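(* Let $v\in\mathbb C^n$, let $k\in\mathbb C$ be nonzero, let $\mathcal O_1\subset\mathbb R^2$ be an open neighbourhood of $(0,0)$, let $u:\mathcal O_1\to\mathcal G_0\cap sl(n)_a^\perp$ be a solution of the KW-equation (admitting a local reduced wave function), and let $E$ be the trivialization of $u$ normalized at $(0,0)$. Let $\tilde v(x,t)=E(x,t,k)^{-1}v$. If $B(v)$ is non-singular, then there exists an open subset $\mathcal O$ of $\mathcal O_1$ containing $(0,0)$ such that $B(\tilde v(x,t))$ is non-singular for all $(x,t)\in\mathcal O$. Moreover: (i) $\tilde u=aua^{-1}+[\tilde Y,a]a^{-1}$ is again a solution of the KW-equation defined on $\mathcal O$, where $\tilde Y(x,t)=-kaB(\tilde v(x,t))aB(\tilde v(x,t))^{-1}$; (ii) $\tilde E(x,t,\lambda)=p_{v,k}(\lambda)E(x,t,\lambda)p_{\tilde v(x,t),k}(\lambda)^{-1}$ is the trivialization of $\tilde u$ normalized at $(0,0)$; (iii) $Y=\tilde Y$ is a solution of $$\begin{cases}Y_x=Yu-(aua^{-1}+[Y,a]a^{-1})Y,\\ Y_t=YQ_{a,n+1}(u)-Q_{a,n+1}(aua^{-1}+[Y,a]a^{-1})Y,\\ \tau^{-1}Y\tau=Y.\end{cases}$$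
   Context: Let $\alpha=e^{2\pi i/n}$, $a=\mathrm{diag}(1,\alpha,\dots,\alpha^{n-1})$, and let $\tau\in GL(n,\mathbb C)$ be the cyclic permutation matrix $\tau(e_i)=e_{i+1}$ (indices mod $n$). $\mathcal G_0=\{y\in gl(n,\mathbb C):\tau^{-1}y\tau=y\}$ (circulant matrices), and $sl(n)_a^\perp$ is the set of matrices with zero diagonal (the trace-orthogonal complement of the centralizer of $a$ in $sl(n,\mathbb C)$). For smooth $u$ with values in $sl(n)_a^\perp$: $Q_{a,0}(u)=a$, and $Q_{a,i}(u)$, $i\ge1$, are the unique matrix-valued polynomials without constant term in the entries of $u$ and their $x$-derivatives such that $(Q_{a,i}(u))_x+[u,Q_{a,i}(u)]=[Q_{a,i+1}(u),a]$ for all $i\ge0$. The KW (Kupershmidt-Wilson) equation is $u_t=(Q_{a,n+1}(u))_x+[u,Q_{a,n+1}(u)]$ for $u$ with values in $\mathcal G_0\cap sl(n)_a^\perp$. The trivialization of $u$ normalized at $(0,0)$ is the solution $E(x,t,\lambda)$ of $E_x=E(a\lambda+u)$, $E_t=E(a\lambda^{n+1}+Q_{a,1}(u)\lambda^n+\dots+Q_{a,n+1}(u))$, $E(0,0,\lambda)=I$. A local reduced wave function of $u$ is a smooth $GL(n,\mathbb C)$-valued $m(x,t,\lambda)$ (away from poles), meromorphic in $\lambda\in\mathbb C\setminus\Gamma_a$, $\Gamma_a=\{\lambda:\mathrm{Re}(\lambda(\alpha^i-\alpha^l))=0\text{ for some }0\le i<l\le n-1\}$, with asymptotic expansion $I+m_1(x,t)\lambda^{-1}+\cdots$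 at $\lambda=\infty$, $u=[a,m_1]$, and $E=m(0,0,\lambda)^{-1}e^{a\lambda x+a\lambda^{n+1}t}m(x,t,\lambda)$. For $v\in\mathbb C^n$, $B(v)$ is the $n\times n$ matrix whose $i$-th column is $\tau^{-(i-1)}(v)$, $1\le i\le n$. If $B(v)$ is non-singular and $k\in\mathbb C$, $p_{v,k}(\lambda)=a\lambda-kaB(v)aB(v)^{-1}$. *)

(* Defs.v *)
From HB Require Import structures.
From mathcomp Require Import all_boot all_order all_algebra.
From mathcomp Require Import finmap.
From mathcomp.real_closed Require Import complex.
From mathcomp Require Import all_classical all_reals all_analysis.
From mathcomp.multinomials Require Import -(notations) monalg.

Set Implicit Arguments.
Unset Strict Implicit.
Unset Printing Implicit Defensive.

Import Order.TTheory GRing.Theory Num.Theory.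
Import numFieldNormedType.Exports.

Local Open Scope classical_set_scope.
Local Open Scope ring_scope.
Local Open Scope complex_scope.

Section Smoothness.
Variable R : realType.

(* Class C^k on the open set D: iterated directional derivatives up to order k,
   in all directions, exist and are continuous on D. *)
Fixpoint Ck (V : normedModType R) (k : nat) (D : set V) (f : V -> R) : Prop :=
  (forall x, D x -> {for x, continuous f}) /\
  match k with
  | 0%N => True
  | k'.+1 => forall w : V,
      (forall x, D x -> derivable f x w) /\ Ck k' D (fun x => 'D_w f x)
  end.

Definition smooth_on (V : normedModType R) (D : set V) (f : V -> R) : Prop :=
  forall k : nat, Ck k D f.

Definition smooth_mx (V : normedModType R) (n : nat) (D : set V)
    (A : V -> 'M[R[i]]_n) : Prop :=
  forall i j : 'I_n, smooth_on D (fun x => complex.Re (A x i j)) /\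
                     smooth_on D (fun x => complex.Im (A x i j)).

Definition dirC (w : R * R) (f : R * R -> R[i]) : R * R -> R[i] :=
  fun p => ('D_w (fun q => complex.Re (f q)) p) +i* ('D_w (fun q => complex.Im (f q)) p).

(* Points of R^2 are pairs (x, t). *)
Definition dx : (R * R -> R[i]) -> R * R -> R[i] := dirC (1, 0).
Definition dt : (R * R -> R[i]) -> R * R -> R[i] := dirC (0, 1).

Definition dxM (n : nat) (A : R * R -> 'M[R[i]]_n) (p : R * R) : 'M[R[i]]_n :=
  \matrix_(i, j) dx (fun q => A q i j) p.
Definition dtM (n : nat) (A : R * R -> 'M[R[i]]_n) (p : R * R) : 'M[R[i]]_n :=
  \matrix_(i, j) dt (fun q => A q i j) p.

End Smoothness.

Section ComplexAnalysis.
Variable R : realType.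
Local Notation C := R[i].

Definition cexp (z : C) : C :=
  (expR (complex.Re z))%:C * ((cos (complex.Im z)) +i* (sin (complex.Im z))).

(* C-differentiability: derivability over the numFieldType C itself. *)
Definition holo_at (f : C -> C) (z : C) : Prop :=
  \forall w \near (z : C^o), derivable (f : C^o -> C^o) w 1.

(* Near z, away from z itself, f is a holomorphic function divided by a power
   of the local coordinate; the value of f at z is irrelevant. *)
Definition mero_at (f : C -> C) (z : C) : Prop :=
  exists (N : nat) (g : C -> C), holo_at g z /\
    \forall w \near (z : C^o)^', f w = g w / (w - z) ^+ N.

End ComplexAnalysis.

Section KW.
Variable R : realType.
Variable n : nat.
Local Notation C := R[i].
Local Notation M := 'M[C]_n.

Definition alpha : C := cexp (0 +i* (2 * pi / n%:R)).

Definition amx : M := diag_mx (\row_(i < n) alpha ^+ i).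

(* tau e_i = e_(i+1), indices mod n. *)
Definition tau : M := \matrix_(i, j) (i == ordS j)%:R.

Definition lie (A B : M) : M := A *m B - B *m A.

Definition circulant (y : M) : Prop := invmx tau *m y *m tau = y.
Definition zero_diag (y : M) : Prop := forall i : 'I_n, y i i = 0.

Definition Gamma_a : set C :=
  [set z | exists i l : 'I_n, (i < l)%N /\ complex.Re (z * (alpha ^+ i - alpha ^+ l)) = 0].

(* Polynomials in the entries of u and of its x-derivatives: the variable
   (k, (r, s)) stands for the k-th x-derivative of the (r, s) entry of u. *)
Definition jetvar : choiceType := (nat * ('I_n * 'I_n))%type.
Definition diffpoly := monalg.malg (monalg.cmonom jetvar) C.

Definition eval_monom (x : jetvar -> C) (m : monalg.cmonom jetvar) : C :=
  \prod_(v <- finsupp (monalg.cmonom_val m)) x v ^+ monalg.cmonom_val m v.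

Definition jet (u : R * R -> M) (p : R * R) (v : jetvar) : C :=
  iter v.1 (@dx R) (fun q => u q v.2.1 v.2.2) p.

Definition eval_dp (P : 'M[diffpoly]_n) (u : R * R -> M) (p : R * R) : M :=
  map_mx (monalg.mmap idfun (eval_monom (jet u p))) P.

(* The sequence Q_(a,i), characterized by its defining conditions.  The
   recursion is an identity for all smooth u with zero diagonal, where t is a
   parameter; it determines each Q_(a,i) as a function of such u, the variables
   (k, (r, r)) being evaluated at 0. *)
Definition is_Qseq (Q : nat -> 'M[diffpoly]_n) : Prop :=
  [/\ Q 0%N = map_mx (monalg.mkmalgU monalg.one) amx,
      forall (i : nat) (r s : 'I_n), (0 < i)%N ->
        monalg.mcoeff monalg.one (Q i r s) = 0
    & forall (D : set (R * R)) (u : R * R -> M),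
        open D -> smooth_mx D u -> (forall p, D p -> zero_diag (u p)) ->
        forall (i : nat) (p : R * R), D p ->
          dxM (eval_dp (Q i) u) p + lie (u p) (eval_dp (Q i) u p)
          = lie (eval_dp (Q i.+1) u p) amx].

Definition is_KW_solution (Q : nat -> 'M[diffpoly]_n) (D : set (R * R))
    (u : R * R -> M) : Prop :=
  smooth_mx D u /\
  forall p, D p ->
    [/\ circulant (u p), zero_diag (u p)
      & dtM u p = dxM (eval_dp (Q n.+1) u) p + lie (u p) (eval_dp (Q n.+1) u p)].

(* The trivialization of u on D normalized at (0, 0); note that
   Q_(a,0)(u) = a supplies the leading term of the second equation. *)
Definition is_trivialization (Q : nat -> 'M[diffpoly]_n) (D : set (R * R))
    (u : R * R -> M) (E : R * R -> C -> M) : Prop :=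
  forall z : C,
    [/\ smooth_mx D (fun p => E p z),
        E (0, 0) z = 1%:M
      & forall p, D p ->
          dxM (fun q => E q z) p = E p z *m (z *: amx + u p) /\
          dtM (fun q => E q z) p =
            E p z *m \sum_(j < n.+2) z ^+ (n.+1 - j) *: eval_dp (Q j) u p].

(* exp (a z x + a z^(n+1) t), the argument being a diagonal matrix. *)
Definition exp_phase (p : R * R) (z : C) : M :=
  diag_mx (\row_(i < n)
    cexp (alpha ^+ i * (z * p.1%:C + z ^+ n.+1 * p.2%:C))).

(* m is a reduced wave function, over the open set D of (x, t), of the solution
   u with trivialization E.  W is the set of ((x, t), (Re z, Im z)) with z
   outside Gamma_a and not a pole of m or m^-1 at (x, t); poles are isolated in
   the complement of Gamma_a.  The mc l are the coefficients m_l of the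
   asymptotic expansion at infinity (in the sense of Poincare, along
   non-poles). *)
Definition is_reduced_wave_function (D : set (R * R)) (u : R * R -> M)
    (E m : R * R -> C -> M) : Prop :=
  exists (W : set ((R * R) * (R * R))) (mc : nat -> R * R -> M),
  let reg p z := W (p, (complex.Re z, complex.Im z)) in
  [/\ open W,
      forall p z, reg p z -> D p /\ ~ Gamma_a z,
      forall p z, D p -> ~ Gamma_a z -> \forall w \near (z : C^o)^', reg p w
    & [/\ smooth_mx W (fun y => m y.1 (y.2.1 +i* y.2.2)),
          forall p z, reg p z ->
            m p z \in unitmx /\ forall i j, holo_at (fun w => m p w i j) z
        & forall p z, D p -> ~ Gamma_a z ->
            forall i j, mero_at (fun w => m p w i j) z]] /\
  [/\ forall p, D p -> mc 0%N p = 1%:M,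
      forall p, D p -> forall (N : nat) (i j : 'I_n) (e : C), 0 < e ->
        exists r : C, forall z, reg p z -> r < `|z| ->
          `|z ^+ N * (m p z - \sum_(l < N.+1) z ^- l *: mc l p) i j| < e,
      forall p, D p -> u p = lie amx (mc 1%N p)
    & forall p z, reg p z -> reg (0, 0) z ->
        E p z = invmx (m (0, 0) z) *m exp_phase p z *m m p z].

(* Column i (counted from 0) is tau^-i v. *)
Definition Bmx (v : 'cV[C]_n) : M :=
  \matrix_(r, i) ((invmx tau ^+ (i : nat)) *m v) r 0.

Definition Ymx (v : 'cV[C]_n) (k : C) : M :=
  - (k *: (amx *m Bmx v *m amx *m invmx (Bmx v))).

Definition pvk (v : 'cV[C]_n) (k z : C) : M :=
  z *: amx - k *: (amx *m Bmx v *m amx *m invmx (Bmx v)).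

Definition vtilde (E : R * R -> C -> M) (v : 'cV[C]_n) (k : C) (p : R * R) :
    'cV[C]_n :=
  invmx (E p k) *m v.

Definition utilde (u Y : R * R -> M) (p : R * R) : M :=
  amx *m u p *m invmx amx + lie (Y p) amx *m invmx amx.

Definition is_BT_solution (Q : nat -> 'M[diffpoly]_n) (D : set (R * R))
    (u Y : R * R -> M) : Prop :=
  smooth_mx D Y /\
  forall p, D p ->
    [/\ dxM Y p = Y p *m u p - utilde u Y p *m Y p,
        dtM Y p = Y p *m eval_dp (Q n.+1) u p
                  - eval_dp (Q n.+1) (utilde u Y) p *m Y p
      & circulant (Y p)].

End KW.

(* Main.v *)
Require Import Defs.
From HB Require Import structures.
From mathcomp Require Import all_boot all_order all_algebra.
From mathcomp Require Import finmap.
From mathcomp.real_closed Require Import complex.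
From mathcomp Require Import ring lra.
From mathcomp Require Import all_classical all_reals all_analysis.
From mathcomp.multinomials Require Import -(notations) monalg.

From Stdlib Require Ncring Ncring_tac.

Set Implicit Arguments.
Unset Strict Implicit.
Unset Printing Implicit Defensive.

Import Order.TTheory GRing.Theory Num.Theory.
Import numFieldNormedType.Exports.

Local Open Scope classical_set_scope.
Local Open Scope ring_scope.
Local Open Scope complex_scope.

(** The theorem is a Darboux transformation with the factor
    p(z) = a z + Y = a (z - Z), where Z = k B a B^-1 and the columns of B are
    the vectors tau^-j vt, with vt = E(k)^-1 v; the value of p at (0, 0) is
    denoted pv.

    Conjugating by tau and multiplying z by alpha preserves the linear system of
    u, because u is circulant and because Q_i has weight alpha^(n+1-i)
    (Qseq_weight).  So tau^-j vt solves the adjoint linear system at alpha^j k,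
    and, writing the connection matrix along a direction w as a polynomial
    W(z) = sum_i c_i z^(N-i), the columns assemble into
    B_w = - sum_i c_i Z^(N-i) B (Bt_flow).  Define h_i by the formal relation
    p(z) sum_i c_i z^-i = sum_i h_i z^-i p(z).  Then the evolution of B becomes
    Y_w = Y c_N - h_N Y (Yt_flow), which is the statement that p(z) intertwines
    the polynomials W(z) and sum_i h_i z^(N-i) (factor_gauge).  For w = x one
    has c = (a, u), h = (a, ut); for w = t one has c_i = Q_i(u), N = n+1.
    The notion flow records exactly what the two directions have in common.

    It remains to see that the coefficients h_i of the t-direction are the
    Q_i(ut).  They satisfy the recursion for ut (lax_dressed), but the recursion
    leaves the diagonal of each term undetermined.  The missing
    condition is that the n-th power of the formal series sum_i Q_i(u) z^-i is
    the identity (Qseq_power): its coefficients satisfy the recursion too, so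
    the first one that could differ from those of the identity is diagonal and
    independent of x; and a differential polynomial without constant term
    that is independent of x along every u vanishes, since a u with prescribed
    jet at one point can be given zero jet at another point.  Intertwining
    preserves the n-th power, and a solution of the recursion with leading
    term a and n-th power 1 is unique (lax_unique).  The same uniqueness gives
    the weights of the Q_i.

    Finally pv(z) E(z) p(z)^-1 is the new trivialization wherever
    z^n <> k^n.  At z^n = k^n the inverse has a pole, while the numerator
    pv(z) E(z) adj(z) vanishes because E maps the kernel of p to the
    kernel of pv (dressed_E_vanishes).  The value there is therefore its
    derivative in z divided by that of z^n - k^n.  The
    derivative of E in z solves an inhomogeneous linear system and is obtained
    by integrating a closed one-form (parameter_derivative). *)

(** * Noncommutative ring identities *)
(** The noncommutative ring tactic needs every ring of the algebraic hierarchy to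
    be presented through its own classes. *)
Section NcRing.
Variable A : pzRingType.

#[local] Instance nc_ops : @Ncring.Ring_ops A 0 1 (@GRing.add A) (@GRing.mul A)
  (fun x y => x - y) (@GRing.opp A) (@eq A) := {}.
#[local] Instance nc_ring : Ncring.Ring (Ro := nc_ops).
Proof.
split; try exact _; rewrite /Algebra_syntax.equality /Algebra_syntax.addition
  /Algebra_syntax.zero /Algebra_syntax.one /Algebra_syntax.opposite
  /Algebra_syntax.subtraction /Algebra_syntax.multiplication; intros;
  rewrite /Ncring.eq_notation /Ncring.add_notation /Ncring.zero_notation
  /Ncring.one_notation /Ncring.mul_notation /Ncring.sub_notation
  /Ncring.opp_notation ?add0r ?mulr1 ?mul1r ?addrN ?mulrDl ?mulrDr ?addrA ?mulrA //.
by rewrite addrC.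
Qed.
End NcRing.
#[global] Existing Instance nc_ops.
#[global] Existing Instance nc_ring.

Ltac nc_ring := Ncring_tac.non_commutative_ring.

(** * Formal series as sequences of coefficients *)
Section Convolution.
Variable A : nzRingType.
Implicit Types (f g h : nat -> A) (a d : A).

Definition conv f g k := \sum_(i < k.+1) f i * g (k - i)%N.
Definition conv1 : nat -> A := fun k => (k == 0)%:R.
Definition cpow f m := iter m (conv f) conv1.

Lemma convE f g N k : (k < N)%N ->
  conv f g k = (\poly_(i < N) f i * \poly_(i < N) g i)`_k.
Proof.
move=> kN; rewrite coefM; apply: eq_bigr => i _; rewrite !coef_poly.
by rewrite (leq_trans (ltn_ord i) kN) (leq_ltn_trans (leq_subr _ _) kN).
Qed.

Lemma convA f g h : conv f (conv g h) = conv (conv f g) h.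
Proof.
apply/funext => k; set N := k.+1.
transitivity ((\poly_(i < N) f i * (\poly_(i < N) g i * \poly_(i < N) h i))`_k).
  rewrite coefM; apply: eq_bigr => i _; rewrite coef_poly ltn_ord; congr (_ * _).
  by apply: convE; rewrite ltnS leq_subr.
rewrite mulrA coefM; apply: eq_bigr => i _; congr (_ * _).
  by rewrite (@convE _ _ N).
by rewrite coef_poly ltnS leq_subr.
Qed.

Lemma conv1l f : conv conv1 f = f.
Proof.
apply/funext => k; rewrite /conv big_ord_recl /conv1 /= mul1r subn0 big1 ?addr0//.
by move=> i _; rewrite mul0r.
Qed.

Lemma conv1r f : conv f conv1 = f.
Proof.
apply/funext => k; rewrite /conv big_ord_recr /= subnn /conv1 eqxx mulr1 big1 ?add0r//.
by move=> i _; rewrite subn_eq0 leqNgt ltn_ord mulr0.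
Qed.

Lemma conv_0 f g : conv f g 0 = f 0%N * g 0%N.
Proof. by rewrite /conv big_ord1. Qed.

Lemma cpow_0 f m : cpow f m 0 = f 0%N ^+ m.
Proof. by elim: m => [|m IH] //=; rewrite conv_0 IH exprS. Qed.

Lemma cpow_intertwine (p f g : nat -> A) m : conv p f = conv g p ->
  conv p (cpow f m) = conv (cpow g m) p.
Proof.
move=> e; elim: m => [|m IH] /=; first by rewrite conv1l conv1r.
by rewrite convA e -convA IH convA.
Qed.

Lemma conv_cancelr (p f g : nat -> A) (b : A) : p 0%N * b = 1 ->
  conv f p = conv g p -> f = g.
Proof.
move=> pb e; apply/funext; elim/ltn_ind => k IH.
have := congr1 (fun h => h k) e; rewrite /= /conv !big_ord_recr /= subnn.
have -> : \sum_(i < k) f i * p (k - i)%N = \sum_(i < k) g i * p (k - i)%N.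
  by apply: eq_bigr => i _; rewrite IH.
by move/addrI/(congr1 (fun x => x * b)); rewrite -!mulrA pb !mulr1.
Qed.

(** If the difference d of the first coefficients that may differ commutes with
    the leading one, the m-th powers differ there by m f_0^(m-1) d; so equal
    powers force d = 0 in characteristic zero. *)
Lemma cpow_first_difference f g l m : (0 < l)%N ->
  (forall i, (i < l)%N -> f i = g i) -> f l * f 0%N - f 0%N * f l = g l * g 0%N - g 0%N * g l ->
  (forall i, (i < l)%N -> cpow f m i = cpow g m i) /\
  (cpow f m l - cpow g m l) * f 0%N = f 0%N ^+ m * (f l - g l) *+ m.
Proof.
move=> l0 fg e; have fg0 := fg _ l0.
have comm : f 0%N * (f l - g l) = (f l - g l) * f 0%N.
  apply/eqP; rewrite -subr_eq0; apply/eqP; rewrite -fg0 in e.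
  have -> : f 0%N * (f l - g l) - (f l - g l) * f 0%N =
    (g l * f 0%N - f 0%N * g l) - (f l * f 0%N - f 0%N * f l) by nc_ring.
  by rewrite e subrr.
elim: m => [|m [IH1 IH2]]; first by split=> //=; rewrite subrr mul0r mulr0n.
split=> /= [i il|].
  rewrite /conv; apply: eq_bigr => j _.
  by rewrite fg ?IH1// (leq_ltn_trans _ il)// ?leq_subr// -ltnS.
case: l l0 fg e comm IH1 IH2 => // l _ fg e comm IH1 IH2.
rewrite /conv !(big_ord_recl l.+1) !big_ord_recr /= /bump !add1n !subn0 !subnn !cpow_0 -fg0.
have -> : \sum_(i < l) f (bump 0 (widen_ord (leqnSn l) i)) *
            cpow f m (l.+1 - bump 0 (widen_ord (leqnSn l) i)) =
          \sum_(i < l) g (bump 0 (widen_ord (leqnSn l) i)) *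
            cpow g m (l.+1 - bump 0 (widen_ord (leqnSn l) i)).
  apply: eq_bigr => i _; rewrite /bump /= add1n fg ?ltnS// IH1//.
  by rewrite ltnS subSS leq_subr.
set s := \sum_(i < l) _; set x := cpow f m _; set y := cpow g m _.
have -> : f 0%N * x + (s + f l.+1 * f 0%N ^+ m) - (f 0%N * y + (s + g l.+1 * f 0%N ^+ m))
   = f 0%N * (x - y) + (f l.+1 - g l.+1) * f 0%N ^+ m by nc_ring.
rewrite mulrDl -mulrA IH2 mulrnAr mulrA -exprS -mulrA -exprSr.
by rewrite (commrX m.+1 (esym comm)) mulrS addrC.
Qed.

(** The recursion f'_i + [u, f_i] = [f_(i+1), a] says that the formal series
    commutes with d/dx + a z + u, and the commutator is a derivation. *)
Lemma conv_lax a u f g f' g' k :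
  f 0%N * a = a * f 0%N -> g 0%N * a = a * g 0%N ->
  (forall i, f' i + (u * f i - f i * u) = f i.+1 * a - a * f i.+1) ->
  (forall i, g' i + (u * g i - g i * u) = g i.+1 * a - a * g i.+1) ->
  \sum_(i < k.+1) (f' i * g (k - i)%N + f i * g' (k - i)%N)
    + (u * conv f g k - conv f g k * u)
  = conv f g k.+1 * a - a * conv f g k.+1.
Proof.
move=> f0 g0 ef eg.
have -> : conv f g k.+1 * a - a * conv f g k.+1 =
    \sum_(i < k.+2) f i * (g (k.+1 - i)%N * a - a * g (k.+1 - i)%N) +
    \sum_(i < k.+2) (f i * a - a * f i) * g (k.+1 - i)%N.
  rewrite /conv mulr_suml mulr_sumr -sumrB -big_split/=.
  by apply: eq_bigr => i _; nc_ring.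
rewrite [X in _ = X + _]big_ord_recr [X in _ = _ + X]big_ord_recl /= subnn g0 f0 !subrr mulr0 mul0r.
rewrite addr0 add0r.
rewrite /conv mulr_suml mulr_sumr -sumrB -!big_split/=; apply: eq_bigr => i _.
have ik : (i <= k)%N by rewrite -ltnS.
rewrite /bump /= add1n subSS (subSn ik) -(ef i) -(eg (k - i)%N).
by set x := g (k - i)%N; nc_ring.
Qed.

End Convolution.

(** * Intertwining with a factor linear in the spectral parameter *)
Section Dressing.
Variable A : nzRingType.
Implicit Types (a b u ut Y Z : A) (q h c : nat -> A).

(** The coefficients of z^-1 (a z + Y). *)
Definition lin a Y : nat -> A := fun i => if i is i'.+1 then (if i' is 0%N then Y else 0) else a.

Lemma conv_linl a Y q k : conv (lin a Y) q k.+1 = a * q k.+1 + Y * q k.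
Proof.
rewrite /conv !big_ord_recl big1 /= ?addr0 ?subn0 ?subn1// => i _.
by rewrite mul0r.
Qed.

Lemma conv_linr a Y q k : conv q (lin a Y) k.+1 = q k.+1 * a + q k * Y.
Proof.
rewrite /conv !big_ord_recr big1 /= ?add0r ?subnn.
  by rewrite subSn// subnn addrC.
move=> i _; rewrite subSn ?(ltnW (ltn_ord i))//=.
have : (0 < k - i)%N by rewrite subn_gt0.
by case: (k - i)%N => // j _; rewrite mulr0.
Qed.

(** The coefficients of (a z + Y) q(z) (a z + Y)^-1, when b is the inverse of a
    and q_0 = a. *)
Fixpoint dress a b Y q i : A :=
  if i is j.+1 then (a * q j.+1 + Y * q j - dress a b Y q j * Y) * b else a.

Lemma dressE a b Y q i : b * a = 1 ->
  dress a b Y q i.+1 * a + dress a b Y q i * Y = a * q i.+1 + Y * q i.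
Proof. by move=> ba; rewrite /= -mulrA ba mulr1 subrK. Qed.

(** Intertwining passes to powers, and the factor a z + Y can be cancelled because
    its leading coefficient is invertible. *)
Lemma dress_power a b Y q m : b * a = 1 -> a * b = 1 -> q 0%N = a ->
  cpow q m = conv1 A -> cpow (dress a b Y q) m = conv1 A.
Proof.
move=> ba ab q0 qm.
have e : conv (lin a Y) q = conv (dress a b Y q) (lin a Y).
  apply/funext => -[|k]; first by rewrite !conv_0 /= q0.
  by rewrite conv_linl conv_linr dressE.
have := cpow_intertwine m e; rewrite qm conv1r -[X in X = _]conv1l.
by move/(conv_cancelr (b := b)) => ->.
Qed.

(** The first two terms of the recursion for the dressed sequence.  Commuting
    with d/dx + a z + u turns into commuting with d/dx + a z + ut; in terms of
    coefficients, the defect X of each relation satisfies X a = 0 because X a is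
    a combination of the defects of the hypotheses. *)
Lemma dress_lax0 a b u ut Y (q1 h1 : A) : a * b = 1 -> ut * a = a * u + Y * a - a * Y ->
  u * a - a * u = q1 * a - a * q1 -> h1 * a + a * Y = a * q1 + Y * a ->
  ut * a - a * ut = h1 * a - a * h1.
Proof.
move=> ab e1 e2 e3; apply/eqP; rewrite -subr_eq0; apply/eqP.
set X := _ - _; suff : X * a = 0.
  by move/(congr1 (fun x => x * b)); rewrite -mulrA ab mulr1 mul0r.
have -> : X * a =
    (ut * a - (a * u + Y * a - a * Y)) * a - a * (ut * a - (a * u + Y * a - a * Y))
  + a * ((u * a - a * u) - (q1 * a - a * q1))
  - ((h1 * a + a * Y) - (a * q1 + Y * a)) * a
  + a * ((h1 * a + a * Y) - (a * q1 + Y * a)) by rewrite /X; nc_ring.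
by rewrite e1 e2 e3 !subrr !(mul0r, mulr0, subr0, addr0).
Qed.

Lemma dress_laxS a b u ut Y (q0 q1 q2 h0 h1 h2 dY dq0 dq1 dh0 dh1 : A) : a * b = 1 ->
  ut * a = a * u + Y * a - a * Y -> dY = Y * u - ut * Y ->
  dq0 + (u * q0 - q0 * u) = q1 * a - a * q1 ->
  dq1 + (u * q1 - q1 * u) = q2 * a - a * q2 ->
  h1 * a + h0 * Y = a * q1 + Y * q0 -> h2 * a + h1 * Y = a * q2 + Y * q1 ->
  dh1 * a + (dh0 * Y + h0 * dY) = a * dq1 + (dY * q0 + Y * dq0) ->
  dh0 + (ut * h0 - h0 * ut) = h1 * a - a * h1 ->
  dh1 + (ut * h1 - h1 * ut) = h2 * a - a * h2.
Proof.
move=> ab e1 e2 e3 e4 e5 e6 e7 e8; apply/eqP; rewrite -subr_eq0; apply/eqP.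
set X := _ - _; suff : X * a = 0.
  by move/(congr1 (fun x => x * b)); rewrite -mulrA ab mulr1 mul0r.
pose r1 := ut * a - (a * u + Y * a - a * Y).
pose r2 := dY - (Y * u - ut * Y).
pose r3 := dq0 + (u * q0 - q0 * u) - (q1 * a - a * q1).
pose r4 := dq1 + (u * q1 - q1 * u) - (q2 * a - a * q2).
pose r5 := h1 * a + h0 * Y - (a * q1 + Y * q0).
pose r6 := h2 * a + h1 * Y - (a * q2 + Y * q1).
pose r7 := dh1 * a + (dh0 * Y + h0 * dY) - (a * dq1 + (dY * q0 + Y * dq0)).
pose r8 := dh0 + (ut * h0 - h0 * ut) - (h1 * a - a * h1).
have -> : X * a = r7 - r8 * Y - h0 * r2 + a * r4 + r2 * q0 + Y * r3 + ut * r5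
   - h1 * r1 - r6 * a + a * r6 - r5 * u + r1 * q1.
  by rewrite /X /r1 /r2 /r3 /r4 /r5 /r6 /r7 /r8; nc_ring.
rewrite /r1 /r2 /r3 /r4 /r5 /r6 /r7 /r8 -e1 -e2 e3 e4 e5 e6 e7 e8.
by rewrite !subrr !(mul0r, mulr0, subr0, addr0).
Qed.

(** The polynomial sum_(i <= N) q_i X^(N-i), that is the polynomial part of X^N
    times the series of q. *)
Fixpoint tpoly q N : {poly A} :=
  if N is M.+1 then tpoly q M * 'X + (q M.+1)%:P else (q 0%N)%:P.

(** The two sides of the intertwining relation of the full series, multiplied by
    X^N and truncated, differ by the constant term Y q_N - h_N Y only. *)
Lemma tpoly_gauge a Y q h N : q 0%N = a -> h 0%N = a ->
  (forall i, (i < N)%N -> h i.+1 * a + h i * Y = a * q i.+1 + Y * q i) ->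
  tpoly (lin a Y) 1 * tpoly q N - (Y * q N - h N * Y)%:P = tpoly h N * tpoly (lin a Y) 1.
Proof.
move=> q0 h0 e; apply/eqP; rewrite subr_eq addrC -subr_eq; apply/eqP.
elim: N e => [|N IH] e.
  rewrite /= q0 h0 polyCB !polyCM; set ap := a%:P; set Yp := Y%:P.
  have Xa : 'X * ap = ap * 'X by rewrite commr_polyX.
  transitivity (Yp * ap - ap * Yp + ap * ('X * ap - ap * 'X)); first by nc_ring.
  by rewrite Xa subrr mulr0 addr0.
have {}IH := IH (fun i iN => e i (ltnW iN)).
rewrite [tpoly q _]/= [tpoly h _]/=; set L := tpoly (lin a Y) 1 in IH *.
have XL : 'X * L = L * 'X by rewrite commr_polyX.
have -> : L * (tpoly q N * 'X + (q N.+1)%:P) - (tpoly h N * 'X + (h N.+1)%:P) * L =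
   (L * tpoly q N - tpoly h N * L) * 'X + (L * (q N.+1)%:P - (h N.+1)%:P * L) +
   tpoly h N * (L * 'X - 'X * L) by nc_ring.
rewrite XL subrr mulr0 addr0 IH /L /= !(polyCB, polyCM).
have := congr1 polyC (e N (ltnSn N)); rewrite !(polyCD, polyCM).
set ap := a%:P; set Yp := Y%:P; set q1 := (q N.+1)%:P; set h1 := (h N.+1)%:P.
set q0' := (q N)%:P; set h0' := (h N)%:P => e'.
have Xq : 'X * q1 = q1 * 'X by rewrite commr_polyX.
transitivity (Yp * q1 - h1 * Yp + ap * ('X * q1 - q1 * 'X)
    - (h1 * ap + h0' * Yp - (ap * q1 + Yp * q0')) * 'X); first by nc_ring.
by rewrite Xq e' !subrr mulr0 mul0r subr0 addr0.
Qed.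

(** When B evolves by - S B with S = sum_i q_i Z^(N-i), the matrix Z = k B a B^-1
    evolves by Z S - S Z; the intertwining relation makes this sum telescope. *)
Lemma dressing_commutator Z q h N : h 0%N = q 0%N ->
  (forall i, (i < N)%N -> h i.+1 - h i * Z = q i.+1 - Z * q i) ->
  Z * (\sum_(i < N.+1) q i * Z ^+ (N - i)) - (\sum_(i < N.+1) q i * Z ^+ (N - i)) * Z
  = Z * q N - h N * Z.
Proof.
move=> h0; elim: N => [|N IH] e.
  by rewrite !big_ord1 expr0 mulr1 h0.
have {}IH := IH (fun i iN => e i (ltnW iN)).
have -> : \sum_(i < N.+2) q i * Z ^+ (N.+1 - i) =
    (\sum_(i < N.+1) q i * Z ^+ (N - i)) * Z + q N.+1.
  rewrite big_ord_recr /= subnn expr0 mulr1 mulr_suml; congr (_ + _).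
  apply: eq_bigr => i _; rewrite -mulrA -exprSr subSn//.
  by rewrite -ltnS.
set S := \sum_(i < _) _ in IH *.
have e' := e N (ltnSn N).
have -> : Z * (S * Z + q N.+1) - (S * Z + q N.+1) * Z =
   (Z * S - S * Z) * Z + Z * q N.+1 - q N.+1 * Z by nc_ring.
rewrite IH.
have -> : h N.+1 = q N.+1 - Z * q N + h N * Z by rewrite -e' subrK.
nc_ring.
Qed.

(** (sum_i Z^i X^(N-i)) (X - Z) = X^(N+1) - Z^(N+1), with a moved across:
    the sum plays the role of the adjugate of a X + Y. *)
Lemma tpoly_adj_factor a b Y Z N : a * b = 1 -> b * a = 1 -> Y = - (a * Z) ->
  tpoly (fun i => Z ^+ i * b) N * tpoly (lin a Y) 1 = 'X ^+ N.+1 - (Z ^+ N.+1)%:P.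
Proof.
move=> ab ba ->; set L := tpoly _ 1.
have bL : b%:P * L = 'X - Z%:P.
  by rewrite /L /= mulrDr mulrA -!polyCM mulrN mulrA ba mul1r mul1r polyCN.
elim: N => [|N IH].
  by rewrite /= expr0 mul1r bL expr1.
rewrite [tpoly _ N.+1]/= mulrDl -mulrA (_ : 'X * L = L * 'X); last by rewrite commr_polyX.
rewrite mulrA IH polyCM -mulrA bL mulrBl mulrBr -exprSr -polyCM -exprSr addrA.
by rewrite subrK.
Qed.

Lemma tpoly_factor_adj a b Y Z N : a * b = 1 -> Y = - (a * Z) ->
  tpoly (lin a Y) 1 * tpoly (fun i => Z ^+ i * b) N = a%:P * ('X ^+ N.+1 - (Z ^+ N.+1)%:P) * b%:P.
Proof.
move=> ab ->; set L := tpoly _ 1.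
have L' : L = a%:P * ('X - Z%:P).
  by rewrite /L /= mulrBr -polyCM polyCN.
rewrite L' -!mulrA; congr (_ * _).
elim: N => [|N IH].
  by rewrite /= expr0 mul1r expr1.
rewrite [tpoly _ N.+1]/= polyCM (exprSr 'X N.+1) (exprS Z N.+1) (polyCM Z).
set P := tpoly _ N in IH *; set zm := (Z ^+ N.+1)%:P in IH *; set bp := b%:P in IH *.
set Xm := 'X ^+ N.+1 in IH *; set z := Z%:P in IH *.
have Xb : 'X * bp = bp * 'X by rewrite commr_polyX.
have Xz : 'X * zm = zm * 'X by rewrite commr_polyX.
transitivity (((('X - z) * P) - (Xm - zm) * bp) * 'X + ('X * zm - zm * 'X) * bp
  + (Xm * 'X - z * zm) * bp - (Xm - zm) * ('X * bp - bp * 'X)); first by nc_ring.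
by rewrite IH Xb Xz !subrr !mul0r mulr0 subr0 !add0r.
Qed.

(** The Leibniz rule for the product of the two factors above, s and ds being the
    powers of Z and their derivatives. *)
Lemma tpoly_adj_leibniz a b Y Z dY dZ (s ds : nat -> A) N : b * a = 1 ->
  Y = - (a * Z) -> dY = - (a * dZ) -> ds 0%N = 0 -> s 0%N = 1 ->
  (forall i, ds i.+1 = ds i * Z + s i * dZ) ->
  tpoly (fun i => ds i * b) N * tpoly (lin a Y) 1 + tpoly (fun i => s i * b) N * dY%:P
  = - (ds N.+1)%:P.
Proof.
move=> ba -> -> d0 s0 dsS; set L := tpoly (lin a _) 1; set dYp := (- _)%:P.
have bL : b%:P * L = 'X - Z%:P.
  by rewrite /L /= mulrDr mulrA -!polyCM mulrN mulrA ba !mul1r polyCN.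
have bdY : b%:P * dYp = - dZ%:P.
  by rewrite /dYp -polyCM mulrN mulrA ba mul1r polyCN.
elim: N => [|N IH].
  by rewrite /= dsS d0 s0 !(mul0r, mul1r, add0r, polyC0) bdY.
rewrite [tpoly _ N.+1]/= [X in _ + X * _]/= (dsS N.+1) polyCD !polyCM.
set dP := tpoly _ N in IH *; set P := tpoly _ N in IH *.
set d := (ds N.+1)%:P in IH *; set t := (s N.+1)%:P.
have XL : 'X * L = L * 'X by rewrite commr_polyX.
have Xd : 'X * dYp = dYp * 'X by rewrite commr_polyX.
transitivity ((dP * L + P * dYp) * 'X + d * (b%:P * L) + t * (b%:P * dYp)
   + dP * ('X * L - L * 'X) + P * ('X * dYp - dYp * 'X)); first by nc_ring.
by rewrite IH bL bdY XL Xd !subrr !mulr0 !addr0; nc_ring.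
Qed.

(** The adjugate P is (X^(N+1) - k) L^-1, so its derivative follows from that of
    L; the inverse is avoided by cancelling a monic polynomial. *)
Lemma adj_derive (P dP L dL W Wt : {poly A}) (k : A) N :
  P * L = 'X ^+ N.+1 - k%:P -> L * P = 'X ^+ N.+1 - k%:P ->
  (forall p : {poly A}, ('X ^+ N.+1 - k%:P) * p = p * ('X ^+ N.+1 - k%:P)) ->
  dP * L + P * dL = 0 -> L * W - dL = Wt * L -> dP = P * Wt - W * P.
Proof.
move=> e1 e2 cm e3 e4; apply/eqP; rewrite -subr_eq0; apply/eqP.
have Hr : GRing.rreg ('X ^+ N.+1 - k%:P) by apply/monic_rreg; rewrite monicXnsubC.
apply: Hr; rewrite mul0r -{1}e2 mulrA.
suff -> : (dP - (P * Wt - W * P)) * L = 0 by rewrite mul0r.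
have -> : (dP - (P * Wt - W * P)) * L = (dP * L + P * dL)
  + P * ((L * W - dL) - Wt * L) + (W * (P * L) - (P * L) * W) by nc_ring.
by rewrite e3 e4 e1 subrr mulr0 cm subrr !addr0.
Qed.

End Dressing.

(** * Smooth real functions *)
Section RealSmooth.
Context {R : realType} {V : normedModType R}.
Implicit Types (D : set V) (f g : V -> R) (k : nat).

Lemma Ck_continuous k D f : Ck k D f -> forall x, D x -> {for x, continuous f}.
Proof. by case: k => [|k] []. Qed.

Lemma CkW k D f : Ck k.+1 D f -> Ck k D f.
Proof.
elim: k f => [|k IH] f [cf df]; first by split.
by split=> // w; have [dw /IH] := df w.
Qed.

Lemma open_near D x : open D -> D x -> \forall y \near x, D y.
Proof. by move=> oD Dx; exact: open_nbhs_nbhs. Qed.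

Lemma eq_open_near D f g x : open D -> {in D, f =1 g} -> D x -> {near x, f =1 g}.
Proof.
by move=> oD fg Dx; apply: filterS (open_near oD Dx) => y Dy; apply: fg; rewrite inE.
Qed.

Lemma derive_open D f g x w : open D -> {in D, f =1 g} -> D x ->
  'D_w f x = 'D_w g x.
Proof.
move=> oD fg Dx; have [->|w0] := eqVneq w 0; first by rewrite !derive0.
by apply: near_eq_derive => //; exact: eq_open_near fg Dx.
Qed.

Lemma derivable_open D f g x w : open D -> {in D, f =1 g} -> D x ->
  derivable f x w -> derivable g x w.
Proof.
move=> oD fg Dx; have [->|w0] := eqVneq w 0; first by move=> _; exact: derivable0.
by apply: near_eq_derivable => //; exact: eq_open_near fg Dx.
Qed.

Lemma Ck_open k D f g : open D -> {in D, f =1 g} -> Ck k D f -> Ck k D g.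
Proof.
move=> oD; elim: k f g => [|k IH] f g fg [cf df].
  split=> // x Dx; rewrite /prop_for /continuous_at -(fg x) ?inE//.
  apply: cvg_trans (cf _ Dx); apply: near_eq_cvg.
  exact: eq_open_near fg Dx.
split=> [x Dx|w].
  rewrite /prop_for /continuous_at -(fg x) ?inE//.
  apply: cvg_trans (cf _ Dx); apply: near_eq_cvg.
  exact: eq_open_near fg Dx.
have [dw cw] := df w; split=> [x Dx|]; first exact: derivable_open fg Dx (dw _ Dx).
by apply: IH cw => x; rewrite inE => Dx; exact: derive_open fg Dx.
Qed.

Lemma Ck_cst k D (c : R) : Ck k D (fun=> c).
Proof.
elim: k c => [|k IH] c; first by split=> // x _; exact: cst_continuous.
split=> [x _|w]; first exact: cst_continuous.
split=> [x _|]; first exact: derivable_cst.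
have -> : (fun x : V => 'D_w (fun=> c) x) = fun=> (0 : R); last exact: IH.
by apply/funext=> x; rewrite derive_cst.
Qed.

Lemma CkD k D f g : open D -> Ck k D f -> Ck k D g -> Ck k D (fun x => f x + g x).
Proof.
move=> oD; elim: k f g => [|k IH] f g [cf df] [cg dg].
  by split=> // x Dx; apply: continuousD; [exact: cf|exact: cg].
split=> [x Dx|w]; first by apply: continuousD; [exact: cf|exact: cg].
have [dfw cfw] := df w; have [dgw cgw] := dg w; split=> [x Dx|].
  by apply: derivableD; [exact: dfw|exact: dgw].
apply: Ck_open (IH _ _ cfw cgw) => // x; rewrite inE => Dx.
by rewrite -deriveD//; [exact: dfw|exact: dgw].
Qed.

Lemma CkM k D f g : open D -> Ck k D f -> Ck k D g -> Ck k D (fun x => f x * g x).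
Proof.
move=> oD; elim: k f g => [|k IH] f g Hf Hg.
  split=> // x Dx; apply: continuousM; [exact: (Ck_continuous Hf)|exact: (Ck_continuous Hg)].
split=> [x Dx|w]; first by apply: continuousM; [exact: (Ck_continuous Hf)|exact: (Ck_continuous Hg)].
case: (Hf) => cf /(_ w)[dfw cfw]; case: (Hg) => cg /(_ w)[dgw cgw].
split=> [x Dx|].
  by apply: derivableM; [exact: dfw|exact: dgw].
apply: (Ck_open (f := fun x => f x * 'D_w g x + g x * 'D_w f x)) => //.
  move=> x; rewrite inE => Dx.
  by rewrite -[in RHS]/(f * g) deriveM//; [exact: dfw|exact: dgw].
by apply: CkD => //; apply: IH => //; exact: CkW.
Qed.

Lemma CkV k D f : open D -> {in D, forall x, f x != 0} -> Ck k D f ->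
  Ck k D (fun x => (f x)^-1).
Proof.
move=> oD f0; elim: k => [|k IH] Hf.
  split=> // x Dx; apply: continuousV; last exact: (Ck_continuous Hf).
  by apply: f0; rewrite inE.
have {}IH := IH (CkW Hf).
case: (Hf) => cf /[dup] df _; split=> [x Dx|w].
  by apply: continuousV; [apply: f0; rewrite inE|exact: cf].
have [dfw cfw] := df w; split=> [x Dx|].
  by apply: derivableV; [apply: f0; rewrite inE|exact: dfw].
apply: (Ck_open (f := fun x => (-1) * ((f x)^-1 * (f x)^-1 * 'D_w f x))) => //.
  move=> x; rewrite inE => Dx; rewrite deriveV; last exact: dfw.
    by rewrite mulN1r expr2 invfM scaleNr.
  by apply: f0; rewrite inE.
by apply: CkM (Ck_cst _ _ _) _ => //; do 2?apply: CkM.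
Qed.

Lemma smooth_continuous D f x : smooth_on D f -> D x -> {for x, continuous f}.
Proof. by move=> sf; exact: (Ck_continuous (sf 0%N)). Qed.

Lemma smooth_derivable D f x w : smooth_on D f -> D x -> derivable f x w.
Proof. by move=> /(_ 1%N)[_ /(_ w)[dw _]] /dw. Qed.

Lemma smooth_derive D f w : smooth_on D f -> smooth_on D (fun x => 'D_w f x).
Proof. by move=> sf k; have [_ /(_ w)[]] := sf k.+1. Qed.

Lemma smooth_open D f g : open D -> {in D, f =1 g} -> smooth_on D f -> smooth_on D g.
Proof. by move=> oD fg sf k; exact: Ck_open (sf k). Qed.

Lemma smooth_cst D (c : R) : smooth_on D (fun=> c).
Proof. by move=> k; exact: Ck_cst. Qed.

Lemma smoothD D f g : open D -> smooth_on D f -> smooth_on D g ->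
  smooth_on D (fun x => f x + g x).
Proof. by move=> oD sf sg k; exact: CkD. Qed.

Lemma smoothM D f g : open D -> smooth_on D f -> smooth_on D g ->
  smooth_on D (fun x => f x * g x).
Proof. by move=> oD sf sg k; exact: CkM. Qed.

Lemma smoothN D f : open D -> smooth_on D f -> smooth_on D (fun x => - f x).
Proof.
move=> oD sf; apply: (smooth_open (f := fun x => -1 * f x)) => //.
  by move=> x _; rewrite mulN1r.
by apply: smoothM => //; exact: smooth_cst.
Qed.

Lemma smoothV D f : open D -> {in D, forall x, f x != 0} -> smooth_on D f ->
  smooth_on D (fun x => (f x)^-1).
Proof. by move=> oD f0 sf k; exact: CkV. Qed.

Lemma CkS k D D' f : D' `<=` D -> Ck k D f -> Ck k D' f.
Proof.
move=> sD; elim: k f => [|k IH] f [cf df]; first by split=> // x /sD; exact: cf.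
split=> [x /sD|w]; first exact: cf.
by have [dw cw] := df w; split=> [x /sD|]; [exact: dw|exact: IH].
Qed.

Lemma smoothS D D' f : D' `<=` D -> smooth_on D f -> smooth_on D' f.
Proof. by move=> sD sf k; exact: CkS (sf k). Qed.

Lemma smooth_of_derive D f :
  (forall x, D x -> {for x, continuous f}) ->
  (forall w, (forall x, D x -> derivable f x w) /\ smooth_on D (fun x => 'D_w f x)) ->
  smooth_on D f.
Proof.
move=> cf df [|k]; split=> // w; have [dw sw] := df w; split=> //; exact: sw.
Qed.

End RealSmooth.

(** * Smooth complex and matrix functions on the plane *)
Section ComplexSmooth.
Context {R : realType}.
Local Notation C := R[i].
Implicit Types (D : set (R * R)) (f g : R * R -> C) (w p : R * R).

Definition smoothC D f := smooth_on D (fun x => complex.Re (f x)) /\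
  smooth_on D (fun x => complex.Im (f x)).

Lemma ReD (x y : C) : complex.Re (x + y) = complex.Re x + complex.Re y.
Proof. by case: x y => [? ?] []. Qed.
Lemma ImD (x y : C) : complex.Im (x + y) = complex.Im x + complex.Im y.
Proof. by case: x y => [? ?] []. Qed.
Lemma ReM (x y : C) : complex.Re (x * y) =
  complex.Re x * complex.Re y - complex.Im x * complex.Im y.
Proof. by case: x y => [? ?] []. Qed.
Lemma ImM (x y : C) : complex.Im (x * y) =
  complex.Re x * complex.Im y + complex.Im x * complex.Re y.
Proof. by case: x y => [? ?] []. Qed.

Lemma smoothC_open D f g : open D -> {in D, f =1 g} -> smoothC D f -> smoothC D g.
Proof.
move=> oD fg [sr si]; split.
  by apply: smooth_open sr => // x Dx; rewrite fg.
by apply: smooth_open si => // x Dx; rewrite fg.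
Qed.

Lemma smoothCS D D' f : D' `<=` D -> smoothC D f -> smoothC D' f.
Proof. by move=> sD [sr si]; split; exact: (smoothS sD). Qed.

Lemma smoothC_cst D (c : C) : smoothC D (fun=> c).
Proof. by split; exact: smooth_cst. Qed.

Lemma smoothCD D f g : open D -> smoothC D f -> smoothC D g ->
  smoothC D (fun x => f x + g x).
Proof.
move=> oD [fr fi] [gr gi]; split.
  by apply: (smooth_open oD _ (smoothD oD fr gr)) => x _; rewrite ReD.
by apply: (smooth_open oD _ (smoothD oD fi gi)) => x _; rewrite ImD.
Qed.

Lemma smoothCM D f g : open D -> smoothC D f -> smoothC D g ->
  smoothC D (fun x => f x * g x).
Proof.
move=> oD [fr fi] [gr gi]; split.
  apply: (smooth_open oD _ (smoothD oD (smoothM oD fr gr)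
    (smoothN oD (smoothM oD fi gi)))) => x _; by rewrite ReM.
apply: (smooth_open oD _ (smoothD oD (smoothM oD fr gi)
    (smoothM oD fi gr))) => x _; by rewrite ImM.
Qed.

Lemma smoothCN D f : open D -> smoothC D f -> smoothC D (fun x => - f x).
Proof.
move=> oD sf; apply: (smoothC_open oD _ (smoothCM oD (smoothC_cst D (-1)) sf)).
by move=> x _; rewrite mulN1r.
Qed.

Lemma smoothC_sum D (I : Type) (r : seq I) (P : pred I) (F : I -> R * R -> C) :
  open D -> (forall i, P i -> smoothC D (F i)) ->
  smoothC D (fun x => \sum_(i <- r | P i) F i x).
Proof.
move=> oD sF; elim: r => [|i r IH].
  by apply: (smoothC_open oD _ (smoothC_cst D 0)) => x _; rewrite big_nil.
have [Pi|nPi] := boolP (P i); last first.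
  by apply: (smoothC_open oD _ IH) => x _; rewrite big_cons (negPf nPi).
by apply: (smoothC_open oD _ (smoothCD oD (sF _ Pi) IH)) => x _; rewrite big_cons Pi.
Qed.

Lemma smoothC_prod D (I : Type) (r : seq I) (P : pred I) (F : I -> R * R -> C) :
  open D -> (forall i, P i -> smoothC D (F i)) ->
  smoothC D (fun x => \prod_(i <- r | P i) F i x).
Proof.
move=> oD sF; elim: r => [|i r IH].
  by apply: (smoothC_open oD _ (smoothC_cst D 1)) => x _; rewrite big_nil.
have [Pi|nPi] := boolP (P i); last first.
  by apply: (smoothC_open oD _ IH) => x _; rewrite big_cons (negPf nPi).
by apply: (smoothC_open oD _ (smoothCM oD (sF _ Pi) IH)) => x _; rewrite big_cons Pi.
Qed.

Lemma smoothCX D f m : open D -> smoothC D f -> smoothC D (fun x => f x ^+ m).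
Proof.
move=> oD sf; elim: m => [|m IH].
  by apply: (smoothC_open oD _ (smoothC_cst D 1)) => x _; rewrite expr0.
by apply: (smoothC_open oD _ (smoothCM oD sf IH)) => x _; rewrite exprS.
Qed.

Lemma smoothCV D f : open D -> {in D, forall x, f x != 0} -> smoothC D f ->
  smoothC D (fun x => (f x)^-1).
Proof.
move=> oD f0 [fr fi].
have sn := smoothD oD (smoothM oD fr fr) (smoothM oD fi fi).
have n0 : {in D, forall x, complex.Re (f x) * complex.Re (f x)
    + complex.Im (f x) * complex.Im (f x) != 0}.
  move=> x /f0; case: (f x) => a b /=; apply: contra => /eqP.
  move/eqP; rewrite paddr_eq0 -?expr2 ?sqr_ge0// !sqrf_eq0 => /andP[/eqP-> /eqP->].
  by [].
have sv := smoothV oD n0 sn; split.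
  apply: (smooth_open oD _ (smoothM oD fr sv)) => x _.
  by case: (f x) => a b /=; rewrite !expr2.
apply: (smooth_open oD _ (smoothN oD (smoothM oD fi sv))) => x _.
by case: (f x) => a b /=; rewrite -!expr2 ?mulNr ?mulrN.
Qed.

Lemma dirC_open D f g p w : open D -> {in D, f =1 g} -> D p ->
  dirC w f p = dirC w g p.
Proof.
move=> oD fg Dp; rewrite /dirC; congr (_ +i* _).
  by apply: (derive_open _ oD) => // x Dx; rewrite fg.
by apply: (derive_open _ oD) => // x Dx; rewrite fg.
Qed.

Lemma dirC_cst (c : C) p w : dirC w (fun=> c) p = 0.
Proof. by rewrite /dirC !derive_cst. Qed.

Lemma dirCD D f g p w : smoothC D f -> smoothC D g -> D p ->
  dirC w (fun x => f x + g x) p = dirC w f p + dirC w g p.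
Proof.
move=> [fr fi] [gr gi] Dp; rewrite /dirC.
rewrite (_ : (fun q => complex.Re (f q + g q)) =
  (fun q => complex.Re (f q)) + (fun q => complex.Re (g q))); last first.
  by apply/funext => q; rewrite ReD.
rewrite (_ : (fun q => complex.Im (f q + g q)) =
  (fun q => complex.Im (f q)) + (fun q => complex.Im (g q))); last first.
  by apply/funext => q; rewrite ImD.
by rewrite !deriveD//; apply: smooth_derivable Dp.
Qed.

Lemma dirCM D f g p w : smoothC D f -> smoothC D g -> D p ->
  dirC w (fun x => f x * g x) p = dirC w f p * g p + f p * dirC w g p.
Proof.
move=> [fr fi] [gr gi] Dp; rewrite /dirC.
rewrite (_ : (fun q => complex.Re (f q * g q)) =
  (fun q => complex.Re (f q)) * (fun q => complex.Re (g q))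
   - (fun q => complex.Im (f q)) * (fun q => complex.Im (g q))); last first.
  by apply/funext => q; rewrite ReM.
rewrite (_ : (fun q => complex.Im (f q * g q)) =
  (fun q => complex.Re (f q)) * (fun q => complex.Im (g q))
  + (fun q => complex.Im (f q)) * (fun q => complex.Re (g q))); last first.
  by apply/funext => q; rewrite ImM.
have [d1 d2 d3 d4] : [/\ derivable (fun q => complex.Re (f q)) p w,
   derivable (fun q => complex.Im (f q)) p w,
   derivable (fun q => complex.Re (g q)) p w &
   derivable (fun q => complex.Im (g q)) p w].
  by split; apply: smooth_derivable Dp.
have dM := @derivableM _ _ _ _ p w.
rewrite (deriveB (dM _ _ d1 d3) (dM _ _ d2 d4)).
rewrite (deriveD (dM _ _ d1 d4) (dM _ _ d2 d3)).
rewrite (deriveM d1 d3) (deriveM d2 d4) (deriveM d1 d4) (deriveM d2 d3).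
rewrite /GRing.scale/=.
case: (f p) => a b; case: (g p) => c d /=.
by apply/eqP; rewrite eq_complex /=; apply/andP; split; apply/eqP; ring.
Qed.

Lemma smoothC_dirC D f w : smoothC D f -> smoothC D (dirC w f).
Proof. by move=> [fr fi]; split; exact: smooth_derive. Qed.

Lemma dirCN D f p w : smoothC D f -> D p ->
  dirC w (fun x => - f x) p = - dirC w f p.
Proof.
move=> sf Dp; rewrite (_ : (fun x => - f x) = fun x => -1 * f x); last first.
  by apply/funext => x; rewrite mulN1r.
by rewrite (dirCM _ (smoothC_cst D _) sf Dp) dirC_cst mul0r add0r mulN1r.
Qed.

Lemma dirC_sum D (I : Type) (r : seq I) (P : pred I) (F : I -> R * R -> C) p w :
  open D -> (forall i, P i -> smoothC D (F i)) -> D p ->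
  dirC w (fun x => \sum_(i <- r | P i) F i x) p = \sum_(i <- r | P i) dirC w (F i) p.
Proof.
move=> oD sF Dp; elim: r => [|i r IH].
  rewrite big_nil -[RHS](dirC_cst 0 p w); congr (dirC w _ p).
  by apply/funext => x; rewrite big_nil.
rewrite big_cons -IH; have [Pi|nPi] := boolP (P i).
  rewrite -(dirCD _ (sF _ Pi) (smoothC_sum _ oD sF) Dp); congr (dirC w _ p).
  by apply/funext => x; rewrite big_cons Pi.
congr (dirC w _ p).
by apply/funext => x; rewrite big_cons (negPf nPi).
Qed.

Lemma smoothC_neq0_open D f : open D -> smoothC D f -> open (D `&` [set p | f p != 0]).
Proof.
move=> oD [fr fi].
have sn := smoothD oD (smoothM oD fr fr) (smoothM oD fi fi).
rewrite openE => p [Dp /= fp0].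
set N := (fun x => _) in sn.
have Np0 : 0 < N p.
  rewrite /N; move: fp0; case: (f p) => a b /=.
  by rewrite eq_complex/= negb_and -!expr2 => /orP[] h;
   [apply: ltr_pwDl|apply: ltr_wpDl]; rewrite ?sqr_ge0 ?exprn_even_gt0.
have := smooth_continuous sn Dp => /cvgr_gt /(_ _ Np0) H.
have oDp := open_near oD Dp.
apply: filterS2 oDp H => q Dq Nq; split=> //=.
by apply: contraTneq Nq => fq; rewrite /N fq /= mul0r addr0 ltxx.
Qed.

End ComplexSmooth.

Section MatrixSmooth.
Context {R : realType}.
Local Notation C := R[i].
Implicit Types (D : set (R * R)) (w p : R * R).

(** The entrywise derivative along w; [dxM] and [dtM] are the cases (1, 0) and
    (0, 1). *)
Definition dirM (m n : nat) w (A : R * R -> 'M[C]_(m, n)) p : 'M[C]_(m, n) :=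
  \matrix_(i, j) dirC w (fun q => A q i j) p.

Definition smoothMx (m n : nat) D (A : R * R -> 'M[C]_(m, n)) : Prop :=
  forall i j, smoothC D (fun q => A q i j).

Section Rect.
Context {m n : nat}.
Implicit Types A B : R * R -> 'M[C]_(m, n).

Lemma smoothMx_open D A B : open D -> {in D, A =1 B} -> smoothMx D A -> smoothMx D B.
Proof.
move=> oD AB sA i j; apply: (smoothC_open oD _ (sA i j)) => x Dx; by rewrite AB.
Qed.

Lemma smoothMxS D D' A : D' `<=` D -> smoothMx D A -> smoothMx D' A.
Proof. by move=> sD sA i j; apply: smoothCS sD (sA i j). Qed.

Lemma smoothMx_cst D (c : 'M[C]_(m, n)) : smoothMx D (fun=> c).
Proof. by move=> i j; exact: smoothC_cst. Qed.

Lemma smoothMxD D A B : open D -> smoothMx D A -> smoothMx D B ->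
  smoothMx D (fun x => A x + B x).
Proof.
move=> oD sA sB i j; apply: (smoothC_open oD _ (smoothCD oD (sA i j) (sB i j))).
by move=> x _; rewrite mxE.
Qed.

Lemma smoothMxZ D A (c : C) : open D -> smoothMx D A -> smoothMx D (fun x => c *: A x).
Proof.
move=> oD sA i j; apply: (smoothC_open oD _ (smoothCM oD (smoothC_cst D c) (sA i j))).
by move=> x _; rewrite mxE.
Qed.

Lemma smoothMxN D A : open D -> smoothMx D A -> smoothMx D (fun x => - A x).
Proof.
move=> oD sA i j; apply: (smoothC_open oD _ (smoothCN oD (sA i j))).
by move=> x _; rewrite mxE.
Qed.

Lemma smoothMxB D A B : open D -> smoothMx D A -> smoothMx D B ->
  smoothMx D (fun x => A x - B x).
Proof. by move=> oD sA sB; apply: smoothMxD => //; exact: smoothMxN. Qed.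

Lemma smoothMx_sum D (I : Type) (r : seq I) (P : pred I)
    (F : I -> R * R -> 'M[C]_(m, n)) :
  open D -> (forall i, P i -> smoothMx D (F i)) ->
  smoothMx D (fun x => \sum_(i <- r | P i) F i x).
Proof.
move=> oD sF i j.
apply: (smoothC_open oD _ (smoothC_sum (F := fun k x => F k x i j) r oD _)).
  by move=> x _; rewrite summxE.
by move=> k /sF; apply.
Qed.

Lemma dirM_open D A B p w : open D -> {in D, A =1 B} -> D p -> dirM w A p = dirM w B p.
Proof.
move=> oD AB Dp; apply/matrixP => i j; rewrite !mxE; apply: (dirC_open _ oD) => //.
by move=> x Dx; rewrite AB.
Qed.

Lemma dirM_cst (c : 'M[C]_(m, n)) p w : dirM w (fun=> c) p = 0.
Proof. by apply/matrixP => i j; rewrite !mxE dirC_cst. Qed.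

Lemma dirMD D A B p w : smoothMx D A -> smoothMx D B -> D p ->
  dirM w (fun x => A x + B x) p = dirM w A p + dirM w B p.
Proof.
move=> sA sB Dp; apply/matrixP => i j; rewrite !mxE -(dirCD _ (sA i j) (sB i j) Dp).
by congr (dirC w _ p); apply/funext => x; rewrite mxE.
Qed.

Lemma dirMZ D A (c : C) p w : smoothMx D A -> D p ->
  dirM w (fun x => c *: A x) p = c *: dirM w A p.
Proof.
move=> sA Dp; apply/matrixP => i j; rewrite !mxE.
rewrite -[RHS]add0r -(mul0r (A p i j)) -(dirC_cst c p w).
rewrite -(dirCM _ (smoothC_cst D c) (sA i j) Dp).
by congr (dirC w _ p); apply/funext => x; rewrite mxE.
Qed.

Lemma dirMN D A p w : smoothMx D A -> D p ->
  dirM w (fun x => - A x) p = - dirM w A p.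
Proof.
move=> sA Dp; apply/matrixP => i j; rewrite !mxE -(dirCN _ (sA i j) Dp).
by congr (dirC w _ p); apply/funext => x; rewrite mxE.
Qed.

Lemma dirMB D A B p w : open D -> smoothMx D A -> smoothMx D B -> D p ->
  dirM w (fun x => A x - B x) p = dirM w A p - dirM w B p.
Proof.
by move=> oD sA sB Dp; rewrite (dirMD _ sA (smoothMxN oD sB) Dp) (dirMN _ sB Dp).
Qed.

Lemma dirM_sum D (I : Type) (r : seq I) (P : pred I)
    (F : I -> R * R -> 'M[C]_(m, n)) p w :
  open D -> (forall i, P i -> smoothMx D (F i)) -> D p ->
  dirM w (fun x => \sum_(i <- r | P i) F i x) p = \sum_(i <- r | P i) dirM w (F i) p.
Proof.
move=> oD sF Dp; apply/matrixP => i j; rewrite mxE summxE.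
transitivity (\sum_(k <- r | P k) dirC w (fun x => F k x i j) p).
  rewrite -(dirC_sum (F := fun k x => F k x i j) r w oD _ Dp); last first.
    by move=> k /sF; apply.
  by congr (dirC w _ p); apply/funext => x; rewrite summxE.
by apply: eq_bigr => k _; rewrite mxE.
Qed.

End Rect.

Lemma smoothMxM D m n l (A : R * R -> 'M[C]_(m, n)) (B : R * R -> 'M[C]_(n, l)) :
  open D -> smoothMx D A -> smoothMx D B -> smoothMx D (fun x => A x *m B x).
Proof.
move=> oD sA sB i j.
apply: (smoothC_open oD _ (smoothC_sum (index_enum 'I_n) (P := xpredT)
   (F := fun k x => A x i k * B x k j) oD _)).
  by move=> x _; rewrite mxE.
by move=> k _; apply: smoothCM.
Qed.

Lemma dirMM D m n l (A : R * R -> 'M[C]_(m, n)) (B : R * R -> 'M[C]_(n, l)) p w :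
  open D -> smoothMx D A -> smoothMx D B -> D p ->
  dirM w (fun x => A x *m B x) p = dirM w A p *m B p + A p *m dirM w B p.
Proof.
move=> oD sA sB Dp; apply/matrixP => i j; rewrite !mxE -big_split/=.
transitivity (\sum_k dirC w (fun x => A x i k * B x k j) p).
  rewrite -(dirC_sum (F := fun k x => A x i k * B x k j) _ _ oD _ Dp).
    by congr (dirC w _ p); apply/funext => x; rewrite mxE.
  by move=> k _; apply: smoothCM.
by apply: eq_bigr => k _; rewrite !mxE (dirCM _ (sA i k) (sB k j) Dp).
Qed.

Lemma dirM_mull D m n l (c : 'M[C]_(m, n)) (B : R * R -> 'M[C]_(n, l)) p w :
  open D -> smoothMx D B -> D p ->
  dirM w (fun x => c *m B x) p = c *m dirM w B p.
Proof.
move=> oD sB Dp; rewrite (dirMM _ oD (smoothMx_cst D c) sB Dp) dirM_cst.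
by rewrite mul0mx add0r.
Qed.

Lemma dirM_mulr D m n l (A : R * R -> 'M[C]_(m, n)) (c : 'M[C]_(n, l)) p w :
  open D -> smoothMx D A -> D p ->
  dirM w (fun x => A x *m c) p = dirM w A p *m c.
Proof.
move=> oD sA Dp; rewrite (dirMM _ oD sA (smoothMx_cst D c) Dp) dirM_cst.
by rewrite mulmx0 addr0.
Qed.

Lemma smoothC_det D n (A : R * R -> 'M[C]_n) : open D -> smoothMx D A ->
  smoothC D (fun x => \det (A x)).
Proof.
move=> oD sA; apply: smoothC_sum => // s _; apply: smoothCM => //.
  exact: smoothC_cst.
by apply: smoothC_prod => // i _; exact: sA.
Qed.

Lemma smoothMx_inv D n (A : R * R -> 'M[C]_n) : open D -> smoothMx D A ->
  (forall p, D p -> A p \in unitmx) -> smoothMx D (fun x => invmx (A x)).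
Proof.
move=> oD sA uA i j.
have sd : smoothC D (fun x => (\det (A x))^-1).
  apply: smoothCV (smoothC_det oD sA) => // x; rewrite inE => /uA.
  by rewrite unitmxE unitfE.
have sc : smoothC D (fun x => cofactor (A x) j i).
  apply: smoothCM => //; first exact: smoothC_cst.
  apply: (smoothC_det (A := fun x => row' j (col' i (A x)))) => // r s.
  apply: (smoothC_open oD _ (sA (lift j r) (lift i s))).
  by move=> x _; rewrite !mxE.
apply: (smoothC_open oD _ (smoothCM oD sd sc)) => x; rewrite inE => /uA u.
by rewrite /invmx u !mxE.
Qed.

Lemma dirM_inv D n (A : R * R -> 'M[C]_n) p w : open D -> smoothMx D A ->
  (forall p, D p -> A p \in unitmx) -> D p ->
  dirM w (fun x => invmx (A x)) p = - (invmx (A p) *m dirM w A p *m invmx (A p)).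
Proof.
move=> oD sA uA Dp; have sV := smoothMx_inv oD sA uA.
have : dirM w (fun x => A x *m invmx (A x)) p = 0.
  rewrite -(dirM_cst 1%:M p w); apply: (dirM_open _ oD) => // x; rewrite inE => Dx.
  by rewrite mulmxV ?uA.
rewrite (dirMM _ oD sA sV Dp) => /(congr1 (mulmx (invmx (A p)))).
rewrite mulmx0 mulmxDr !mulmxA mulVmx ?uA// mul1mx => /eqP.
by rewrite addrC addr_eq0 => /eqP.
Qed.

Lemma dxME n (A : R * R -> 'M[C]_n) p : dxM A p = dirM (1, 0) A p.
Proof. by []. Qed.
Lemma dtME n (A : R * R -> 'M[C]_n) p : dtM A p = dirM (0, 1) A p.
Proof. by []. Qed.

End MatrixSmooth.

(** * Partial derivatives of functions of two real variables *)
Section Line.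
Context {R : realType} {V : normedModType R}.
Implicit Types (f : V -> R) (p w : V).

Lemma line_is_derive f p w s : derivable f (s *: w + p) w ->
  is_derive s 1 (fun s : R => f (s *: w + p)) ('D_w f (s *: w + p)).
Proof.
have E : (fun h : R => h^-1 *: (((fun s : R => f (s *: w + p)) \o shift s) (h *: 1)
    - f (s *: w + p))) =
    (fun h => h^-1 *: ((f \o shift (s *: w + p)) (h *: w) - f (s *: w + p))).
  apply/funext => h /=; congr (_ *: (f _ - _)).
  by rewrite [h *: 1]mulr1 scalerDl addrA.
move=> df; apply: DeriveDef; first by rewrite /derivable E.
by rewrite /derive E.
Qed.

Lemma line_MVT f p w (h : R) : (forall s : R, `|s| <= `|h| -> derivable f (s *: w + p) w) ->
  exists2 c, `|c| <= `|h| & f (h *: w + p) - f p = h * 'D_w f (c *: w + p).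
Proof.
move=> df; pose g (s : R) := f (s *: w + p); pose dg (s : R) : R := 'D_w f (s *: w + p).
have is_dg (s : R) : `|s| <= `|h| -> is_derive s 1 g (dg s).
  by move=> /df; exact: line_is_derive.
have cg (a b : R) : (forall s, s \in `[a, b] -> `|s| <= `|h|) ->
    {within `[a, b], continuous g}.
  move=> ab; apply: derivable_within_continuous => s /ab sh.
  by have [] := is_dg _ sh.
have g0 : f p = g 0 by rewrite /g scale0r add0r.
have [h0|h0] := leP 0 h.
  have bnd s : s \in `[0, h] -> `|s| <= `|h|.
    by rewrite in_itv /= => /andP[s0 sh]; rewrite !ger0_norm.
  have dI s : s \in `]0, h[ -> is_derive s 1 g (dg s).
    by move=> /subset_itv_oo_cc/bnd/is_dg.
  have [c cI e] := MVT_segment h0 dI (cg _ _ bnd).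
  exists c; first exact: bnd.
  by rewrite g0 -/(g h) e subr0 mulrC.
have bnd s : s \in `[h, 0] -> `|s| <= `|h|.
  by rewrite in_itv /= => /andP[sh s0]; rewrite !ler0_norm ?lerN2// ltW.
have dI s : s \in `]h, 0[ -> is_derive s 1 g (dg s).
  by move=> /subset_itv_oo_cc/bnd/is_dg.
have [c cI e] := MVT_segment (ltW h0) dI (cg _ _ bnd).
exists c; first exact: bnd.
by rewrite g0 -/(g h) -[LHS]opprB e sub0r mulrN opprK mulrC.
Qed.

Lemma line_cst f p w (h : R) : (forall s : R, `|s| <= `|h| -> derivable f (s *: w + p) w) ->
  (forall s : R, `|s| <= `|h| -> 'D_w f (s *: w + p) = 0) -> f (h *: w + p) = f p.
Proof.
move=> /line_MVT[c ch e] d0; apply/eqP; rewrite -subr_eq0 e d0//.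
by rewrite mulr0.
Qed.

End Line.

Section Plane.
Context {R : realType}.
Implicit Types (f g : R * R -> R) (p w : R * R) (D : set (R * R)).

Definition square (r : R) : set (R * R) := [set p | `|p.1| < r /\ `|p.2| < r].

Lemma squareE r : square r = ball ((0, 0) : R * R) r.
Proof.
by apply/seteqP; split=> -[x t]; rewrite /square /ball /= /prod_ball /= /ball /= !sub0r !normrN.
Qed.

Lemma open_square r : open (square r).
Proof.
rewrite openE => p [p1 p2].
pose e := Num.min (r - `|p.1|) (r - `|p.2|).
have e0 : 0 < e by rewrite /e lt_min !subr_gt0 p1.
apply/nbhs_ballP; exists e => //= q [].
rewrite /ball /= => q1 q2; split.
  apply: le_lt_trans (_ : `|p.1| + `|p.1 - q.1| < r).
    by rewrite -[X in `|X| <= _](subKr p.1) (le_trans (ler_normB _ _)).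
  by rewrite -ltrBrDl (lt_le_trans q1)// ge_min lexx.
apply: le_lt_trans (_ : `|p.2| + `|p.2 - q.2| < r).
  by rewrite -[X in `|X| <= _](subKr p.2) (le_trans (ler_normB _ _)).
by rewrite -ltrBrDl (lt_le_trans q2)// ge_min lexx orbT.
Qed.

Lemma square_nbhs D : open D -> D (0, 0) -> exists2 r, 0 < r & square r `<=` D.
Proof.
move=> oD D0; have /nbhs_ballP[r r0 rD] := open_near oD D0.
by exists r => //; rewrite squareE.
Qed.

Lemma square_cst r f : (forall w p, square r p -> derivable f p w) ->
  (forall p, square r p -> 'D_(1, 0) f p = 0) ->
  (forall p, square r p -> 'D_(0, 1) f p = 0) ->
  forall p, square r p -> f p = f (0, 0).
Proof.
move=> df fx ft [x t] [/= xr tr].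
have r0 : 0 < r := le_lt_trans (normr_ge0 _) xr.
have inx s : `|s| <= `|x| -> square r (s *: (1, 0) + (0, 0) : R * R).
  move=> sx; rewrite /square /= addr0 /GRing.scale /= mulr1 mulr0 addr0 normr0.
  by split=> //; apply: le_lt_trans xr.
have int s : `|s| <= `|t| -> square r (s *: (0, 1) + (x, 0) : R * R).
  move=> sx; rewrite /square /= addr0 /GRing.scale /= mulr1 mulr0 add0r.
  by split=> //; apply: le_lt_trans tr.
transitivity (f (x, 0)).
  rewrite -(@line_cst _ _ f (x, 0) (0, 1) t).
  - congr f; congr (_, _); rewrite /= /GRing.scale /= ?mulr0 ?add0r ?mulr1 ?addr0//.
  - by move=> s /int; exact: df.
  - by move=> s /int; exact: ft.
rewrite -(@line_cst _ _ f (0, 0) (1, 0) x).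
- congr f; congr (_, _); rewrite /= /GRing.scale /= ?mulr0 ?add0r ?mulr1 ?addr0//.
- by move=> s /inx; exact: df.
- by move=> s /inx; exact: fx.
Qed.

(** An increment is the sum of one along each axis, to which the mean value
    theorem applies. *)
Lemma partials_increment f (fx ft : R * R -> R) p (d u v : R) :
  (forall q, ball p d q -> is_derive q ((1, 0) : R * R) f (fx q)) ->
  (forall q, ball p d q -> is_derive q ((0, 1) : R * R) f (ft q)) ->
  `|u| < d -> `|v| < d ->
  exists q1 q2, [/\ ball p d q1, ball p d q2 &
    f (p.1 + u, p.2 + v) - f p = u * fx q1 + v * ft q2].
Proof.
move=> dx dt ud vd; have d0 := le_lt_trans (normr_ge0 _) ud.
have inb (s t : R) : `|s| < d -> `|t| < d -> ball p d (p.1 + s, p.2 + t).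
  by move=> sd td; split; rewrite /ball /= opprD addNKr normrN.
have inb0 (t : R) : `|t| < d -> ball p d (p.1, p.2 + t).
  by move=> td; rewrite -[p.1 in X in ball _ _ X]addr0; apply: inb => //; rewrite normr0.
have e1 (s t : R) : s *: ((1, 0) : R * R) + (p.1, t) = (p.1 + s, t).
  by congr (_, _); rewrite /= /GRing.scale /= ?mulr0 ?add0r ?mulr1 1?addrC.
have e2 (s : R) : s *: ((0, 1) : R * R) + p = (p.1, p.2 + s).
  by rewrite [p in LHS]surjective_pairing; congr (_, _);
    rewrite /= /GRing.scale /= ?mulr0 ?add0r ?mulr1 1?addrC.
have [s sh|c1 c1h E1] := @line_MVT _ _ f (p.1, p.2 + v) (1, 0) u.
  by rewrite e1; have [] := dx _ (inb s v (le_lt_trans sh ud) vd).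
have [s sh|c2 c2h E2] := @line_MVT _ _ f p (0, 1) v.
  by rewrite e2; have [] := dt _ (inb0 s (le_lt_trans sh vd)).
have in1 := inb c1 v (le_lt_trans c1h ud) vd; have in2 := inb0 _ (le_lt_trans c2h vd).
exists (p.1 + c1, p.2 + v), (p.1, p.2 + c2); split => //.
rewrite !e1 in E1; rewrite !e2 in E2.
rewrite -(@derive_val _ _ _ _ _ _ _ (dx _ in1)) -(@derive_val _ _ _ _ _ _ _ (dt _ in2)).
by rewrite -E1 -E2 addrA subrK.
Qed.

Lemma partials_is_derive f (fx ft : R * R -> R) D p w : open D -> D p ->
  (forall q, D q -> is_derive q ((1, 0) : R * R) f (fx q)) ->
  (forall q, D q -> is_derive q ((0, 1) : R * R) f (ft q)) ->
  {for p, continuous fx} -> {for p, continuous ft} ->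
  is_derive p w f (w.1 * fx p + w.2 * ft p).
Proof.
move=> oD Dp dx dt cx ct.
suff cv : (fun h : R => h^-1 *: ((f \o shift p) (h *: w) - f p)) @ 0^' -->
    w.1 * fx p + w.2 * ft p.
  apply: DeriveDef; first by apply/cvg_ex; eexists; exact: cv.
  exact/cvg_lim.
apply/cvgrPdist_le => e e0.
pose m := `|w.1| + `|w.2| + 1.
have m0 : 0 < m by rewrite /m ltr_wpDl// addr_ge0.
have em : 0 < e / m by rewrite divr_gt0.
have H : \forall q \near p, [/\ D q, `|fx p - fx q| <= e / m & `|ft p - ft q| <= e / m].
  near=> q; split; near: q; first exact: (open_near oD Dp).
    by move/cvgrPdist_le : cx; apply.
  by move/cvgrPdist_le : ct; apply.
have /nbhs_ballP[d d0 dH] := H.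
have dm : 0 < d / m by rewrite divr_gt0.
near=> h.
have h0 : h != 0 by near: h; exact: nbhs_dnbhs_neq.
have hd : `|h| < d / m by near: h; exact: dnbhs0_lt.
have hw i : `|i| <= m -> `|h * i| < d.
  move=> im; rewrite normrM (le_lt_trans (ler_wpM2l _ im))//.
  by rewrite -ltr_pdivlMr.
have w1m : `|w.1| <= m by rewrite /m -addrA lerDl addr_ge0.
have w2m : `|w.2| <= m by rewrite /m addrAC lerDr addr_ge0.
have dxd q : ball p d q -> is_derive q ((1, 0) : R * R) f (fx q).
  by move=> /dH[Dq _ _]; exact: dx.
have dtd q : ball p d q -> is_derive q ((0, 1) : R * R) f (ft q).
  by move=> /dH[Dq _ _]; exact: dt.
have [q1 [q2 [in1 in2 E]]] := partials_increment dxd dtd (hw _ w1m) (hw _ w2m).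
have [Dq1 fq1 _] := dH _ in1; have [Dq2 _ fq2] := dH _ in2.
have -> : (f \o shift p) (h *: w) = f (p.1 + h * w.1, p.2 + h * w.2).
  by rewrite /= addrC [p in LHS]surjective_pairing.
rewrite E /GRing.scale /= mulrDr -!mulrA !mulKf//.
rewrite opprD addrACA -!mulrBr (le_trans (ler_normD _ _))// !normrM.
have : `|w.1| * (e / m) + `|w.2| * (e / m) <= e.
  rewrite -mulrDl mulrA ler_pdivrMr// mulrC ler_pM2l//.
  by rewrite /m lerDl.
apply: le_trans; apply: lerD; exact: ler_wpM2l.
Unshelve. all: by end_near. Qed.

Lemma partials_continuous f (fx ft : R * R -> R) D p : open D -> D p ->
  (forall q, D q -> is_derive q ((1, 0) : R * R) f (fx q)) ->
  (forall q, D q -> is_derive q ((0, 1) : R * R) f (ft q)) ->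
  {for p, continuous fx} -> {for p, continuous ft} -> {for p, continuous f}.
Proof.
move=> oD Dp dx dt cx ct.
apply/cvgrPdist_le => e e0.
pose m := `|fx p| + `|ft p| + 2.
have m0 : 0 < m by rewrite /m ltr_wpDl// addr_ge0.
have H : \forall q \near p, [/\ D q, `|fx p - fx q| <= 1 & `|ft p - ft q| <= 1].
  near=> q; split; near: q; first exact: (open_near oD Dp).
    by move/cvgrPdist_le : cx; apply.
  by move/cvgrPdist_le : ct; apply.
have /nbhs_ballP[d d0 dH] := H.
have dxd q : ball p d q -> is_derive q ((1, 0) : R * R) f (fx q).
  by move=> /dH[Dq _ _]; exact: dx.
have dtd q : ball p d q -> is_derive q ((0, 1) : R * R) f (ft q).
  by move=> /dH[Dq _ _]; exact: dt.
have em : 0 < e / m by rewrite divr_gt0.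
have dm0 : 0 < Num.min d (e / m) by rewrite lt_min d0.
have nb : nbhs p (ball p (Num.min d (e / m))) by exact: nbhsx_ballx.
near=> q; have : ball p (Num.min d (e / m)) q by near: q; exact: nb.
case=> /=; rewrite /ball /= (distrC p.1) (distrC p.2) !lt_min => /andP[q1 q1'] /andP[q2 q2'].
have [r1 [r2 [in1 in2 E]]] := partials_increment dxd dtd q1 q2.
have [_ f1 _] := dH _ in1; have [_ _ f2] := dH _ in2.
rewrite -normrN opprB.
have -> : f q = f (p.1 + (q.1 - p.1), p.2 + (q.2 - p.2)).
  by rewrite ![_ + (_ - _)]addrC !subrK -surjective_pairing.
rewrite E (le_trans (ler_normD _ _))// !normrM.
have b1 : `|fx r1| <= `|fx p| + 1.
  rewrite -[fx r1](subKr (fx p)) (le_trans (ler_normB _ _))// lerD2l//.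
have b2 : `|ft r2| <= `|ft p| + 1.
  rewrite -[ft r2](subKr (ft p)) (le_trans (ler_normB _ _))// lerD2l//.
have : e / m * (`|fx p| + 1) + e / m * (`|ft p| + 1) <= e.
  rewrite -mulrDr (_ : _ + 1 + _ = m) ?divfK ?gt_eqF//.
  by rewrite /m addrACA.
apply: le_trans; apply: lerD; apply: ler_pM => //; exact: ltW.
Unshelve. all: by end_near. Qed.

Lemma is_derive_slicex f (x t l : R) :
  is_derive x 1 (fun s : R => f (s, t)) l <-> is_derive (x, t) ((1, 0) : R * R) f l.
Proof.
have E : (fun h : R => h^-1 *: (((fun s : R => f (s, t)) \o shift x) (h *: 1)
    - f (x, t))) =
    (fun h => h^-1 *: ((f \o shift (x, t)) (h *: ((1, 0) : R * R)) - f (x, t))).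
  apply/funext => h /=; congr (_ *: (f _ - _)).
  by congr (_, _); rewrite /= [h *: 0]mulr0 add0r.
split=> -[d1 d2]; apply: DeriveDef; move: d1 d2; rewrite /derivable /derive E//.
Qed.

Lemma is_derive_slicet f (x t l : R) :
  is_derive t 1 (fun s : R => f (x, s)) l <-> is_derive (x, t) ((0, 1) : R * R) f l.
Proof.
have E : (fun h : R => h^-1 *: (((fun s : R => f (x, s)) \o shift t) (h *: 1)
    - f (x, t))) =
    (fun h => h^-1 *: ((f \o shift (x, t)) (h *: ((0, 1) : R * R)) - f (x, t))).
  apply/funext => h /=; congr (_ *: (f _ - _)).
  by congr (_, _); rewrite /= [h *: 0]mulr0 add0r.
split=> -[d1 d2]; apply: DeriveDef; move: d1 d2; rewrite /derivable /derive E//.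
Qed.

(** With continuous partial derivatives, the derivative along w is
    w_1 A + w_2 B, which is smooth again. *)
Lemma smooth_of_partials D f A B : open D -> smooth_on D A -> smooth_on D B ->
  (forall q, D q -> is_derive q ((1, 0) : R * R) f (A q)) ->
  (forall q, D q -> is_derive q ((0, 1) : R * R) f (B q)) -> smooth_on D f.
Proof.
move=> oD sA sB dA dB.
have cA p Dp := smooth_continuous sA (x := p) Dp.
have cB p Dp := smooth_continuous sB (x := p) Dp.
have dw p w (Dp : D p) := partials_is_derive w oD Dp dA dB (cA _ Dp) (cB _ Dp).
apply: smooth_of_derive => [p Dp|w].
  exact: (partials_continuous oD Dp dA dB (cA _ Dp) (cB _ Dp)).
split=> [p /(dw _ w)[]//|].
apply: (smooth_open oD _ (smoothD oD (smoothM oD (smooth_cst D w.1) sA)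
   (smoothM oD (smooth_cst D w.2) sB))) => p; rewrite inE => /(dw _ w) e.
by rewrite derive_val.
Qed.

End Plane.

(** * Primitives of closed one-forms *)
Section Quadrature.
Context {R : realType}.
Variables (r : R) (A B : R * R -> R).
Hypothesis r0 : 0 < r.
Let S2 : set (R * R) := square (2 * r).
Hypotheses (sA : smooth_on S2 A) (sB : smooth_on S2 B).
Hypothesis closed : forall p, S2 p -> 'D_(0, 1) A p = 'D_(1, 0) B p.
Local Notation mu := (@lebesgue_measure R).

Let r_lt2 : r < 2 * r. Proof. by rewrite ltr_pMl// ltr1n. Qed.

Let in_S2 (x t : R) : `|x| <= r -> `|t| <= r -> S2 (x, t).
Proof. by move=> xr tr; split; apply: le_lt_trans r_lt2; assumption. Qed.

Let absP (x : R) : x \in `[- r, r] -> `|x| <= r.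
Proof. by rewrite in_itv /= ler_norml. Qed.

Let dslicex (g : R * R -> R) (x t : R) : smooth_on S2 g -> `|x| <= r -> `|t| <= r ->
  is_derive x 1 (fun s => g (s, t)) ('D_(1, 0) g (x, t)).
Proof.
move=> sg xr tr; apply/is_derive_slicex; apply: derivableP.
apply: (smooth_derivable sg); exact: in_S2.
Qed.

Let dslicet (g : R * R -> R) (x t : R) : smooth_on S2 g -> `|x| <= r -> `|t| <= r ->
  is_derive t 1 (fun s => g (x, s)) ('D_(0, 1) g (x, t)).
Proof.
move=> sg xr tr; apply/is_derive_slicet; apply: derivableP.
apply: (smooth_derivable sg); exact: in_S2.
Qed.

Let is_derive_continuous (h : R -> R) (x l : R) : is_derive x 1 h l -> {for x, continuous h}.
Proof. by move=> [dh _]; apply/differentiable_continuous/derivable1_diffP. Qed.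

Let cslicet (g : R * R -> R) (x b : R) : smooth_on S2 g -> `|x| <= r -> b <= r ->
  {within `[- r, b], continuous (fun s => g (x, s))}.
Proof.
move=> sg xr br; apply: derivable_within_continuous => s.
rewrite in_itv /= => /andP[s1 s2].
have sr : `|s| <= r by rewrite ler_norml s1 (le_trans s2).
by have [] := dslicet sg xr sr.
Qed.

Let cslicex (g : R * R -> R) (t b : R) : smooth_on S2 g -> `|t| <= r -> b <= r ->
  {within `[- r, b], continuous (fun s => g (s, t))}.
Proof.
move=> sg xr br; apply: derivable_within_continuous => s.
rewrite in_itv /= => /andP[s1 s2].
have sr : `|s| <= r by rewrite ler_norml s1 (le_trans s2).
by have [] := dslicex sg sr xr.
Qed.

Let islicet (g : R * R -> R) (x b : R) : smooth_on S2 g -> `|x| <= r -> b <= r ->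
  mu.-integrable `[- r, b] (EFin \o (fun s => g (x, s))).
Proof.
move=> sg xr br; apply: continuous_compact_integrable; first exact: segment_compact.
exact: cslicet.
Qed.

(* The primitive integrates A along the lower side of the square, then B
   upwards; the lower left corner as origin keeps all intervals oriented. *)
Let F1 (x : R) : R := \int[mu]_(s in `[- r, x]) A (s, - r).
Let G (x t : R) : R := \int[mu]_(s in `[- r, t]) B (x, s).

Let nr : `|- r| <= r. Proof. by rewrite normrN ger0_norm// ltW. Qed.

Let dF1 (x : R) : `|x| < r -> is_derive x 1 F1 (A (x, - r)).
Proof.
move=> xr; have /andP[rx x2] : - r < x < r by rewrite -ltr_norml.
have iA : mu.-integrable `[- r, r] (EFin \o (fun s => A (s, - r))).
  apply: continuous_compact_integrable; first exact: segment_compact.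
  exact: cslicex.
have cx := is_derive_continuous (dslicex sA (ltW xr) nr).
have [d1 d2] := continuous_FTC1_closed x2 iA rx cx.
by apply: DeriveDef; [exact: d1|rewrite -derive1E; exact: d2].
Qed.

Let dGt (x t : R) : `|x| <= r -> `|t| < r -> is_derive t 1 (G x) (B (x, t)).
Proof.
move=> xr tr; have /andP[rx x2] : - r < t < r by rewrite -ltr_norml.
have cx := is_derive_continuous (dslicet sB xr (ltW tr)).
have [d1 d2] := continuous_FTC1_closed x2 (islicet sB xr (lexx r)) rx cx.
by apply: DeriveDef; [exact: d1|rewrite -derive1E; exact: d2].
Qed.

(* the domination needed to differentiate under the integral sign *)
Let bound : exists K, forall x t, `|x| <= r -> `|t| <= r -> `|'D_(1, 0) B (x, t)| <= K.
Proof.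
have cK : compact (`[- r, r]%classic `*` `[- r, r]%classic : set (R * R)).
  by apply: compact_setX; exact: segment_compact.
pose dB : R * R -> R := fun p => 'D_(1, 0) B p.
have sdB : smooth_on S2 dB by apply: smooth_derive.
have cB : {within `[- r, r]%classic `*` `[- r, r]%classic,
    continuous dB}.
  apply: continuous_in_subspaceT => p; rewrite inE => -[p1 p2].
  have Sp : S2 p by rewrite [p]surjective_pairing; apply: in_S2; apply: absP.
  exact: (smooth_continuous sdB Sp).
have [K [_ HK]] := compact_bounded (continuous_compact cB cK).
exists (K + 1) => x t xr tr; apply: (HK (K + 1)); first by rewrite ltrDl.
by exists (x, t) => //; split; rewrite /= in_itv /= -ler_norml.
Qed.

Let dGx (x t : R) : `|x| < r -> `|t| < r ->
  is_derive x 1 (G ^~ t) (A (x, t) - A (x, - r)).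
Proof.
move=> xr tr; have /andP[rt x2] : - r < t < r by rewrite -ltr_norml.
have [K HK] := bound.
pose f x s := B (x, s).
have Ix : `]- r, r[%classic x by rewrite /= in_itv /= -ltr_norml.
have absI y : `]- r, r[%classic y -> `|y| <= r.
  by rewrite /= in_itv /= -ltr_norml; exact: ltW.
have absJ y : `[- r, t]%classic y -> `|y| <= r.
  by rewrite /= in_itv /= ler_norml => /andP[-> /le_trans]; apply; exact: ltW.
have mB : measurable (`[- r, t]%classic : set R) by exact: measurable_itv.
have intf y : `]- r, r[%classic y -> mu.-integrable `[- r, t] (EFin \o f y).
  by move=> /absI yr; apply: islicet => //; exact: ltW.
have derf y s : `]- r, r[%classic y -> `[- r, t]%classic s -> derivable (f^~ s) y 1.
  by move=> /absI yr /absJ sr; have [] := dslicex sB yr sr.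
have K0 : 0 <= K.
  by apply: le_trans (HK 0 0 _ _); rewrite ?normr0 ?(ltW r0).
have intG : mu.-integrable `[- r, t] (EFin \o (fun=> K : R)).
  apply: continuous_compact_integrable; first exact: segment_compact.
  by apply: continuous_subspaceT => y; exact: cst_continuous.
have ub y s : `]- r, r[%classic y -> `[- r, t]%classic s ->
    `|partial1of2 f y s| <= K.
  move=> /absI yr /absJ sr; rewrite partial1of2E.
  have [_ ->] := dslicex sB yr sr; exact: HK.
have d1 := @derivable_under_integral R _ (measurableTypeR R) mu f _ mB _ _ _ Ix intf derf _ (fun=> K0) intG ub.
have d2 := @differentiation_under_integral R _ (measurableTypeR R) mu f _ mB _ _ _ Ix intf derf _ (fun=> K0) intG ub.
apply: DeriveDef; [exact: d1|rewrite -derive1E d2].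
pose dA : R * R -> R := fun p => 'D_(0, 1) A p.
have sdA : smooth_on S2 dA by apply: smooth_derive.
transitivity (\int[mu]_(s in `[- r, t]) dA (x, s)).
  apply: eq_Rintegral => s; rewrite inE => /absJ sr.
  rewrite partial1of2E; have [_ ->] := dslicex sB (ltW xr) sr.
  by rewrite -closed//; apply: in_S2 => //; exact: ltW.
have c1 : {within `[- r, t], continuous (fun s => dA (x, s))}.
  by apply: (cslicet sdA); exact: ltW.
have sr s : s \in `]- r, t[ -> `|s| <= r.
  rewrite in_itv /= => /andP[s1 s2].
  by rewrite ler_norml (ltW s1) (le_trans (ltW s2) (ltW x2)).
have c2 : derivable_oo_LRcontinuous (fun s => A (x, s)) (- r) t.
  split=> [s /sr st||]; first by have [] := dslicet sA (ltW xr) st.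
  - apply: cvg_at_right_filter.
    exact: (is_derive_continuous (dslicet sA (ltW xr) nr)).
  - apply: cvg_at_left_filter.
    exact: (is_derive_continuous (dslicet sA (ltW xr) (ltW tr))).
have c3 : {in `]- r, t[, derive1 (fun s => A (x, s)) =1 (fun s => dA (x, s))}.
  by move=> s /sr st; rewrite derive1E; have [_ ->] := dslicet sA (ltW xr) st.
have e := continuous_FTC2 rt c1 c2 c3.
by rewrite /Rintegral e.
Qed.

(** The x-derivative of the vertical integral is the integral of B_x = A_t, which
    telescopes to A(x, t) - A(x, -r). *)
Lemma quadrature : exists f : R * R -> R, [/\ smooth_on (square r) f, f (0, 0) = 0,
  forall p, square r p -> 'D_(1, 0) f p = A p &
  forall p, square r p -> 'D_(0, 1) f p = B p].
Proof.
pose c := F1 0 + G 0 0.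
pose f (p : R * R) := F1 p.1 + G p.1 p.2 - c.
have dx p : square r p -> is_derive p ((1, 0) : R * R) f (A p).
  case: p => x t [/= xr tr]; apply/is_derive_slicex => /=.
  have [d1 e1] := dF1 xr; have [d2 e2] := dGx xr tr.
  have dc := derivable_cst c x 1.
  have dFG := derivableD d1 d2.
  apply: DeriveDef; first exact: (derivableB dFG dc).
  rewrite -[LHS]/('D_1 (F1 + G^~ t - cst c) x).
  rewrite (deriveB dFG dc) (deriveD d1 d2) e1 e2 derive_cst subr0.
  by rewrite addrC subrK.
have dt p : square r p -> is_derive p ((0, 1) : R * R) f (B p).
  case: p => x t [/= xr tr]; apply/is_derive_slicet => /=.
  have [d1 e1] := dGt (ltW xr) tr.
  have dc := derivable_cst c t 1; have dF := derivable_cst (F1 x) t 1.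
  have dFG := derivableD dF d1.
  apply: DeriveDef; first exact: (derivableB dFG dc).
  rewrite -[LHS]/('D_1 (cst (F1 x) + G x - cst c) t).
  by rewrite (deriveB dFG dc) (deriveD dF d1) e1 !derive_cst subr0 add0r.
have sS : square r `<=` S2.
  by move=> p [p1 p2]; split; apply: lt_trans r_lt2; assumption.
exists f; split.
- exact: (smooth_of_partials (@open_square _ _) (smoothS sS sA) (smoothS sS sB) dx dt).
- by rewrite /f /= subrr.
- by move=> p /dx [].
- by move=> p /dt [].
Qed.

End Quadrature.

Section MatrixPrimitive.
Context {R : realType} {m n : nat}.
Local Notation C := R[i].
Implicit Types (A P T : R * R -> 'M[C]_(m, n)).

Lemma square_cst_mx r A : smoothMx (square r) A ->
  (forall p, square r p -> dirM (1, 0) A p = 0) ->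
  (forall p, square r p -> dirM (0, 1) A p = 0) ->
  forall p, square r p -> A p = A (0, 0).
Proof.
move=> sA Ax At p Sp; apply/matrixP => i j; have [sr si] := sA i j.
have ex q (Sq : square r q) : dirC (1, 0) (fun q => A q i j) q = 0.
  by have /matrixP/(_ i j) := Ax q Sq; rewrite !mxE.
have et q (Sq : square r q) : dirC (0, 1) (fun q => A q i j) q = 0.
  by have /matrixP/(_ i j) := At q Sq; rewrite !mxE.
apply/eqP; rewrite eq_complex; apply/andP; split; apply/eqP.
  apply: (@square_cst _ r (fun q => complex.Re (A q i j))) => // [w q Sq|q Sq|q Sq].
  - exact: (smooth_derivable sr Sq).
  - by have := congr1 (@complex.Re R) (ex _ Sq).
  - by have := congr1 (@complex.Re R) (et _ Sq).
apply: (@square_cst _ r (fun q => complex.Im (A q i j))) => // [w q Sq|q Sq|q Sq].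
- exact: (smooth_derivable si Sq).
- by have := congr1 (@complex.Im R) (ex _ Sq).
- by have := congr1 (@complex.Im R) (et _ Sq).
Qed.

Lemma quadratureC (r : R) (P T : R * R -> C) : 0 < r ->
  smoothC (square (2 * r)) P -> smoothC (square (2 * r)) T ->
  (forall p, square (2 * r) p -> dirC (0, 1) P p = dirC (1, 0) T p) ->
  exists f : R * R -> C, [/\ smoothC (square r) f, f (0, 0) = 0,
    forall p, square r p -> dirC (1, 0) f p = P p &
    forall p, square r p -> dirC (0, 1) f p = T p].
Proof.
move=> r0 [Pr Pi] [Tr Ti] cl.
have [q Sq|f [sf f0 fx ft]] := quadrature r0 Pr Tr.
  exact: (congr1 (@complex.Re R) (cl q Sq)).
have [q Sq|g [sg g0 gx gt]] := quadrature r0 Pi Ti.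
  exact: (congr1 (@complex.Im R) (cl q Sq)).
exists (fun p => f p +i* g p); split.
- by split.
- by rewrite f0 g0.
- by move=> p Sp; rewrite /dirC /= fx// gx//; case: (P p).
- by move=> p Sp; rewrite /dirC /= ft// gt//; case: (T p).
Qed.

Lemma quadrature_mx (r : R) P T : 0 < r ->
  smoothMx (square (2 * r)) P -> smoothMx (square (2 * r)) T ->
  (forall p, square (2 * r) p -> dirM (0, 1) P p = dirM (1, 0) T p) ->
  exists F : R * R -> 'M[C]_(m, n), [/\ smoothMx (square r) F, F (0, 0) = 0,
    forall p, square r p -> dirM (1, 0) F p = P p &
    forall p, square r p -> dirM (0, 1) F p = T p].
Proof.
move=> r0 sP sT cl.
have H i : forall j, exists f : R * R -> C, [/\ smoothC (square r) f, f (0, 0) = 0,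
    forall p, square r p -> dirC (1, 0) f p = P p i j &
    forall p, square r p -> dirC (0, 1) f p = T p i j].
  move=> j; apply: (quadratureC r0 (sP i j) (sT i j)) => p Sp.
  by have /matrixP/(_ i j) := cl p Sp; rewrite !mxE.
have [f Hf] := choice (fun ij : 'I_m * 'I_n => H ij.1 ij.2).
exists (fun p => \matrix_(i, j) f (i, j) p); split.
- move=> i j; have [sf _ _ _] := Hf (i, j).
  by apply: (smoothC_open (@open_square _ _) _ sf) => p _; rewrite mxE.
- by apply/matrixP => i j; have [_ f0 _ _] := Hf (i, j); rewrite !mxE.
- move=> p Sp; apply/matrixP => i j; have [_ _ fx _] := Hf (i, j); rewrite !mxE -[RHS]fx//.
  by congr (dirC _ _ p); apply/funext => q; rewrite mxE.
- move=> p Sp; apply/matrixP => i j; have [_ _ _ ft] := Hf (i, j); rewrite !mxE -[RHS]ft//.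
  by congr (dirC _ _ p); apply/funext => q; rewrite mxE.
Qed.

End MatrixPrimitive.

(** * Differential polynomials *)
Section DifferentialPolynomials.
Context {R : realType} {n : nat}.
Local Notation C := R[i].
Local Notation M := 'M[C]_n.
Implicit Types (D : set (R * R)) (u : R * R -> M) (P : diffpoly R n).

(** One entry of [eval_dp], with the jet as a free argument. *)
Definition eval_poly P (x : jetvar n -> C) : C := monalg.mmap idfun (eval_monom x) P.

Lemma eval_dpE (P : 'M[diffpoly R n]_n) u p i j :
  eval_dp P u p i j = eval_poly (P i j) (jet u p).
Proof. by rewrite mxE. Qed.

Lemma smoothC_jet D u v : smoothMx D u -> smoothC D (fun p => jet u p v).
Proof.
move=> su; rewrite /jet; elim: v.1 => [|k IH] /=; first exact: su.
exact: smoothC_dirC.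
Qed.

Lemma smoothMx_eval_dp D (P : 'M[diffpoly R n]_n) u : open D -> smoothMx D u ->
  smoothMx D (eval_dp P u).
Proof.
move=> oD su i j.
have s : smoothC D (fun p => \sum_(m <- msupp (P i j)) mcoeff m (P i j) *
    \prod_(v <- finsupp (cmonom_val m)) jet u p v ^+ cmonom_val m v).
  apply: smoothC_sum => // m _; apply: smoothCM => //; first exact: smoothC_cst.
  apply: smoothC_prod => // v _; apply: smoothCX => //; exact: smoothC_jet.
by apply: (smoothC_open oD _ s) => p _; rewrite eval_dpE /eval_poly mmapE.
Qed.

Definition jet_order P : nat :=
  (\max_(m <- msupp P) \max_(v <- finsupp (cmonom_val m)) v.1)%N.

Lemma leq_jet_order P m v : m \in msupp P -> v \in finsupp (cmonom_val m) ->
  (v.1 <= jet_order P)%N.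
Proof.
move=> mP vm; rewrite /jet_order.
apply: leq_trans (leq_bigmax_seq _ mP isT).
exact: (@leq_bigmax_seq _ _ _ (fun v : jetvar n => v.1) _ vm isT).
Qed.

Lemma eq_eval_poly P x y :
  (forall v, (v.1 <= jet_order P)%N -> x v = y v) -> eval_poly P x = eval_poly P y.
Proof.
move=> xy; rewrite /eval_poly !mmapE; apply: eq_big_seq => m mP; congr (_ * _).
by apply: eq_big_seq => v vm; rewrite xy// (leq_jet_order mP).
Qed.

Lemma eval_poly_0 P x : (forall v, (v.1 <= jet_order P)%N -> x v = 0) ->
  eval_poly P x = mcoeff monalg.one P.
Proof.
move=> x0; pose o : cmonom (jetvar n) := monalg.one.
have off m : m \in msupp P -> m != o -> eval_monom x m = 0.
  move=> mP m1; have [v vm] : exists v, v \in finsupp (cmonom_val m).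
    apply/fset0Pn; apply: contra m1 => /eqP m0; apply/eqP/val_inj/fsfunP => v /=.
    rewrite cm1; apply/eqP; rewrite -memNfinsupp.
    by rewrite m0.
  rewrite /eval_monom (bigD1_seq v) ?fset_uniq//= x0 ?(leq_jet_order mP)// expr0n.
  by move: vm; rewrite mem_finsupp => /negPf ->; rewrite mul0r.
have on : eval_monom x o = 1 by rewrite /eval_monom mdom1 big_seq_fset0.
rewrite /eval_poly mmapE; have [oP|oP] := boolP (o \in msupp P).
  rewrite (bigD1_seq _ oP (fset_uniq _)) on mulr1 big_seq_cond big1 => [|m /andP[mP m1]].
    exact: addr0.
  by rewrite off ?mulr0.
rewrite big_seq big1 ?mcoeff_outdom// => m mP; rewrite off ?mulr0//.
by apply: contraNneq oP => <-.
Qed.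

Lemma eval_dp_cst (c : M) u p :
  eval_dp (map_mx (monalg.mkmalgU monalg.one) c : 'M[diffpoly R n]_n) u p = c.
Proof.
apply/matrixP => i j; rewrite !mxE mmapU /=.
by rewrite /eval_monom mdom1 big_seq_fset0 mulr1.
Qed.

Lemma is_derive_fst (p w : R * R) : is_derive p w (fst : R * R -> R) w.1.
Proof.
have cv : (fun h : R => h^-1 *: ((fst \o shift p) (h *: w) - p.1)) @ 0^' --> w.1.
  apply: cvg_near_cst; near=> e.
  have e0 : e != 0 by near: e; exact: nbhs_dnbhs_neq.
  by rewrite /= addrK scalerA mulVf// scale1r.
by apply: DeriveDef; [apply/cvg_ex; exists w.1|exact/cvg_lim].
Unshelve. all: by end_near. Qed.

Lemma smoothC_fst D : open D -> smoothC D (fun p : R * R => p.1%:C).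
Proof.
move=> oD; split; last exact: smooth_cst.
case=> [|k].
  by split; [move=> p _; exact: cvg_fst|exact: Logic.I].
split=> [p _|w]; first exact: cvg_fst.
split=> [p _|]; first by have [] := is_derive_fst p w.
apply: (Ck_open oD _ (Ck_cst k D w.1)) => p _.
by have [_ ->] := is_derive_fst p w.
Qed.

Lemma smoothC_horner D (h : {poly C}) : open D ->
  smoothC D (fun p : R * R => h.[p.1%:C]).
Proof.
move=> oD; elim/poly_ind: h => [|h c IH].
  by apply: (smoothC_open oD _ (smoothC_cst D 0)) => p _; rewrite horner0.
apply: (smoothC_open oD _ (smoothCD oD (smoothCM oD IH (smoothC_fst oD))
  (smoothC_cst D c))).
by move=> p _; rewrite !hornerE.
Qed.

Lemma dx_horner (h : {poly C}) :
  dx (fun p : R * R => h.[p.1%:C]) = fun p => (h^`()).[p.1%:C].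
Proof.
apply/funext => p; have oT : open [set: R * R] by exact: openT.
have d1 : dirC (1, 0) (fun p : R * R => p.1%:C) p = 1.
  rewrite /dirC /= derive_cst.
  by have [_ ->] := is_derive_fst p (1, 0).
rewrite /dx; elim/poly_ind: h => [|h c IH].
  rewrite deriv0 horner0 -[RHS](dirC_cst 0 p (1, 0)); congr (dirC _ _ p).
  by apply/funext => q; rewrite horner0.
have sh := smoothC_horner h oT; have sX := smoothC_fst oT.
rewrite (_ : (fun p : R * R => _) = fun p => h.[p.1%:C] * p.1%:C + c); last first.
  by apply/funext => q; rewrite !hornerE.
rewrite (dirCD _ (smoothCM oT sh sX) (smoothC_cst _ c))// (dirCM _ sh sX)//.
by rewrite dirC_cst d1 IH derivMXaddC !hornerE ?mulr1 ?addr0 addrC.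
Qed.

Lemma iter_dx_horner (h : {poly C}) k :
  iter k (@dx R) (fun p : R * R => h.[p.1%:C]) = fun p => h^`(k).[p.1%:C].
Proof.
elim: k => [|k IH]; first by rewrite derivn0.
by rewrite iterS IH dx_horner derivnS.
Qed.

Lemma iter_dx_open D (f g : R * R -> C) k p : open D -> {in D, f =1 g} -> D p ->
  iter k (@dx R) f p = iter k (@dx R) g p.
Proof.
move=> oD fg; elim: k p => [|k IH] p Dp /=; first by rewrite fg ?inE.
by apply: (dirC_open _ oD _ Dp) => q; rewrite inE; exact: IH.
Qed.

End DifferentialPolynomials.

(** * Hermite interpolation *)
Section Hermite.
Variable F : numFieldType.
Implicit Types (g h : {poly F}) (x : F).

Lemma deriv_XsubC_exp_mul x m g : exists2 g1,
  (('X - x%:P) ^+ m.+1 * g)^`() = ('X - x%:P) ^+ m * g1 & g1.[x] = g.[x] *+ m.+1.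
Proof.
exists (g *+ m.+1 + ('X - x%:P) * g^`()).
  rewrite derivM deriv_exp derivXsubC mul1r /= mulrDr mulrA -exprSr.
  by rewrite mulrnAr mulrnAl.
by rewrite hornerD hornerMn hornerM hornerXsubC subrr mul0r addr0.
Qed.

Lemma derivn_XsubC_exp_mul x m g j : (j <= m)%N ->
  (('X - x%:P) ^+ m * g)^`(j).[x] = if j == m then g.[x] *+ m`! else 0.
Proof.
elim: m g j => [|m IH] g [|j]// jm.
- by rewrite derivn0 expr0 mul1r eqxx fact0 mulr1n.
- by rewrite derivn0 exprS -mulrA hornerM hornerXsubC subrr mul0r.
have [g1 e g1x] := deriv_XsubC_exp_mul x m g.
by rewrite derivSn e IH// eqSS g1x factS mulrnA.
Qed.

(** All candidates are multiples of (X - x1)^(K+1), so the jet at x1 vanishes; the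
    derivatives at x0 are then corrected one after the other. *)
Lemma hermite_interpolation (x0 x1 : F) (y : nat -> F) K : x0 != x1 ->
  exists h, (forall k, (k <= K)%N -> h^`(k).[x0] = y k) /\
            (forall k, (k <= K)%N -> h^`(k).[x1] = 0).
Proof.
move=> x01; pose B := ('X - x1%:P) ^+ K.+1.
suff H L : exists g, forall k, (k <= L)%N -> (B * g)^`(k).[x0] = y k.
  have [g Hg] := H K; exists (B * g); split => // k kK.
  by rewrite derivn_XsubC_exp_mul ?leqW// ltn_eqF.
have B0 : B.[x0] != 0.
  by rewrite horner_exp hornerXsubC expf_neq0// subr_eq0.
elim: L => [|L [g Hg]].
  exists (y 0%N / B.[x0])%:P => k; rewrite leqn0 => /eqP->.
  by rewrite derivn0 hornerM hornerC mulrCA divff// mulr1.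
pose c := (y L.+1 - (B * g)^`(L.+1).[x0]) / (B.[x0] *+ (L.+1)`!).
exists (g + c *: ('X - x0%:P) ^+ L.+1) => k kL.
have -> : B * (g + c *: ('X - x0%:P) ^+ L.+1) = B * g + ('X - x0%:P) ^+ L.+1 * (c *: B).
  by rewrite mulrDr -!scalerAr (mulrC B (_ ^+ L.+1)).
rewrite derivnD hornerD derivn_XsubC_exp_mul//; case: eqP => [->|/eqP kL'].
  rewrite hornerZ -mulrnAr /c divfK ?subrKC//.
  by rewrite mulrn_eq0 negb_or B0 -lt0n fact_gt0.
by rewrite addr0 Hg// -ltnS ltn_neqAle kL'.
Qed.

End Hermite.

(** * The matrices a and tau *)
Section RootOfUnity.
Variables (R : realType) (n' : nat).
Local Notation n := n'.+1.
Local Notation C := R[i].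
Local Notation M := 'M[C]_n.
Local Notation alpha := (alpha R n).
Local Notation a := (amx R n).
Local Notation tau := (tau R n).

Lemma alphaX m : alpha ^+ m =
  cos (2 * pi * m%:R / n%:R) +i* sin (2 * pi * m%:R / n%:R).
Proof.
have cexpI (x : R) : cexp (0 +i* x) = cos x +i* sin x.
  by rewrite /cexp /= expR0 mul1r.
elim: m => [|m IH]; first by rewrite mulr0 mul0r cos0 sin0.
rewrite exprSr IH {1}/Defs.alpha cexpI.
have -> : 2 * pi * m.+1%:R / n%:R = 2 * pi * m%:R / n%:R + 2 * pi / n%:R :> R.
  by rewrite -(natr1 m) mulrDr mulr1 mulrDl.
rewrite cosD sinD; set x := 2 * pi * m%:R / _; set y := 2 * pi / _.
by congr (_ +i* _); rewrite addrC.
Qed.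

Lemma cos_eq1_itv (x : R) : 0 < x -> x < 2 * pi -> cos x != 1.
Proof.
move=> x0 x2; apply/eqP => c1.
have sx : 0 < sin (x / 2) by apply: sin_gt0_pi; lra.
have : cos (x / 2 *+ 2) = 1 by rewrite -mulr_natr divfK.
rewrite cos_mulr2n => c2.
have := cos2Dsin2 (x / 2); have := exprn_gt0 2 sx; move: c2; rewrite !mulr2n; lra.
Qed.

Lemma alpha_prim : n.-primitive_root alpha.
Proof.
apply/andP; split=> //; apply/forallP => /= i; rewrite unity_rootE; apply/eqP.
have n0 : (n%:R : R) != 0 by rewrite pnatr_eq0.
rewrite alphaX; have [->|in'] := eqVneq i.+1 n.
  by rewrite mulfK// mulr_natl cos2pi sin2pi eqxx.
have iltn : (i.+1 < n)%N by rewrite ltn_neqAle in' ltn_ord.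
have n00 : 0 < (n%:R : R) by rewrite ltr0n.
apply/negbTE; rewrite eq_complex /= negb_and cos_eq1_itv//.
  by rewrite divr_gt0// mulr_gt0 ?mulr_gt0 ?pi_gt0 ?ltr0n.
by rewrite -mulrA gtr_pMr ?mulr_gt0 ?pi_gt0// ltr_pdivrMr// mul1r ltr_nat.
Qed.

Lemma alpha_neq0 : alpha != 0.
Proof.
apply/eqP => a0; have := prim_expr_order alpha_prim.
by rewrite a0 expr0n /= => /eqP; rewrite eq_sym oner_eq0.
Qed.

Lemma alpha_inj (i j : 'I_n) : alpha ^+ i = alpha ^+ j -> i = j.
Proof.
move/eqP; rewrite (eq_prim_root_expr alpha_prim) => /eqP e; apply/val_inj.
by rewrite /= -(modn_small (ltn_ord i)) -(modn_small (ltn_ord j)).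
Qed.

Lemma amxX m : a ^+ m = diag_mx (\row_i (alpha ^+ i) ^+ m).
Proof.
elim: m => [|m IH].
  rewrite expr0; apply/matrixP => i j; rewrite !mxE expr0.
  by case: eqP.
rewrite exprS IH -mulmxE mulmx_diag; congr diag_mx; apply/rowP => i.
by rewrite !mxE -exprS.
Qed.

Lemma amx_order : a ^+ n = 1.
Proof.
rewrite amxX; apply/matrixP => i j; rewrite !mxE exprAC.
by rewrite (prim_expr_order alpha_prim) expr1n.
Qed.

Lemma amx_mulV : a * a ^+ n' = 1. Proof. by rewrite -exprS amx_order. Qed.
Lemma amx_mulVl : a ^+ n' * a = 1. Proof. by rewrite -exprSr amx_order. Qed.

Lemma amx_unit : a \in unitmx.
Proof. by have [] := @mulmx1_unit C n a (a ^+ n') amx_mulV. Qed.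

Lemma invmx_amx : invmx a = a ^+ n'.
Proof.
by have := mulmxK amx_unit (a ^+ n'); rewrite !mulmxE amx_mulVl mul1r.
Qed.

(** The diagonal entries of a are pairwise distinct. *)
Lemma comm_amx_diag (X : M) : X * a - a * X = 0 -> forall i j, i != j -> X i j = 0.
Proof.
move=> e i j ij; have := congr1 (fun Z : M => Z i j) e.
rewrite /amx -!mulmxE mul_mx_diag mul_diag_mx !mxE mulrC -mulrBl => /eqP.
rewrite mulf_eq0 subr_eq0 => /orP[/eqP/alpha_inj ji|/eqP//].
by rewrite ji eqxx in ij.
Qed.

Lemma comm_amx_diag_entry (X : M) i : (X * a - a * X) i i = 0.
Proof. by rewrite /amx -!mulmxE mul_mx_diag mul_diag_mx !mxE mulrC subrr. Qed.

Lemma trmx_tau_tau : tau^T *m tau = 1%:M.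
Proof.
apply/matrixP => i j; rewrite !mxE (bigD1 (ordS i))//= !mxE eqxx mul1r.
rewrite big1 ?addr0 => [|k ki]; last by rewrite !mxE (negPf ki) mul0r.
by rewrite (inj_eq (@ordS_inj n)).
Qed.

Lemma tau_unit : tau \in unitmx.
Proof. by have [] := mulmx1_unit trmx_tau_tau. Qed.

Lemma invmx_tau : invmx tau = tau^T.
Proof. by rewrite -[LHS]mul1mx -trmx_tau_tau mulmxK ?tau_unit. Qed.

Lemma tauV_mul p (X : 'M[C]_(n, p)) i j : (invmx tau *m X) i j = X (ordS i) j.
Proof.
rewrite invmx_tau mxE (bigD1 (ordS i))//= !mxE eqxx mul1r.
by rewrite big1 ?addr0 => // k ki; rewrite !mxE (negPf ki) mul0r.
Qed.

Lemma mul_tau p (X : 'M[C]_(p, n)) i j : (X *m tau) i j = X i (ordS j).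
Proof.
rewrite mxE (bigD1 (ordS j))//= !mxE eqxx mulr1.
by rewrite big1 ?addr0 => // k ki; rewrite !mxE (negPf ki) mulr0.
Qed.

Lemma alpha_ordS (i : 'I_n) : alpha ^+ ordS i = alpha * alpha ^+ i.
Proof. by rewrite /= (prim_expr_mod alpha_prim) exprS. Qed.

Lemma tauV_amx_tau : invmx tau *m a *m tau = alpha *: a.
Proof.
apply/matrixP => i j; rewrite mul_tau tauV_mul !mxE (inj_eq (@ordS_inj n)).
by rewrite alpha_ordS mulrnAr.
Qed.

Lemma iter_ordS m (i : 'I_n) : iter m (@ordS n) i = ((i + m) %% n)%N :> nat.
Proof.
elim: m => [|m IH]; first by rewrite addn0 modn_small.
by rewrite iterS /= IH -addn1 modnDml addn1 addnS.
Qed.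

Lemma tauVX_mul m (v : 'cV[C]_n) i :
  (invmx tau ^+ m *m v) i 0 = v (iter m (@ordS n) i) 0.
Proof.
elim: m i => [|m IH] i; first by rewrite expr0 mul1mx.
by rewrite exprS -mulmxE -mulmxA tauV_mul IH -iterSr.
Qed.

Lemma BmxE (v : 'cV[C]_n) r i : Bmx v r i = v (iter i (@ordS n) r) 0.
Proof. by rewrite mxE tauVX_mul. Qed.

(** Applying tau^-1 shifts the columns of B(v) cyclically, tau having order n. *)
Lemma tauV_Bmx (v : 'cV[C]_n) : invmx tau *m Bmx v = Bmx v *m tau.
Proof.
apply/matrixP => r i; rewrite tauV_mul mul_tau !BmxE; congr (v _ 0); apply: ord_inj.
by rewrite !iter_ordS /= modnDml modnDmr addSn addnS.
Qed.

End RootOfUnity.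

(** * The recursion for the sequence Q *)
Section Lax.
Variables (R : realType) (n' : nat).
Local Notation n := n'.+1.
Local Notation C := R[i].
Local Notation M := 'M[C]_n.
Local Notation a := (amx R n).
Implicit Types (D : set (R * R)) (u : R * R -> M) (f g : nat -> R * R -> M).

(** The formal series of f commutes with d/dx + a z + u on D. *)
Definition lax D u f : Prop :=
  (forall i, smoothMx D (f i)) /\
  forall p, D p -> lie (f 0%N p) a = 0 /\
    forall i, dirM (1, 0) (f i) p + lie (u p) (f i p) = lie (f i.+1 p) a.

Lemma smoothMx_conv D f g k : open D -> (forall i, smoothMx D (f i)) ->
  (forall i, smoothMx D (g i)) -> smoothMx D (fun p => conv (f^~ p) (g^~ p) k).
Proof. by move=> oD sf sg; apply: smoothMx_sum => // i _; apply: smoothMxM. Qed.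

Lemma dirM_conv D f g k p w : open D -> (forall i, smoothMx D (f i)) ->
  (forall i, smoothMx D (g i)) -> D p ->
  dirM w (fun p => conv (f^~ p) (g^~ p) k) p =
  \sum_(i < k.+1) (dirM w (f i) p * g (k - i)%N p + f i p * dirM w (g (k - i)%N) p).
Proof.
move=> oD sf sg Dp.
rewrite (dirM_sum (F := fun (i : 'I_k.+1) p => f i p *m g (k - i)%N p) _ _ oD _ Dp).
  by apply: eq_bigr => i _; rewrite (dirMM _ oD (sf i) (sg _) Dp).
by move=> i _; apply: smoothMxM.
Qed.

Lemma lax_conv D u f g : open D -> lax D u f -> lax D u g ->
  lax D u (fun k p => conv (f^~ p) (g^~ p) k).
Proof.
move=> oD [sf lf] [sg lg]; split=> [k|p Dp]; first exact: smoothMx_conv.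
have [f0 ef] := lf _ Dp; have [g0 eg] := lg _ Dp.
have cf : f 0%N p * a = a * f 0%N p by apply/eqP; rewrite -subr_eq0; apply/eqP.
have cg : g 0%N p * a = a * g 0%N p by apply/eqP; rewrite -subr_eq0; apply/eqP.
split=> [|k].
  by rewrite conv_0 /lie !mulmxE -mulrA cg mulrA cf mulrA subrr.
rewrite (dirM_conv _ _ oD sf sg Dp).
exact: (conv_lax k cf cg ef eg).
Qed.

Lemma lax_conv1 D u : open D -> lax D u (fun k _ => conv1 M k).
Proof.
move=> oD; split=> [k|p Dp]; first exact: smoothMx_cst.
have l0 k (X : M) : lie (conv1 M k) X = 0.
  by rewrite /lie !mulmxE commr_nat subrr.
split=> // i; rewrite dirM_cst add0r l0.
by rewrite /lie !mulmxE commr_nat subrr.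
Qed.

Lemma lax_cpow D u f m : open D -> lax D u f ->
  lax D u (fun k p => cpow (f^~ p) m k).
Proof.
move=> oD lf; elim: m => [|m IH]; first exact: lax_conv1.
exact: (lax_conv oD lf IH).
Qed.

(** If f_l commutes with a it is diagonal, and then the diagonal parts of [u, f_l]
    and of [f_(l+1), a] both vanish. *)
Lemma lax_diag_const D u f l p (i : 'I_n) : lax D u f -> D p -> zero_diag (u p) ->
  lie (f l p) a = 0 -> dirM (1, 0) (f l) p i i = 0.
Proof.
move=> [_ /(_ p) lf] Dp u0 fa; have [_ /(_ l) e] := lf Dp.
have off := comm_amx_diag fa.
have -> : dirM (1, 0) (f l) p = lie (f l.+1 p) a - lie (u p) (f l p).
  by rewrite -e addrK.
have d1 : (u p *m f l p) i i = 0.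
  rewrite mxE big1// => j _; have [->|ji] := eqVneq j i; first by rewrite u0 mul0r.
  by rewrite off ?mulr0.
have d2 : (f l p *m u p) i i = 0.
  rewrite mxE big1// => j _; have [->|ji] := eqVneq j i; first by rewrite u0 mulr0.
  by rewrite off ?mul0r// eq_sym.
have d3 := comm_amx_diag_entry (f l.+1 p) i.
have E (X Y : M) : (X - Y) i i = X i i - Y i i by rewrite !mxE.
by rewrite E [X in X - _]d3 /lie E d1 d2 !subrr.
Qed.

(** If the series agree before l, the recursion fixes f_l up to a diagonal matrix,
    and the n-th power fixes the latter. *)
Lemma lax_unique D u f g : open D -> lax D u f -> lax D u g ->
  (forall p, D p -> f 0%N p = a) -> (forall p, D p -> g 0%N p = a) ->
  (forall p, D p -> cpow (f^~ p) n = conv1 M) ->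
  (forall p, D p -> cpow (g^~ p) n = conv1 M) ->
  forall i p, D p -> f i p = g i p.
Proof.
move=> oD [sf lf] [sg lg] f0 g0 fn gn; elim/ltn_ind => -[|l] IH p Dp.
  by rewrite f0 ?g0.
have [_ /(_ l) ef] := lf _ Dp; have [_ /(_ l) eg] := lg _ Dp.
have e : lie (f l.+1 p) a = lie (g l.+1 p) a.
  rewrite -ef -eg (IH l)//; congr (_ + _); apply: (dirM_open _ oD _ Dp) => q.
  by rewrite inE => Dq; rewrite IH.
have [i il||_] := @cpow_first_difference _ (f^~ p) (g^~ p) l.+1 n isT.
- exact: IH.
- by rewrite f0// g0.
rewrite fn// gn// subrr mul0r f0// amx_order mul1r => /esym/eqP.
rewrite -scaler_nat scaler_eq0 pnatr_eq0 /= subr_eq0 => /eqP.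
exact.
Qed.

End Lax.

Section QPower.
Variables (R : realType) (n' : nat).
Local Notation n := n'.+1.
Local Notation C := R[i].
Local Notation M := 'M[C]_n.
Local Notation a := (amx R n).
Variable Q : nat -> 'M[diffpoly R n]_n.
Hypothesis hQ : is_Qseq Q.

Definition Qseq (u : R * R -> M) (i : nat) (p : R * R) : M := eval_dp (Q i) u p.

Lemma Qseq0 u p : Qseq u 0 p = a.
Proof. by rewrite /Qseq; case: hQ => -> _ _; rewrite eval_dp_cst. Qed.

Lemma lax_Qseq D u : open D -> smoothMx D u -> (forall p, D p -> zero_diag (u p)) ->
  lax D u (Qseq u).
Proof.
move=> oD su u0; split=> [i|p Dp]; first exact: smoothMx_eval_dp.
split; first by rewrite Qseq0 /lie subrr.
by move=> i; case: hQ => _ _ /(_ D u oD su u0 i p Dp).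
Qed.

Lemma cpow_eq (A : nzRingType) (f g : nat -> A) m l :
  (forall i, (i <= l)%N -> f i = g i) -> cpow f m l = cpow g m l.
Proof.
elim: m l => [|m IH] l fg //=; apply: eq_bigr => i _.
have il : (i <= l)%N by rewrite -ltnS.
rewrite (fg _ il) (IH (l - i)%N) // => j jl.
by apply: fg; exact: leq_trans jl (leq_subr _ _).
Qed.

Lemma cpow_single (A : nzRingType) (f : nat -> A) m l :
  (forall i, (0 < i <= l)%N -> f i = 0) -> (0 < l)%N -> cpow f m l = 0.
Proof.
case: l => // l; elim: m => [|m IH] f0 _ //=.
rewrite /conv big_ord_recl big1 => [|i _].
  by rewrite subn0 IH// mulr0 addr0.
by rewrite f0 ?mul0r// /bump /=.
Qed.

(** The function is a matrix of polynomials in x; its diagonal is taken to be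
    exactly zero, in agreement with the jet of u. *)
Lemma polynomial_jets D u p K : open D -> (forall q, D q -> zero_diag (u q)) -> D p ->
  exists u' : R * R -> M, [/\ smoothMx setT u', forall q, zero_diag (u' q),
    forall v, (v.1 <= K)%N -> jet u' p v = jet u p v &
    forall v, (v.1 <= K)%N -> jet u' (p.1 + 1, p.2) v = 0].
Proof.
move=> oD u0 Dp.
have x01 : (p.1%:C : C) != (p.1 + 1)%:C.
  by rewrite eq_complex /= eqxx andbT eq_sym -subr_eq0 addrAC subrr add0r oner_eq0.
have H (rs : 'I_n * 'I_n) : exists h : {poly C}, [/\ rs.1 = rs.2 -> h = 0,
    forall k, (k <= K)%N -> h^`(k).[p.1%:C] = jet u p (k, rs) &
    forall k, (k <= K)%N -> h^`(k).[(p.1 + 1)%:C] = 0].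
  have [e|ne] := eqVneq rs.1 rs.2.
    exists 0; split=> // k _; last by rewrite linear0 horner0.
    rewrite linear0 horner0 /jet /= (@iter_dx_open _ D _ (fun=> 0) _ _ oD _ Dp).
      rewrite (_ : (fun=> 0) = fun q : R * R => (0 : {poly C}).[q.1%:C]).
        by rewrite iter_dx_horner linear0 horner0.
      by apply/funext => q; rewrite horner0.
    by move=> q; rewrite inE e => /u0.
  have [h [h0 h1]] := hermite_interpolation (fun k => jet u p (k, rs)) K x01.
  by exists h; split=> // e; rewrite e eqxx in ne.
have [h Hh] := choice H.
pose u' (q : R * R) : M := \matrix_(r, s) (h (r, s)).[q.1%:C].
have jetE q v : jet u' q v = (h v.2)^`(v.1).[q.1%:C].
  rewrite /jet (_ : (fun q => _) = fun q : R * R => (h v.2).[q.1%:C]).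
    by rewrite iter_dx_horner.
  by apply/funext => x; rewrite mxE -surjective_pairing.
exists u'; split.
- move=> r s; apply: (smoothC_open openT _ (smoothC_horner (h (r, s)) openT)).
  by move=> q _; rewrite mxE.
- by move=> q r; rewrite mxE; have [->//] := Hh (r, r); rewrite horner0.
- by move=> v vK; rewrite jetE; have [_ -> //] := Hh v.2; case: v vK.
- by move=> v vK; rewrite jetE; have [_ _ ->] := Hh v.2.
Qed.

Definition Qorder l : nat :=
  (\max_(i < l.+1) \max_(r < n) \max_(s < n) jet_order (Q i r s))%N.

Lemma leq_Qorder l i r s : (i <= l)%N -> (jet_order (Q i r s) <= Qorder l)%N.
Proof.
move=> il; rewrite /Qorder -ltnS in il *.
apply: leq_trans (leq_bigmax (Ordinal il)) => /=.
apply: leq_trans (leq_bigmax r) => /=.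
exact: (leq_bigmax (F := fun s => jet_order (Q i r s)) s).
Qed.

Lemma Qseq_jet l u u' p q : (forall v, (v.1 <= Qorder l)%N -> jet u p v = jet u' q v) ->
  forall i, (i <= l)%N -> Qseq u i p = Qseq u' i q.
Proof.
move=> e i il; apply/matrixP => r s; rewrite !eval_dpE; apply: eq_eval_poly => v vo.
by apply: e; apply: leq_trans vo _; exact: leq_Qorder.
Qed.

Lemma Qseq_jet0 l u p : (forall v, (v.1 <= Qorder l)%N -> jet u p v = 0) ->
  forall i, (0 < i <= l)%N -> Qseq u i p = 0.
Proof.
move=> e i /andP[i0 il]; apply/matrixP => r s; rewrite eval_dpE eval_poly_0.
  by case: hQ => _ -> //; rewrite mxE.
by move=> v vo; apply: e; apply: leq_trans vo _; exact: leq_Qorder.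
Qed.

(** By induction on the coefficient: once the coefficients up to l are those of
    the identity, the next one is diagonal with x-independent entries.  Its value at p
    depends on a finite jet of u only, and for the polynomial potential with
    that jet the value is transported along x to a point with zero jet, where it
    vanishes as the Q_i have no constant term. *)
Theorem Qseq_power D u : open D -> smoothMx D u -> (forall p, D p -> zero_diag (u p)) ->
  forall p, D p -> cpow ((Qseq u)^~ p) n = conv1 M.
Proof.
move=> oD su u0 p Dp; apply/funext => l; elim: l D u oD su u0 p Dp => [|l IH] D u oD su u0 p Dp.
  by rewrite cpow_0 Qseq0 amx_order.
pose P l (u : R * R -> M) (p : R * R) : M := cpow ((Qseq u)^~ p) n l.
(* the coefficient l+1 commutes with a, for every potential *)
have comm D' u' : open D' -> smoothMx D' u' -> (forall q, D' q -> zero_diag (u' q)) ->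
    forall q, D' q -> lie (P l.+1 u' q) a = 0.
  move=> oD' su' u0' q Dq.
  have [_ /(_ q Dq)[_ /(_ l) <-]] := lax_cpow n oD' (lax_Qseq oD' su' u0').
  rewrite (IH D' u')// (@dirM_open _ _ _ D' _ (fun=> conv1 M l) _ _ oD' _ Dq).
    rewrite dirM_cst add0r /conv1; case: eqP => _; rewrite /lie.
      by rewrite mulmx1 mul1mx subrr.
    by rewrite mulmx0 mul0mx subrr.
  by move=> x; rewrite inE => Dx; rewrite (IH D' u').
have [u' [su' u0' j0 j1]] := polynomial_jets (Qorder l.+1) oD u0 Dp.
have -> : cpow ((Qseq u)^~ p) n l.+1 = P l.+1 u' p.
  apply: cpow_eq => i il; apply: Qseq_jet il => v vo; by rewrite j0.
have P0 : P l.+1 u' (p.1 + 1, p.2) = 0.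
  by apply: cpow_single => // i il; apply: Qseq_jet0 il.
rewrite /conv1 /=; apply/matrixP => i j; rewrite mxE.
have lu' : lax setT u' (Qseq u') by apply: lax_Qseq => //; exact: openT.
have cm q : lie (P l.+1 u' q) a = 0 by apply: (comm setT) => //; exact: openT.
have [<-{j}|ij] := eqVneq i j; last exact: comm_amx_diag (cm p) _ _ ij.
have lP := lax_cpow n openT lu'.
have dP q : dirC (1, 0) (fun q => P l.+1 u' q i i) q = 0.
  by have := lax_diag_const i lP I (u0' q) (cm q); rewrite mxE.
have [sr si] := lP.1 l.+1 i i.
have e : (p.1 + 1, p.2) = (1 : R) *: ((1, 0) : R * R) + p.
  rewrite [p in RHS]surjective_pairing.
  by congr (_, _); rewrite /= /GRing.scale /= ?mulr0 ?add0r ?mulr1 1?addrC.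
have /matrixP/(_ i i) := P0; rewrite e mxE => <-.
apply/eqP; rewrite eq_complex; apply/andP; split; apply/eqP; apply/esym.
  apply: (@line_cst R _ (fun q => complex.Re (P l.+1 u' q i i)) p (1, 0) 1) => s _.
    exact: (smooth_derivable sr).
  exact: (congr1 (@complex.Re R) (dP _)).
apply: (@line_cst R _ (fun q => complex.Im (P l.+1 u' q i i)) p (1, 0) 1) => s _.
  exact: (smooth_derivable si).
exact: (congr1 (@complex.Im R) (dP _)).
Qed.

End QPower.

(** * Evolution of the factor a z + Y *)
Section Evaluation.
Variables (R : realType) (n' : nat).
Local Notation n := n'.+1.
Local Notation C := R[i].
Local Notation M := 'M[C]_n.
Implicit Types (z : C).

Lemma horner_scalarM (p q : {poly M}) z : (p * q).[z%:M] = p.[z%:M] * q.[z%:M].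
Proof.
apply: hornerM_comm; rewrite /comm_poly.
by rewrite -!mulmxE scalar_mxC.
Qed.

Lemma mul_scalar_mxE z (X : M) : X * z%:M = z *: X.
Proof. by rewrite -mulmxE mul_mx_scalar. Qed.

Lemma tpoly_horner (f : nat -> M) N z : (tpoly f N).[z%:M] = \sum_(i < N.+1) z ^+ (N - i) *: f i.
Proof.
elim: N => [|N IH]; first by rewrite /= hornerC big_ord1 expr0 scale1r.
rewrite /= hornerD hornerMX hornerC IH [RHS]big_ord_recr /= subnn expr0 scale1r.
congr (_ + _); rewrite mul_scalar_mxE scaler_sumr; apply: eq_bigr => i _.
by rewrite scalerA -exprS subSn// -ltnS.
Qed.

(** The left side is linear in f with constant coefficients, so derivatives along
    the plane pass through the derivative in z. *)
Lemma tpoly_deriv_horner N z : exists c : nat -> C, forall f : nat -> M,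
  ((tpoly f N)^`()).[z%:M] = \sum_(i < N.+1) c i *: f i.
Proof.
elim: N => [|N [c IH]].
  by exists (fun=> 0) => f; rewrite /= derivC horner0 big_ord1 scale0r.
exists (fun i => if i == N.+1 then 0 else z * c i + z ^+ (N - i)) => f.
rewrite [tpoly _ _]/= derivD derivC addr0 derivM derivX mulr1 hornerD hornerMX IH tpoly_horner.
rewrite [RHS]big_ord_recr /= eqxx scale0r addr0 mul_scalar_mxE scaler_sumr -big_split /=.
by apply: eq_bigr => i _; rewrite ltn_eqF// scalerA -scalerDl.
Qed.

Lemma tpoly_linE (a X : M) z : (tpoly (lin a X) 1).[z%:M] = z *: a + X.
Proof. by rewrite /= hornerD hornerMX !hornerC mul_scalar_mxE. Qed.

Context (D : set (R * R)) (oD : open D).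

Lemma smoothMx_tpoly_horner (f : nat -> R * R -> M) N z : (forall i, smoothMx D (f i)) ->
  smoothMx D (fun p => (tpoly (f^~ p) N).[z%:M]).
Proof.
move=> sf; have s : smoothMx D (fun p => \sum_(i < N.+1) z ^+ (N - i) *: f i p).
  by apply: smoothMx_sum => // i _; exact: smoothMxZ.
by apply: (smoothMx_open oD _ s) => p _; rewrite tpoly_horner.
Qed.

Lemma dirM_tpoly_horner (f : nat -> R * R -> M) N z w p : (forall i, smoothMx D (f i)) ->
  D p -> dirM w (fun p => (tpoly (f^~ p) N).[z%:M]) p =
         (tpoly (fun i => dirM w (f i) p) N).[z%:M].
Proof.
move=> sf Dp; rewrite tpoly_horner.
rewrite (_ : (fun p => _) = fun p => \sum_(i < N.+1) z ^+ (N - i) *: f i p); last first.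
  by apply/funext => q; rewrite tpoly_horner.
rewrite (dirM_sum (F := fun (i : 'I_N.+1) p => z ^+ (N - i) *: f i p) _ _ oD _ Dp).
  by apply: eq_bigr => i _; rewrite (dirMZ _ _ (sf i) Dp).
by move=> i _; exact: smoothMxZ.
Qed.

Lemma smoothMx_tpoly_deriv_horner (f : nat -> R * R -> M) N z : (forall i, smoothMx D (f i)) ->
  smoothMx D (fun p => ((tpoly (f^~ p) N)^`()).[z%:M]).
Proof.
move=> sf; have [c Hc] := tpoly_deriv_horner N z.
have s : smoothMx D (fun p => \sum_(i < N.+1) c i *: f i p).
  by apply: smoothMx_sum => // i _; exact: smoothMxZ.
by apply: (smoothMx_open oD _ s) => p _; rewrite Hc.
Qed.

Lemma dirM_tpoly_deriv_horner (f : nat -> R * R -> M) N z w p : (forall i, smoothMx D (f i)) ->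
  D p -> dirM w (fun p => ((tpoly (f^~ p) N)^`()).[z%:M]) p =
         ((tpoly (fun i => dirM w (f i) p) N)^`()).[z%:M].
Proof.
move=> sf Dp; have [c Hc] := tpoly_deriv_horner N z; rewrite Hc.
rewrite (_ : (fun p => _) = fun p => \sum_(i < N.+1) c i *: f i p); last first.
  by apply/funext => q; rewrite Hc.
rewrite (dirM_sum (F := fun (i : 'I_N.+1) p => c i *: f i p) _ _ oD _ Dp).
  by apply: eq_bigr => i _; rewrite (dirMZ _ _ (sf i) Dp).
by move=> i _; exact: smoothMxZ.
Qed.

End Evaluation.

(** Conjugation by t multiplies c by al and B c B^-1 by al^-1. *)
Lemma circulant_conj (F : comNzRingType) m (t' t c B Bi : 'M[F]_m) (al : F) :
  t' *m t = 1%:M -> t *m t' = 1%:M -> B *m Bi = 1%:M -> Bi *m B = 1%:M ->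
  t' *m c *m t = al *: c -> t' *m B = B *m t ->
  t' *m (c *m B *m c *m Bi) *m t = c *m B *m c *m Bi.
Proof.
move=> t't tt' BBi BiB ta tB.
have h1 : t' *m c = al *: (c *m t').
  by rewrite scalemxAl -ta -mulmxA tt' mulmx1.
have h2 : al *: (t *m c) = c *m t.
  by rewrite scalemxAr -ta !mulmxA tt' mul1mx.
have h3 : t *m Bi = Bi *m t'.
  rewrite -[LHS]mul1mx -BiB -(mulmxA Bi) (mulmxA B) -tB -!mulmxA BBi mulmx1.
  by [].
rewrite !mulmxA h1 -!scalemxAl -(mulmxA c) tB.
transitivity (c *m B *m (al *: (t *m c)) *m Bi *m t).
  by rewrite -scalemxAr -!scalemxAl !mulmxA.
rewrite h2 -!mulmxA.
by rewrite (mulmxA t Bi) h3 -mulmxA t't mulmx1.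
Qed.

Section Flow.
Variables (R : realType) (n' : nat).
Local Notation n := n'.+1.
Local Notation C := R[i].
Local Notation M := 'M[C]_n.
Local Notation a := (amx R n).
Local Notation b := (amx R n ^+ n').
Local Notation tau := (tau R n).
Local Notation alpha := (alpha R n).
Variables (v : 'cV[C]_n) (k : C).
Variables (D : set (R * R)) (oD : open D) (E : R * R -> C -> M).
Hypothesis sE : forall z, smoothMx D (E^~ z).
Hypothesis uE : forall p, D p -> E p k \in unitmx.
Local Notation vt := (vtilde E v k).
Local Notation Bt p := (Bmx (vt p)).
Hypothesis uB : forall p, D p -> Bt p \in unitmx.

Definition Yt p : M := Ymx (vt p) k.
(** The factor of the transformation is a (z - Zt). *)
Definition Zt p : M := k *: (Bt p *m a *m invmx (Bt p)).

Lemma YtE p : Yt p = - (a * Zt p).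
Proof. by rewrite /Yt /Ymx /Zt -mulmxE -scalemxAr !mulmxA. Qed.

Lemma smooth_vt : smoothMx D vt.
Proof. by apply: smoothMxM (smoothMx_inv _ _ _) (smoothMx_cst _ _). Qed.

Lemma BtE p r j : Bt p r j = (invmx tau ^+ j *m vt p) r 0.
Proof. by rewrite mxE. Qed.

Lemma smooth_Bt : smoothMx D (fun p => Bt p).
Proof.
move=> r j; have s := smoothMxM oD (smoothMx_cst D (invmx tau ^+ j)) smooth_vt.
by apply: (smoothC_open oD _ (s r 0)) => p _; rewrite BtE.
Qed.

Lemma smooth_Zt : smoothMx D Zt.
Proof.
apply: smoothMxZ => //; apply: smoothMxM => //; last exact: smoothMx_inv smooth_Bt uB.
by apply: smoothMxM => //; [exact: smooth_Bt|exact: smoothMx_cst].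
Qed.

Lemma smooth_Yt : smoothMx D Yt.
Proof.
have s := smoothMxN oD (smoothMxM oD (smoothMx_cst D a) smooth_Zt).
by apply: (smoothMx_open oD _ s) => p _; rewrite YtE.
Qed.

Lemma Zt_Bt p : D p -> Zt p *m Bt p = k *: (Bt p *m a).
Proof. by move=> Dp; rewrite /Zt -scalemxAl mulmxKV ?uB. Qed.

Lemma ZtX_Bt m p : D p -> Zt p ^+ m *m Bt p = k ^+ m *: (Bt p *m a ^+ m).
Proof.
move=> Dp; elim: m => [|m IH]; first by rewrite !expr0 mul1mx mulmx1 scale1r.
rewrite exprSr -mulmxE -mulmxA Zt_Bt// -scalemxAr mulmxA IH -scalemxAl scalerA.
by rewrite -exprS -mulmxA mulmxE -exprSr.
Qed.

Lemma ZtX_order p : D p -> Zt p ^+ n = (k ^+ n)%:M.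
Proof.
move=> Dp; apply: (can_inj (mulmxK (uB Dp))).
by rewrite ZtX_Bt// amx_order mulmx1 mul_scalar_mx.
Qed.

Lemma smooth_ZtX m : smoothMx D (fun p => Zt p ^+ m).
Proof.
elim: m => [|m IH]; first exact: smoothMx_cst.
apply: (smoothMx_open oD _ (smoothMxM oD smooth_Zt IH)) => p _.
by rewrite exprS.
Qed.

Lemma circulant_Yt p : D p -> circulant (Yt p).
Proof.
move=> Dp; have uT := tau_unit R n'; rewrite /circulant /Yt /Ymx.
rewrite mulmxN mulNmx -scalemxAr -scalemxAl; congr (- (_ *: _)).
apply: (circulant_conj (mulVmx uT) (mulmxV uT) (mulmxV (uB Dp)) (mulVmx (uB Dp))).
  exact: tauV_amx_tau.
exact: tauV_Bmx.
Qed.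

(** The common form of the x- and the t-equation: along w the connection matrix of
    E is sum_i c_i z^(N-i), where the weights of the c_i make it equivariant
    under conjugation by tau and z -> alpha z; h is c transformed by the factor
    a z + Yt. *)
Definition flow w N (c h : nat -> R * R -> M) : Prop :=
  [/\ forall i, smoothMx D (c i),
      forall z p, D p -> dirM w (E^~ z) p = E p z *m (tpoly (c^~ p) N).[z%:M],
      forall p i, D p -> (i <= N)%N ->
        invmx tau *m c i p *m tau = alpha ^+ (N - i) *: c i p
    & forall p, D p -> [/\ c 0%N p = a, h 0%N p = a & forall i, (i < N)%N ->
        h i.+1 p * a + h i p * Yt p = a * c i.+1 p + Yt p * c i p]].

Context {w : R * R} {N : nat} {c h : nat -> R * R -> M}.
Hypothesis F : flow w N c h.
Local Notation W z p := (tpoly (c^~ p) N).[z%:M].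

Lemma vt_flow p : D p -> dirM w vt p = - (W k p *m vt p).
Proof.
move=> Dp; have [_ FE _ _] := F.
have e : dirM w (fun p => E p k *m vt p) p = 0.
  rewrite -(dirM_cst v p w); apply: (dirM_open _ oD _ Dp) => q; rewrite inE => Dq.
  by rewrite /vtilde mulKVmx ?uE.
move: e; rewrite (dirMM _ oD (sE k) smooth_vt Dp) FE// -mulmxA -mulmxDr.
move/(congr1 (mulmx (invmx (E p k)))); rewrite mulmx0 mulKmx ?uE// => /eqP.
by rewrite addrC addr_eq0 => /eqP.
Qed.

(** Equivariance moves the spectral parameter from z to alpha^j z. *)
Lemma tau_flow p j z : D p -> invmx tau ^+ j *m W z p = W (alpha ^+ j * z) p *m invmx tau ^+ j.
Proof.
move=> Dp; have [_ _ Ft _] := F.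
have tW x : invmx tau *m W x p = W (alpha * x) p *m invmx tau.
  rewrite !tpoly_horner mulmx_sumr mulmx_suml; apply: eq_bigr => i _.
  have iN : (i <= N)%N by rewrite -ltnS.
  have e : invmx tau *m c i p = alpha ^+ (N - i) *: (c i p *m invmx tau).
    by rewrite scalemxAl -Ft// mulmxK ?tau_unit.
  by rewrite -scalemxAr e -scalemxAl [(alpha * x) ^+ _]exprMn scalerA mulrC.
elim: j z => [|j IH] z; first by rewrite !expr0 mul1mx mulmx1 mul1r.
rewrite exprS -mulmxE -mulmxA IH mulmxA tW -mulmxA.
by rewrite mulrA -exprS.
Qed.

Lemma col_flow p j : D p -> dirM w (fun p => invmx tau ^+ j *m vt p) p =
  - (W (alpha ^+ j * k) p *m (invmx tau ^+ j *m vt p)).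
Proof.
move=> Dp; rewrite (dirMM _ oD (smoothMx_cst _ _) smooth_vt Dp) dirM_cst mul0mx add0r.
by rewrite vt_flow// mulmxN mulmxA tau_flow// -mulmxA.
Qed.

(** Column j evolves by the connection matrix at alpha^j k; the powers of alpha^j
    appear as powers of a on the right, and k B a = Z B turns them into powers
    of Z. *)
Lemma Bt_flow p : D p -> dirM w (fun p => Bt p) p =
  - (\sum_(i < N.+1) c i p * Zt p ^+ (N - i)) *m Bt p.
Proof.
move=> Dp; rewrite mulNmx mulmx_suml.
under eq_bigr do rewrite -mulmxE -mulmxA ZtX_Bt// -scalemxAr mulmxA.
apply/matrixP => r j; rewrite mxE.
transitivity (dirM w (fun p => invmx tau ^+ j *m vt p) p r 0).
  by rewrite [RHS]mxE; congr (dirC _ _ p); apply/funext => q; rewrite mxE.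
rewrite col_flow// tpoly_horner mulmx_suml [LHS]mxE [RHS]mxE !summxE; congr (- _).
apply: eq_bigr => i _; rewrite amxX mul_mx_diag -scalemxAl [LHS]mxE [RHS]mxE.
rewrite [(_ * k) ^+ _]exprMn (mulrC (_ ^+ (N - i))) -mulrA; congr (_ * _).
rewrite [RHS]mxE [X in _ = _ * X]mxE mulrC; congr (_ * _).
by rewrite !mxE; apply: eq_bigr => s _; rewrite BtE.
Qed.

Lemma Zt_flow p : D p -> dirM w Zt p =
  Zt p * (\sum_(i < N.+1) c i p * Zt p ^+ (N - i)) -
  (\sum_(i < N.+1) c i p * Zt p ^+ (N - i)) * Zt p.
Proof.
move=> Dp; set S := \sum_(i < _) _.
apply: (can_inj (mulmxK (uB Dp))); rewrite mulmxBl -!mulmxE.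
have := dirMM w oD smooth_Zt smooth_Bt Dp.
rewrite (@dirM_open _ _ _ D _ (fun p => k *: (Bt p *m a)) _ _ oD _ Dp); last first.
  by move=> q; rewrite inE => Dq; rewrite Zt_Bt.
have sBa := smoothMxM oD smooth_Bt (smoothMx_cst D a).
rewrite (dirMZ _ _ sBa Dp) (dirMM _ oD smooth_Bt (smoothMx_cst D a) Dp) dirM_cst mulmx0 addr0.
rewrite Bt_flow// -/S !mulNmx mulmxN => e.
have -> : dirM w Zt p *m Bt p = k *: - (S *m Bt p *m a) + Zt p *m (S *m Bt p).
  by rewrite e subrK.
have := Zt_Bt Dp; clearbody S; move: (Zt p) (Bmx _) => {e} Z B eZ.
rewrite -[Z *m S *m B]mulmxA -[S *m Z *m B]mulmxA eZ -scalemxAr (mulmxA S B) scalerN.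
exact: addrC.
Qed.

(** Both equations of the Baecklund system, up to the identification of h. *)
Lemma Yt_flow p : D p -> dirM w Yt p = Yt p * c N p - h N p * Yt p.
Proof.
move=> Dp; have [_ _ _ /(_ p Dp)[c0 h0 ch]] := F.
have ab : a * b = 1 := amx_mulV R n'; have ba : b * a = 1 := amx_mulVl R n'.
have e : dirM w Yt p = - (a * dirM w Zt p).
  rewrite (@dirM_open _ _ _ D _ (fun p => - (a *m Zt p)) _ _ oD _ Dp); last first.
    by move=> q _; rewrite YtE.
  have s := smoothMxM oD (smoothMx_cst D a) smooth_Zt.
  rewrite (dirMN _ s Dp) (dirMM _ oD (smoothMx_cst D a) smooth_Zt Dp) dirM_cst.
  by rewrite mul0mx add0r.
rewrite e; have -> : dirM w Zt p = Zt p * c N p - b * h N p * a * Zt p.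
  rewrite Zt_flow//.
  apply: (@dressing_commutator M (Zt p) (c^~ p) (fun i => b * h i p * a) N).
    by rewrite h0 c0 ba mul1r.
  move=> i iN; have := ch i iN; rewrite YtE; move: (Zt p) => Z.
  move/(congr1 (fun x => b * x)).
  by rewrite !mulNr !mulrN !mulrDr !mulrN !mulrA ba !mul1r.
rewrite YtE; move: (Zt p) => Z.
transitivity (- (a * Z * c N p) + a * b * h N p * a * Z); first by nc_ring.
by rewrite ab mul1r; nc_ring.
Qed.

Local Notation L p := (tpoly (lin a (Yt p)) 1).
Local Notation P p := (tpoly (fun i => Zt p ^+ i * b) n').

Lemma factor_gauge p : D p -> L p * tpoly (c^~ p) N - (dirM w Yt p)%:P = tpoly (h^~ p) N * L p.
Proof.
move=> Dp; have [_ _ _ /(_ p Dp)[c0 h0 ch]] := F.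
by rewrite Yt_flow//; apply: tpoly_gauge.
Qed.

Lemma adj_factor p : D p -> P p * L p = 'X ^+ n - (k ^+ n)%:M%:P.
Proof.
move=> Dp; rewrite (tpoly_adj_factor _ (amx_mulV R n') (amx_mulVl R n') (YtE p)).
by rewrite ZtX_order.
Qed.

Lemma XnB_central (p : {poly M}) : ('X ^+ n - (k ^+ n)%:M%:P) * p = p * ('X ^+ n - (k ^+ n)%:M%:P).
Proof.
rewrite mulrBl mulrBr; congr (_ - _); first by rewrite commr_polyXn.
apply/polyP => i; rewrite coefCM coefMC.
by rewrite -!mulmxE scalar_mxC.
Qed.

Lemma factor_adj p : D p -> L p * P p = 'X ^+ n - (k ^+ n)%:M%:P.
Proof.
move=> Dp; rewrite (tpoly_factor_adj _ (amx_mulV R n') (YtE p)) ZtX_order//.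
by rewrite -XnB_central -mulrA -polyCM amx_mulV polyC1 mulr1.
Qed.

Lemma smooth_adj i : smoothMx D (fun p => Zt p ^+ i * b).
Proof. by apply: smoothMxM (smooth_ZtX i) (smoothMx_cst _ _). Qed.

Lemma adj_flow p : D p -> tpoly (fun i => dirM w (fun p => Zt p ^+ i * b) p) n' =
  P p * tpoly (h^~ p) N - tpoly (c^~ p) N * P p.
Proof.
move=> Dp; apply: (adj_derive (adj_factor Dp) (factor_adj Dp) XnB_central) (factor_gauge Dp).
pose ds i := dirM w (fun p => Zt p ^+ i) p.
have ds0 : ds 0%N = 0 by rewrite /ds dirM_cst.
have dsS i : ds i.+1 = ds i * Zt p + Zt p ^+ i * dirM w Zt p.
  rewrite /ds -(dirMM _ oD (smooth_ZtX i) smooth_Zt Dp).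
  by congr (dirM _ _ p); apply/funext => q; rewrite exprSr.
have dY : dirM w Yt p = - (a * dirM w Zt p).
  rewrite (@dirM_open _ _ _ D _ (fun p => - (a *m Zt p)) _ _ oD _ Dp); last first.
    by move=> q _; rewrite YtE.
  have s := smoothMxM oD (smoothMx_cst D a) smooth_Zt.
  rewrite (dirMN _ s Dp) (dirMM _ oD (smoothMx_cst D a) smooth_Zt Dp) dirM_cst.
  by rewrite mul0mx add0r.
have dsn : ds n = 0.
  rewrite /ds -(dirM_cst (k ^+ n)%:M p w); apply: (dirM_open _ oD _ Dp) => q.
  by rewrite inE => Dq; rewrite ZtX_order.
have := tpoly_adj_leibniz n' (amx_mulVl R n') (YtE p) dY ds0 (expr0 (Zt p)) dsS.
rewrite dsn polyC0 oppr0 => <-; congr (tpoly _ _ * _ + _).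
apply/funext => i; rewrite (dirMM _ oD (smooth_ZtX i) (smoothMx_cst D b) Dp).
by rewrite dirM_cst mulmx0 addr0.
Qed.

End Flow.

(** * The trivialization of the transformed solution *)

(** The recursion makes all coefficients of the curvature of a X + u and of the
    truncation cancel but the constant one, which equals u_t for a solution of
    the KW-equation. *)
Lemma tpoly_zero_curvature (A : nzRingType) (a u : A) (q dq : nat -> A) N :
  q 0%N * a = a * q 0%N ->
  (forall i, dq i + (u * q i - q i * u) = q i.+1 * a - a * q i.+1) ->
  tpoly (lin a u) 1 * tpoly q N - tpoly q N * tpoly (lin a u) 1 + tpoly dq N
  = (q N.+1 * a - a * q N.+1)%:P.
Proof.
move=> q0 e; have pe i := congr1 polyC (e i).
elim: N => [|N IH].
  have := pe 0%N; rewrite /= !(polyCB, polyCD, polyCM) => <-.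
  have := congr1 polyC q0; rewrite !polyCM.
  set ap := a%:P; set up := u%:P; set q0' := (q 0%N)%:P; set d := (dq 0%N)%:P => e0.
  have Xq : 'X * q0' = q0' * 'X by rewrite commr_polyX.
  transitivity (d + (up * q0' - q0' * up) + ap * ('X * q0' - q0' * 'X)
     - (q0' * ap - ap * q0') * 'X); first by nc_ring.
  by rewrite Xq e0 !subrr mulr0 mul0r subr0 addr0.
have := pe N.+1; move: IH; rewrite [tpoly q N.+1]/= [tpoly dq N.+1]/= !(polyCB, polyCD, polyCM).
set L := tpoly (lin a u) 1; set P := tpoly q N; set dP := tpoly dq N.
set ap := a%:P; set up := u%:P; set q1 := (q N.+1)%:P; set d := (dq N.+1)%:P.
set q2 := (q N.+2)%:P => IH <-.
have XL : 'X * L = L * 'X by rewrite commr_polyX.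
have Xq : 'X * q1 = q1 * 'X by rewrite commr_polyX.
have LE : L = ap * 'X + up by [].
transitivity ((L * P - P * L + dP) * 'X - P * ('X * L - L * 'X)
   + (L * q1 - q1 * L + d)); first by nc_ring.
rewrite IH XL subrr mulr0 subr0 LE.
transitivity (d + (up * q1 - q1 * up) + ap * ('X * q1 - q1 * 'X)); first by nc_ring.
by rewrite Xq subrr mulr0 addr0.
Qed.

(** The next three identities are the Leibniz rules behind the evolution of
    pv E adj, of its derivative in z, and the closedness of the form whose
    primitive gives the derivative of E in z. *)
Lemma leibniz_gauge (A : nzRingType) (pv e x w wh : A) :
  pv * (e * w) * x + pv * e * (x * wh - w * x) = pv * e * x * wh.
Proof. by nc_ring. Qed.

Lemma leibniz_gauge_deriv (A : nzRingType) (a pv e h x x' w wh w' wh' : A) :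
  a * (e * w) * x + a * e * (x * wh - w * x) +
  (pv * (e * w' + h * w) * x + pv * h * (x * wh - w * x)) +
  (pv * (e * w) * x' + pv * e * (x' * wh + x * wh' - (w' * x + w * x')))
  = (a * e * x + pv * h * x + pv * e * x') * wh + (pv * e * x) * wh'.
Proof. by nc_ring. Qed.

Lemma closed_form (A : nzRingType) (e ei x t x' t' dx dt : A) : ei * e = 1 ->
  dx - dt = x' * t + x * t' - (t' * x + t * x') ->
  (e * t * x' + e * dx) * ei + e * x' * - (ei * (e * t) * ei) =
  (e * x * t' + e * dt) * ei + e * t' * - (ei * (e * x) * ei).
Proof.
move=> EE zc; apply/eqP; rewrite -subr_eq0; apply/eqP.
transitivity (e * ((dx - dt) - (x' * t + x * t' - (t' * x + t * x'))) * ei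
   + e * x' * (1 - ei * e) * t * ei - e * t' * (1 - ei * e) * x * ei).
  by nc_ring.
by rewrite zc EE !subrr !(mulr0, mul0r) subr0 addr0.
Qed.

Section Trivialization.
Variables (R : realType) (n' : nat).
Local Notation n := n'.+1.
Local Notation C := R[i].
Local Notation M := 'M[C]_n.
Local Notation a := (amx R n).
Local Notation b := (amx R n ^+ n').
Local Notation tau := (tau R n).
Local Notation alpha := (alpha R n).
Variables (v : 'cV[C]_n) (k : C) (hk : k != 0).
Hypothesis uv : Bmx v \in unitmx.

Lemma pvkE (x : 'cV[C]_n) z : pvk x k z = (tpoly (lin a (Ymx x k)) 1).[z%:M].
Proof. by rewrite tpoly_linE. Qed.

(** The j-th column of B is an eigenvector of Z with eigenvalue alpha^j k. *)
Lemma pvk_kernel (x : 'cV[C]_n) (j : 'I_n) : Bmx x \in unitmx ->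
  pvk x k (alpha ^+ j * k) *m (Bmx x *m delta_mx j j) = 0.
Proof.
move=> ux; have e : pvk x k (alpha ^+ j * k) *m Bmx x =
    a *m Bmx x *m ((alpha ^+ j * k)%:M - k *: a).
  rewrite /pvk mulmxBl mulmxBr -scalemxAl mul_mx_scalar; congr (_ - _).
  by rewrite -scalemxAl mulmxKV// scalemxAr.
rewrite mulmxA e -mulmxA (_ : _ *m delta_mx j j = 0) ?mulmx0//.
apply/matrixP => r s; rewrite mulmxBl -scalemxAl mul_scalar_mx mul_diag_mx !mxE.
case: eqP => [->|_] /=; last by rewrite !mulr0 subrr.
by case: eqP => _; rewrite ?mulr0 ?mulr1 ?subrr// mulrC subrr.
Qed.

Variables (D : set (R * R)) (oD : open D) (E : R * R -> C -> M).
Hypothesis sE : forall z, smoothMx D (E^~ z).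
Hypothesis E0 : forall z, E (0, 0) z = 1%:M.
Hypothesis uE : forall p, D p -> E p k \in unitmx.
Local Notation vt := (vtilde E v k).
Local Notation Bt p := (Bmx (vt p)).
Hypothesis uB : forall p, D p -> Bt p \in unitmx.
Local Notation Yt := (Yt v k E).
Local Notation Zt := (Zt v k E).
Local Notation P p := (tpoly (fun i => Zt p ^+ i * b) n').

Lemma horner_deriv_commutator (dx dt x t : {poly M}) z : dx - dt = x * t - t * x ->
  (dx^`()).[z%:M] - (dt^`()).[z%:M] =
  (x^`()).[z%:M] * t.[z%:M] + x.[z%:M] * (t^`()).[z%:M]
  - ((t^`()).[z%:M] * x.[z%:M] + t.[z%:M] * (x^`()).[z%:M]).
Proof.
move=> /(congr1 (fun q : {poly M} => (q^`()).[z%:M])).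
by rewrite !derivB !derivM !hornerD !hornerN !hornerD !horner_scalarM.
Qed.

Lemma vt0 : vt (0, 0) = v.
Proof. by rewrite /vtilde E0 invmx1 mul1mx. Qed.

Definition adj z p : M := (P p).[z%:M].
Definition adj' z p : M := ((P p)^`()).[z%:M].

Lemma smooth_adjz z : smoothMx D (adj z).
Proof.
exact: (smoothMx_tpoly_horner oD n' z (fun i => smooth_adj oD sE uE uB i)).
Qed.

Lemma smooth_adj'z z : smoothMx D (adj' z).
Proof.
exact: (smoothMx_tpoly_deriv_horner oD n' z (fun i => smooth_adj oD sE uE uB i)).
Qed.

Lemma XnB_horner z : ('X ^+ n - (k ^+ n)%:M%:P : {poly M}).[z%:M] = (z ^+ n - k ^+ n)%:M.
Proof.
rewrite hornerD hornerXn hornerN hornerC raddfB /=; congr (_ - _).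
by rewrite rmorphXn.
Qed.

Lemma adj_pvk z p : D p -> adj z p *m pvk (vt p) k z = (z ^+ n - k ^+ n)%:M.
Proof.
move=> Dp; rewrite pvkE /adj.
have := congr1 (fun q : {poly M} => q.[z%:M]) (adj_factor uB Dp).
by rewrite /= horner_scalarM XnB_horner.
Qed.

Lemma pvk_adj z p : D p -> pvk (vt p) k z *m adj z p = (z ^+ n - k ^+ n)%:M.
Proof.
move=> Dp; rewrite pvkE /adj.
have := congr1 (fun q : {poly M} => q.[z%:M]) (factor_adj uB Dp).
by rewrite /= horner_scalarM XnB_horner.
Qed.

(** The derivative in z of p(z) adj(z) = z^n - k^n. *)
Lemma pvk_adj' z p : D p -> a *m adj z p + pvk (vt p) k z *m adj' z p
  = (z ^+ n' *+ n)%:M.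
Proof.
move=> Dp; rewrite pvkE /adj /adj'.
have := congr1 (fun q : {poly M} => (q^`()).[z%:M]) (factor_adj uB Dp).
rewrite derivM hornerD !horner_scalarM => e.
have da : ((tpoly (lin a (Ymx (vt p) k)) 1)^`()).[z%:M] = a.
  by rewrite /= derivD derivM !derivC derivX mul0r add0r mulr1 addr0 hornerC.
rewrite da in e; rewrite [LHS]e derivB derivC subr0 derivXn hornerMn hornerXn.
by rewrite raddfMn /= rmorphXn.
Qed.

Section OneFlow.
Context {w : R * R} {N : nat} {c h : nat -> R * R -> M}.
Hypothesis F : flow v k D E w N c h.
Local Notation W z p := (tpoly (c^~ p) N).[z%:M].
Local Notation Wh z p := (tpoly (h^~ p) N).[z%:M].
Local Notation W' z p := ((tpoly (c^~ p) N)^`()).[z%:M].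
Local Notation Wh' z p := ((tpoly (h^~ p) N)^`()).[z%:M].

Lemma dirM_adj z p : D p -> dirM w (adj z) p = adj z p * Wh z p - W z p * adj z p.
Proof.
move=> Dp; rewrite (dirM_tpoly_horner oD n' z w (fun i => smooth_adj oD sE uE uB i) Dp).
by rewrite (adj_flow oD sE uE uB F Dp) hornerD hornerN !horner_scalarM.
Qed.

Lemma dirM_adj' z p : D p -> dirM w (adj' z) p =
  adj' z p * Wh z p + adj z p * Wh' z p - (W' z p * adj z p + W z p * adj' z p).
Proof.
move=> Dp; rewrite (dirM_tpoly_deriv_horner oD n' z w (fun i => smooth_adj oD sE uE uB i) Dp).
rewrite (adj_flow oD sE uE uB F Dp) derivB !derivM hornerD hornerN.
by rewrite !hornerD !horner_scalarM.
Qed.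

Lemma flow_E z p : D p -> dirM w (E^~ z) p = E p z * W z p.
Proof. by move=> Dp; have [_ FE _ _] := F; rewrite FE. Qed.

(** The matrix z^n - k^n times the trivialization to be found. *)
Definition dressed_E z p : M := pvk v k z *m E p z *m adj z p.

Lemma smooth_dressed_E z : smoothMx D (dressed_E z).
Proof.
apply: smoothMxM (smooth_adjz z) => //; apply: smoothMxM (sE z) => //.
exact: smoothMx_cst.
Qed.

Lemma dressed_E_flow z p : D p -> dirM w (dressed_E z) p = dressed_E z p * Wh z p.
Proof.
move=> Dp; have sc := smoothMx_cst D (pvk v k z).
rewrite (dirMM _ oD (smoothMxM oD sc (sE z)) (smooth_adjz z) Dp).
rewrite (dirMM _ oD sc (sE z) Dp) dirM_cst mul0mx add0r flow_E// dirM_adj//.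
exact: (@leibniz_gauge M).
Qed.

(** The derivative in z of [dressed_E], H standing for that of E. *)
Definition dressed_dE (H : R * R -> M) z p : M :=
  a *m E p z *m adj z p + pvk v k z *m H p *m adj z p + pvk v k z *m E p z *m adj' z p.

(** Differentiating the evolution of [dressed_E] in z produces an extra multiple
    of [dressed_E] itself, which is zero at the parameters of interest. *)
Lemma dressed_dE_flow D' (H : R * R -> M) z p : open D' -> D' `<=` D -> smoothMx D' H -> D' p ->
  dirM w H p = E p z * W' z p + H p * W z p -> dressed_E z p = 0 ->
  dirM w (dressed_dE H z) p = dressed_dE H z p * Wh z p.
Proof.
move=> oD' sD sH Dp' eH T0; have Dp := sD _ Dp'.
have sc := smoothMx_cst D' (pvk v k z); have sa := smoothMx_cst D' a.
have sE' := smoothMxS sD (sE z).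
have sA := smoothMxS sD (smooth_adjz z); have sA' := smoothMxS sD (smooth_adj'z z).
have s1 := smoothMxM oD' sa sE'; have s2 := smoothMxM oD' sc sH.
have s3 := smoothMxM oD' sc sE'.
rewrite (dirMD w (smoothMxD oD' (smoothMxM oD' s1 sA) (smoothMxM oD' s2 sA))
  (smoothMxM oD' s3 sA') Dp').
rewrite (dirMD w (smoothMxM oD' s1 sA) (smoothMxM oD' s2 sA) Dp').
rewrite (dirMM w oD' s1 sA Dp') (dirMM w oD' s2 sA Dp') (dirMM w oD' s3 sA' Dp').
rewrite (dirMM w oD' sa sE' Dp') (dirMM w oD' sc sH Dp') (dirMM w oD' sc sE' Dp').
rewrite !dirM_cst !mul0mx !add0r eH flow_E// dirM_adj// dirM_adj'//.
transitivity (dressed_dE H z p * Wh z p + dressed_E z p * Wh' z p).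
  exact: (@leibniz_gauge_deriv M).
by rewrite T0 mul0r addr0.
Qed.

Lemma smooth_dressed_dE D' H z : open D' -> D' `<=` D -> smoothMx D' H -> smoothMx D' (dressed_dE H z).
Proof.
move=> oD' sD sH.
have sc := smoothMx_cst D' (pvk v k z); have sa := smoothMx_cst D' a.
have sE' := smoothMxS sD (sE z).
have sA := smoothMxS sD (smooth_adjz z); have sA' := smoothMxS sD (smooth_adj'z z).
by apply: smoothMxD => //; [apply: smoothMxD => //|]; do 2?apply: smoothMxM => //.
Qed.

(** Both factors evolve by the connection matrix at alpha^j k, with opposite
    signs. *)
Lemma Ecol_flow (j : nat) p : D p ->
  dirM w (fun p => E p (alpha ^+ j * k) *m (invmx tau ^+ j *m vt p)) p = 0.
Proof.
move=> Dp; have sv := smoothMxM oD (smoothMx_cst D (invmx tau ^+ j)) (smooth_vt v oD sE uE).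
rewrite (dirMM w oD (sE _) sv Dp) flow_E// (col_flow oD sE uE F j Dp).
by rewrite mulmxN -mulmxE -(mulmxA (E p _)); exact: subrr.
Qed.

End OneFlow.

Lemma pvk_unit_neq z p : D p -> pvk (vt p) k z \in unitmx -> z ^+ n != k ^+ n.
Proof.
move=> Dp u; apply/eqP => zk.
have /(prim_rootP (alpha_prim R n'))[j zj] : (z / k) ^+ n = 1.
  by rewrite expr_div_n zk divff// expf_neq0.
have {}zj : z = alpha ^+ j * k by rewrite -zj divfK.
have := pvk_kernel j (uB Dp); rewrite -zj => /(congr1 (mulmx (invmx (pvk (vt p) k z)))).
rewrite mulmx0 mulKmx// => /(congr1 (mulmx (invmx (Bt p)))).
rewrite mulmx0 mulKmx ?uB// => /matrixP/(_ j j); rewrite !mxE !eqxx /= => /eqP.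
by rewrite oner_eq0.
Qed.

Section TwoFlows.
Context {Nt : nat} {cx hx ct ht : nat -> R * R -> M}.
Hypothesis Fx : flow v k D E (1, 0) 1 cx hx.
Hypothesis Ft : flow v k D E (0, 1) Nt ct ht.
Hypothesis zc : forall p, D p ->
  tpoly (fun i => dirM (0, 1) (cx i) p) 1 - tpoly (fun i => dirM (1, 0) (ct i) p) Nt
  = tpoly (cx^~ p) 1 * tpoly (ct^~ p) Nt - tpoly (ct^~ p) Nt * tpoly (cx^~ p) 1.
Variable r : R.
Hypotheses (r0 : 0 < r) (rD : square (2 * r) `<=` D).

Let rD1 : square r `<=` D.
Proof.
have r_lt2 : r < 2 * r by rewrite ltr_pMl// ltr1n.
by move=> p [p1 p2]; apply: rD; split; apply: lt_trans r_lt2; assumption.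
Qed.

Let D0 : square r (0, 0). Proof. by split; rewrite /= normr0. Qed.

Local Notation Wx z p := (tpoly (cx^~ p) 1).[z%:M].
Local Notation Wt z p := (tpoly (ct^~ p) Nt).[z%:M].
Local Notation Wx' z p := ((tpoly (cx^~ p) 1)^`()).[z%:M].
Local Notation Wt' z p := ((tpoly (ct^~ p) Nt)^`()).[z%:M].

(** Write H = G E; then dG is the one-form with components E W'(z) E^-1, and its
    closedness is the derivative in z of the zero curvature equation. *)
Lemma parameter_derivative z : (forall p, D p -> E p z \in unitmx) ->
  exists H, [/\ smoothMx (square r) H, H (0, 0) = 0,
   forall p, square r p -> dirM (1, 0) H p = E p z * Wx' z p + H p * Wx z p &
   forall p, square r p -> dirM (0, 1) H p = E p z * Wt' z p + H p * Wt z p].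
Proof.
move=> uz; have o2 := @open_square R (2 * r); have o1 := @open_square R r.
have sEi := smoothMx_inv oD (sE z) uz.
have [scx _ _ _] := Fx; have [sct _ _ _] := Ft.
have sx := smoothMx_tpoly_deriv_horner oD 1 z scx.
have st := smoothMx_tpoly_deriv_horner oD Nt z sct.
have sEx := smoothMxM oD (sE z) sx; have sEt := smoothMxM oD (sE z) st.
pose Px p := E p z *m Wx' z p *m invmx (E p z).
pose Pt p := E p z *m Wt' z p *m invmx (E p z).
have sPx : smoothMx D Px := smoothMxM oD sEx sEi.
have sPt : smoothMx D Pt := smoothMxM oD sEt sEi.
have cl p : square (2 * r) p -> dirM (0, 1) Px p = dirM (1, 0) Pt p.
  move=> /rD Dp.
  rewrite (dirMM _ oD sEx sEi Dp) (dirMM _ oD sEt sEi Dp).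
  rewrite (dirMM _ oD (sE z) sx Dp) (dirMM _ oD (sE z) st Dp).
  rewrite !(dirM_inv _ oD (sE z) uz Dp) (flow_E Fx z Dp) (flow_E Ft z Dp).
  rewrite (dirM_tpoly_deriv_horner oD 1 z (0, 1) scx Dp) (dirM_tpoly_deriv_horner oD Nt z (1, 0) sct Dp).
  have e := horner_deriv_commutator z (zc Dp).
  have EE : invmx (E p z) * E p z = 1 by rewrite -mulmxE mulVmx ?uz.
  exact: (@closed_form M _ _ _ _ _ _ _ _ EE e).
have [G [sG G0 Gx Gt]] := quadrature_mx r0 (smoothMxS rD sPx) (smoothMxS rD sPt) cl.
have sE1 := smoothMxS rD1 (sE z).
have ee q : D q -> invmx (E q z) *m E q z = 1%:M by move=> Dq; rewrite mulVmx ?uz.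
exists (fun p => G p *m E p z); split.
- exact: smoothMxM.
- by rewrite G0 mul0mx.
- move=> p Sp; have Dp := rD1 Sp; rewrite (dirMM _ o1 sG sE1 Sp) Gx// (flow_E Fx z Dp).
  by rewrite /Px -!mulmxA ee// mulmx1 mulmxA.
- move=> p Sp; have Dp := rD1 Sp; rewrite (dirMM _ o1 sG sE1 Sp) Gt// (flow_E Ft z Dp).
  by rewrite /Pt -!mulmxA ee// mulmx1 mulmxA.
Qed.

(** At z = alpha^j k every column of adj(z) lies in the kernel of p(z), spanned by
    the j-th column of B(vt); E maps it to the j-th column of B(v), being
    constant there by [Ecol_flow], and pv(z) annihilates that column. *)
Lemma dressed_E_vanishes (j : 'I_n) p : square r p -> dressed_E (alpha ^+ j * k) p = 0.
Proof.
move=> Sp; have Dp := rD1 Sp; set z := alpha ^+ j * k.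
have sEc : smoothMx D (fun p => E p z *m (invmx tau ^+ j *m vt p)).
  apply: smoothMxM (sE z) _ => //.
  exact: (smoothMxM oD (smoothMx_cst D _) (smooth_vt v oD sE uE)).
have Ec : E p z *m (invmx tau ^+ j *m vt p) = invmx tau ^+ j *m v.
  rewrite (square_cst_mx (smoothMxS rD1 sEc) _ _ Sp).
  - by rewrite E0 mul1mx vt0.
  - by move=> q Sq; rewrite (Ecol_flow Fx)//; exact: rD1.
  - by move=> q Sq; rewrite (Ecol_flow Ft)//; exact: rD1.
have EB : E p z *m (Bt p *m delta_mx j j) = Bmx v *m delta_mx j j.
  rewrite mulmxA; apply/matrixP => s l; rewrite mxE [RHS]mxE; apply: eq_bigr => m _.
  rewrite [delta_mx _ _ _ _]mxE; case: eqP => [->|_]; last by rewrite !mulr0.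
  congr (_ * _); rewrite [Bmx v s j]mxE -Ec [LHS]mxE [RHS]mxE.
  by apply: eq_bigr => i _; rewrite BtE.
have zn : z ^+ n = k ^+ n.
  by rewrite exprMn exprAC (prim_expr_order (alpha_prim R n')) expr1n mul1r.
pose T := invmx (Bt p) *m adj z p.
have eT : z *: T = k *: (a *m T).
  have : a *m (z *: adj z p - k *: (Bt p *m a *m T)) = 0.
    have := pvk_adj z Dp; rewrite zn subrr raddf0 => <-.
    by rewrite /pvk mulmxBl mulmxBr -!scalemxAl -!scalemxAr /T !mulmxA.
  move/(congr1 (mulmx (invmx a))); rewrite mulmx0 mulKmx ?amx_unit//.
  move/(congr1 (mulmx (invmx (Bt p)))); rewrite mulmx0 mulmxBr -!scalemxAr -/T.
  by rewrite -[Bt p *m a *m T]mulmxA mulKmx ?uB// => /eqP; rewrite subr_eq0 => /eqP.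
have AT : adj z p = Bt p *m T by rewrite /T mulKVmx ?uB.
clearbody T; have Tj : T = delta_mx j j *m T.
  apply/matrixP => l s; rewrite mxE (bigD1 j)//= big1 => [|m mj]; last first.
    by rewrite mxE (negPf mj) andbF mul0r.
  rewrite addr0 mxE eqxx andbT; have [->|lj] := eqVneq l j; first by rewrite mul1r.
  rewrite mul0r; have /matrixP/(_ l s) := eT; rewrite mul_diag_mx !mxE => /eqP.
  rewrite mulrA -subr_eq0 -mulrBl mulf_eq0 => /orP[|/eqP//].
  rewrite /z (mulrC k) -mulrBl mulf_eq0 (negPf hk) orbF subr_eq0 => /eqP/alpha_inj jl.
  by rewrite jl eqxx in lj.
by rewrite /dressed_E AT Tj (mulmxA (Bt p)) -mulmxA (mulmxA (E p z)) EB mulmxA pvk_kernel// mul0mx.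
Qed.

Hypothesis uEj : forall (j : 'I_n) p, D p -> E p (alpha ^+ j * k) \in unitmx.

(** If z^n <> k^n the product [dressed_E] is divided by z^n - k^n.  Otherwise z is
    some alpha^j k, the product vanishes on the whole square, and its derivative
    in z is divided by n z^(n-1), which is nonzero as k is. *)
Lemma trivialization_exists z : exists e : R * R -> M,
  [/\ smoothMx (square r) e, e (0, 0) = 1%:M,
   forall p, square r p -> dirM (1, 0) e p = e p *m (tpoly (hx^~ p) 1).[z%:M],
   forall p, square r p -> dirM (0, 1) e p = e p *m (tpoly (ht^~ p) Nt).[z%:M] &
   forall p, square r p -> pvk (vt p) k z \in unitmx ->
     e p = pvk v k z *m E p z *m invmx (pvk (vt p) k z)].
Proof.
have o1 := @open_square R r; have D00 := rD1 D0.
have [zk|zk] := eqVneq (z ^+ n) (k ^+ n).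
  have /(prim_rootP (alpha_prim R n'))[j zj] : (z / k) ^+ n = 1.
    by rewrite expr_div_n zk divff// expf_neq0.
  have {}zj : z = alpha ^+ j * k by rewrite -zj divfK.
  have [H [sH H0 Hx Ht]] := @parameter_derivative z (fun p Dp => ltac:(rewrite zj; exact: uEj)).
  have z0 : z != 0.
    by rewrite zj mulf_neq0// expf_neq0// alpha_neq0.
  pose m : C := z ^+ n' *+ n.
  have m0 : m != 0 by rewrite /m mulrn_eq0 /= expf_neq0.
  have T0 p : square r p -> dressed_E z p = 0 by move=> Sp; rewrite zj dressed_E_vanishes.
  have sK := smooth_dressed_dE z o1 rD1 sH.
  exists (fun p => m^-1 *: dressed_dE H z p); split.
  - exact: smoothMxZ.
  - rewrite /dressed_dE H0 mulmx0 mul0mx addr0 E0 !mulmx1.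
    have := pvk_adj' z D00; rewrite vt0 => ->.
    by rewrite -/m -[m%:M]scalemx1 scalerA mulVf// scale1r.
  - move=> p Sp; rewrite (dirMZ _ _ sK Sp) (dressed_dE_flow Fx o1 rD1 sH Sp (Hx _ Sp) (T0 _ Sp)).
    by rewrite -scalemxAl.
  - move=> p Sp; rewrite (dirMZ _ _ sK Sp) (dressed_dE_flow Ft o1 rD1 sH Sp (Ht _ Sp) (T0 _ Sp)).
    by rewrite -scalemxAl.
  - by move=> p Sp /(pvk_unit_neq (rD1 Sp)); rewrite zk eqxx.
pose m : C := z ^+ n - k ^+ n.
have m0 : m != 0 by rewrite subr_eq0.
have sT := smoothMxS rD1 (smooth_dressed_E z).
exists (fun p => m^-1 *: dressed_E z p); split.
- exact: smoothMxZ.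
- rewrite /dressed_E E0 mulmx1; have := pvk_adj z D00; rewrite vt0 => ->.
  by rewrite -/m -[m%:M]scalemx1 scalerA mulVf// scale1r.
- move=> p Sp; rewrite (dirMZ _ _ sT Sp) (dressed_E_flow Fx z (rD1 Sp)).
  by rewrite -scalemxAl.
- move=> p Sp; rewrite (dirMZ _ _ sT Sp) (dressed_E_flow Ft z (rD1 Sp)).
  by rewrite -scalemxAl.
- move=> p Sp u; apply: (can_inj (mulmxK u)).
  rewrite mulmxKV// /dressed_E -scalemxAl -[_ *m adj z p *m _]mulmxA (adj_pvk z (rD1 Sp)).
  by rewrite mul_mx_scalar scalerA mulVf// scale1r.
Qed.

End TwoFlows.
End Trivialization.

(** * The transform of the sequence Q *)
Section Symmetry.
Variables (R : realType) (n' : nat).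
Local Notation n := n'.+1.
Local Notation C := R[i].
Local Notation M := 'M[C]_n.
Local Notation a := (amx R n).
Local Notation tau := (tau R n).
Local Notation alpha := (alpha R n).

Definition tauJ (X : M) : M := invmx tau *m X *m tau.

Lemma tauJM X Y : tauJ (X * Y) = tauJ X * tauJ Y.
Proof. by rewrite /tauJ -!mulmxE !mulmxA mulmxK ?tau_unit. Qed.

Lemma tauJ_sum I (r : seq I) (P : pred I) (F : I -> M) :
  tauJ (\sum_(i <- r | P i) F i) = \sum_(i <- r | P i) tauJ (F i).
Proof. by rewrite /tauJ mulmx_sumr mulmx_suml. Qed.

Lemma tauJD X Y : tauJ (X + Y) = tauJ X + tauJ Y.
Proof. by rewrite /tauJ mulmxDr mulmxDl. Qed.

Lemma tauJN X : tauJ (- X) = - tauJ X.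
Proof. by rewrite /tauJ mulmxN mulNmx. Qed.

Lemma tauJ_lie X Y : tauJ (lie X Y) = lie (tauJ X) (tauJ Y).
Proof. by rewrite /lie !mulmxE tauJD tauJN !tauJM. Qed.

Lemma tauJ_cpow (f : nat -> M) (be ga : C) m k :
  cpow (fun i => (be ^+ i * ga) *: tauJ (f i)) m k =
  (be ^+ k * ga ^+ m) *: tauJ (cpow f m k).
Proof.
elim: m k => [|m IH] k.
  rewrite /= /conv1 expr0 mulr1; case: eqP => [->|_].
    by rewrite expr0 scale1r /tauJ mulmx1 mulVmx ?tau_unit.
  by rewrite /tauJ mulmx0 mul0mx scaler0.
rewrite /= /conv tauJ_sum scaler_sumr; apply: eq_bigr => i _.
have ik : (i <= k)%N by rewrite -ltnS.
rewrite IH tauJM -scalerAr -scalerAl scalerA; congr (_ *: _).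
by rewrite -[in RHS](subnK ik) exprD exprS; ring.
Qed.

Variable Q : nat -> 'M[diffpoly R n]_n.
Hypothesis hQ : is_Qseq Q.

(** Conjugating by tau and rescaling gives another solution of the recursion with
    the same leading term and the same n-th power. *)
Lemma Qseq_tauJ D u i p : open D -> smoothMx D u ->
  (forall p, D p -> zero_diag (u p)) -> (forall p, D p -> circulant (u p)) -> D p ->
  (alpha ^+ i * alpha ^+ n') *: tauJ (Qseq Q u i p) = Qseq Q u i p.
Proof.
move=> oD su u0 uc.
have [sq lq] := lax_Qseq hQ oD su u0.
have ta : tauJ a = alpha *: a by exact: tauV_amx_tau.
have an : alpha ^+ n = 1 := prim_expr_order (alpha_prim R n').
pose f i p : M := (alpha ^+ i * alpha ^+ n') *: tauJ (Qseq Q u i p).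
have f0 p' : f 0%N p' = a.
  by rewrite /f Qseq0// ta scalerA expr0 mul1r -exprSr an scale1r.
have sJ i' : smoothMx D (fun p => tauJ (Qseq Q u i' p)).
  apply: smoothMxM (smoothMx_cst _ _) => //; apply: smoothMxM (sq i') => //.
  exact: smoothMx_cst.
have lf : lax D u f.
  split=> [i'|p' Dp']; first exact: smoothMxZ.
  split=> [|i']; first by rewrite f0 /lie subrr.
  have [_ /(_ i') e] := lq _ Dp'.
  rewrite (dirMZ _ _ (sJ i') Dp').
  have -> : dirM (1, 0) (fun p => tauJ (Qseq Q u i' p)) p' = tauJ (dirM (1, 0) (Qseq Q u i') p').
    have s1 := smoothMxM oD (smoothMx_cst D (invmx tau)) (sq i').
    by rewrite (dirM_mulr _ _ oD s1 Dp') (dirM_mull _ _ oD (sq i') Dp').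
  have lZl x (X Y : M) : lie (x *: X) Y = x *: lie X Y.
    by rewrite /lie -scalemxAl -scalemxAr scalerBr.
  have lZr x (X Y : M) : lie X (x *: Y) = x *: lie X Y.
    by rewrite /lie -scalemxAl -scalemxAr scalerBr.
  rewrite lZr lZl -scalerDr -[u p' in LHS](uc _ Dp') -/(tauJ _) -tauJ_lie.
  have -> : tauJ (dirM (1, 0) (Qseq Q u i') p') + tauJ (lie (u p') (Qseq Q u i' p')) =
    tauJ (lie (Qseq Q u i'.+1 p') a).
    by rewrite -tauJD e.
  rewrite tauJ_lie ta lZr scalerA; congr (_ *: _).
  by rewrite exprSr mulrAC.
apply: (lax_unique oD lf (conj sq lq)) => [//|p' Dp'|p' Dp'|p' Dp'].
- exact: Qseq0.
- apply/funext => k; rewrite tauJ_cpow (Qseq_power hQ oD su u0 Dp').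
  rewrite /conv1; case: eqP => [->|_].
    rewrite expr0 mul1r -exprM mulnC exprM an expr1n scale1r /tauJ.
    by rewrite mulmx1 mulVmx ?tau_unit.
  by rewrite /tauJ mulmx0 mul0mx scaler0.
- exact: (Qseq_power hQ oD su u0 Dp').
Qed.

Lemma Qseq_weight D u i p : open D -> smoothMx D u ->
  (forall p, D p -> zero_diag (u p)) -> (forall p, D p -> circulant (u p)) -> D p ->
  (i <= n.+1)%N ->
  invmx tau *m Qseq Q u i p *m tau = alpha ^+ (n.+1 - i) *: Qseq Q u i p.
Proof.
move=> oD su u0 uc Dp iN; have e := Qseq_tauJ i oD su u0 uc Dp.
rewrite -[in RHS]e scalerA -/(tauJ _) -!exprD addnA subnK//.
rewrite (_ : (n.+1 + n' = n * 2)%N); last by rewrite muln2 -addnn addSnnS.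
by rewrite exprM (prim_expr_order (alpha_prim R n')) expr1n scale1r.
Qed.

End Symmetry.

Section Dressed.
Variables (R : realType) (n' : nat).
Local Notation n := n'.+1.
Local Notation C := R[i].
Local Notation M := 'M[C]_n.
Local Notation a := (amx R n).
Local Notation b := (amx R n ^+ n').
Variables (D : set (R * R)) (u ut Y : R * R -> M) (q : nat -> R * R -> M).
Hypotheses (oD : open D) (sY : smoothMx D Y) (lq : lax D u q).
Hypothesis q0 : forall p, D p -> q 0%N p = a.
Hypothesis utE : forall p, D p -> ut p * a = a * u p + Y p * a - a * Y p.
Hypothesis Yx : forall p, D p -> dirM (1, 0) Y p = Y p * u p - ut p * Y p.

Definition dressed i p : M := dress a b (Y p) (q^~ p) i.

Let ab : a * b = 1 := amx_mulV R n'.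
Let ba : b * a = 1 := amx_mulVl R n'.

Lemma dressedE i p : dressed i.+1 p * a + dressed i p * Y p = a * q i.+1 p + Y p * q i p.
Proof. exact: (dressE (Y p) (q^~ p) i ba). Qed.

Lemma smooth_dressed i : smoothMx D (dressed i).
Proof.
have [sq _] := lq; elim: i => [|i IH]; first exact: smoothMx_cst.
have sa := smoothMx_cst D a; have sb := smoothMx_cst D b.
have s1 := smoothMxM oD sa (sq i.+1); have s2 := smoothMxM oD sY (sq i).
have s3 := smoothMxM oD IH sY.
exact: (smoothMxM oD (smoothMxB oD (smoothMxD oD s1 s2) s3) sb).
Qed.

Lemma lax_dressed : lax D ut dressed.
Proof.
have [sq lq'] := lq; split=> [|p Dp]; first exact: smooth_dressed.
split=> [|i]; first by rewrite /dressed /= /lie subrr.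
have [_ e] := lq' p Dp.
have sa := smoothMx_cst D a.
elim: i => [|i IH].
  rewrite dirM_cst add0r /lie; apply: (dress_lax0 (b := b) (u := u p) (Y := Y p) (q1 := q 1%N p)).
  - exact: ab.
  - exact: utE.
  - by have := e 0%N; rewrite (dirM_open _ oD _ Dp (B := fun=> a)) ?dirM_cst ?add0r
      /lie ?q0// => x; rewrite inE => /q0.
  - by have := dressedE 0 p; rewrite q0.
have dE : dirM (1, 0) (dressed i.+1) p * a + (dirM (1, 0) (dressed i) p * Y p
     + dressed i p * dirM (1, 0) Y p) = a * dirM (1, 0) (q i.+1) p
     + (dirM (1, 0) Y p * q i p + Y p * dirM (1, 0) (q i) p).
  have s1 := smooth_dressed i.+1; have s2 := smooth_dressed i.
  have := dirMD (1, 0) (smoothMxM oD s1 sa) (smoothMxM oD s2 sY) Dp.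
  rewrite (dirM_mulr _ _ oD s1 Dp) (dirMM _ oD s2 sY Dp) => <-.
  have := dirMD (1, 0) (smoothMxM oD sa (sq i.+1)) (smoothMxM oD sY (sq i)) Dp.
  rewrite (dirM_mull _ _ oD (sq i.+1) Dp) (dirMM _ oD sY (sq i) Dp) => <-.
  by congr (dirM _ _ p); apply/funext => x; exact: dressedE.
exact: (dress_laxS ab (utE Dp) (Yx Dp) (e i) (e i.+1) (dressedE i p) (dressedE i.+1 p) dE IH).
Qed.

End Dressed.

Section Main.
Variables (R : realType) (n' : nat).
Local Notation n := n'.+1.
Local Notation C := R[i].
Local Notation M := 'M[C]_n.
Local Notation a := (amx R n).
Local Notation b := (amx R n ^+ n').
Local Notation alpha := (alpha R n).

(** The coefficient of z in the intertwining relation along x. *)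
Lemma utilde_amx (u Y : R * R -> M) p :
  utilde u Y p * a = a * u p + Y p * a - a * Y p.
Proof.
rewrite /utilde invmx_amx /lie !mulmxE -mulrDl -mulrA amx_mulVl mulr1.
by rewrite addrA.
Qed.

Lemma zero_diag_utilde (u Y : R * R -> M) p : zero_diag (u p) -> zero_diag (utilde u Y p).
Proof.
move=> u0 i; have := congr1 (fun X : M => X i i) (utilde_amx u Y p).
rewrite -addrA [RHS]mxE (comm_amx_diag_entry (Y p) i) addr0.
rewrite -!mulmxE /amx mul_mx_diag mul_diag_mx !mxE u0 mulr0 => /eqP.
rewrite mulf_eq0 => /orP[/eqP//|].
by rewrite expf_eq0 (negPf (alpha_neq0 R n')) andbF.
Qed.

Lemma circulant_utilde (u Y : R * R -> M) p : circulant (u p) -> circulant (Y p) ->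
  circulant (utilde u Y p).
Proof.
move=> uc Yc; have ta : tauJ a = alpha *: a by exact: tauV_amx_tau.
have an0 := alpha_neq0 R n'.
have : tauJ (utilde u Y p * a) = tauJ (a * u p + Y p * a - a * Y p).
  by rewrite utilde_amx.
rewrite !tauJD tauJN !tauJM ta -[tauJ (u p)]/(_ *m _ *m _) uc -[tauJ (Y p)]/(_ *m _ *m _) Yc.
rewrite -!scalerAl -!scalerAr -scalerDr -scalerBr -utilde_amx.
move/(congr1 (fun X => alpha^-1 *: X)); rewrite !scalerA mulVf// !scale1r.
by move/(can_inj (mulmxK (amx_unit R n'))).
Qed.

Lemma smooth_utilde D (u Y : R * R -> M) : open D -> smoothMx D u -> smoothMx D Y ->
  smoothMx D (utilde u Y).
Proof.
move=> oD su sY; have sa := smoothMx_cst D a; have sb := smoothMx_cst D (invmx a).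
apply: smoothMxD => //; first by do 2?apply: smoothMxM => //.
by apply: smoothMxM => //; apply: smoothMxB => //; apply: smoothMxM.
Qed.

Lemma dress_exchange (A : nzRingType) (x y q1 q2 h1 h2 : A) :
  h2 * x + h1 * y = x * q2 + y * q1 -> y * q1 - h1 * y = h2 * x - x * q2.
Proof.
move=> e; transitivity (x * q2 + y * q1 - h1 * y - x * q2); first by nc_ring.
by rewrite -e; nc_ring.
Qed.

(** With u_t = [q, x] and Y_t = h x - x q inserted, the derivative of the
    transformed potential is [h, x]. *)
Lemma kw_transform (A : nzRingType) (x y q h : A) : x * y = 1 ->
  x * (q * x - x * q) * y + ((h * x - x * q) * x - x * (h * x - x * q)) * y
  = h * x - x * h.
Proof.
move=> xy; transitivity ((h * x - x * h) * (x * y)); first by nc_ring.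
by rewrite xy mulr1.
Qed.

End Main.

Theorem mainTheorem17 (R : realType) (n : nat) (hn : (0 < n)%N)
  (Q : nat -> 'M[diffpoly R n]_n) (hQ : is_Qseq Q)
  (v : 'cV[R[i]]_n) (k : R[i]) (hk : k != 0)
  (O1 : set (R * R)) (hO1 : open O1) (hO1_0 : O1 (0, 0))
  (u : R * R -> 'M[R[i]]_n) (hu : is_KW_solution Q O1 u)
  (E : R * R -> R[i] -> 'M[R[i]]_n) (hE : is_trivialization Q O1 u E)
  (hwave : exists (D : set (R * R)) (m : R * R -> R[i] -> 'M[R[i]]_n),
      [/\ open D, D (0, 0), D `<=` O1 & is_reduced_wave_function D u E m])
  (hB : Bmx v \in unitmx) :
  let vt := vtilde E v k in
  let Yt := fun p => Ymx (vt p) k in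
  let ut := utilde u Yt in
  exists O : set (R * R),
    [/\ open O, O `<=` O1, O (0, 0)
      & forall p, O p -> Bmx (vt p) \in unitmx] /\
    [/\ is_KW_solution Q O ut,
        exists Et : R * R -> R[i] -> 'M[R[i]]_n,
          is_trivialization Q O ut Et /\
          forall p z, O p -> pvk (vt p) k z \in unitmx ->
            Et p z = pvk v k z *m E p z *m invmx (pvk (vt p) k z)
      & is_BT_solution Q O u Yt].
Proof.
move=> {hwave}; case: n hn Q hQ v u hu E hE hB => // n' _ Q hQ v u hu E hE hB vt Yt ut.
set n := n'.+1 in Q hQ v u hu E hE hB vt Yt ut *.
have sE1 z : smoothMx O1 (E^~ z) by have [] := hE z.
have E0 z : E (0, 0) z = 1%:M by have [] := hE z.
have [su1 kw] := hu.
(* E at all the alpha^j k, not only at k, is made invertible: the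
   quadrature at an exceptional z divides by E there *)
pose g p : R[i] := \prod_(j < n) \det (E p (alpha R n ^+ j * k)).
have sg : smoothC O1 g.
  rewrite /g; apply: smoothC_prod => // j _; exact: smoothC_det.
pose U1 := O1 `&` [set p | g p != 0].
have oU1 : open U1 by exact: smoothC_neq0_open.
have U1O : U1 `<=` O1 by move=> p [].
have uEj1 (j : 'I_n) p : U1 p -> E p (alpha R n ^+ j * k) \in unitmx.
  by move=> [_ /=]; rewrite unitmxE unitfE => /prodf_neq0 /(_ j isT).
have uE1 p : U1 p -> E p k \in unitmx.
  by move=> Up; have := uEj1 ord0 p Up; rewrite expr0 mul1r.
have sE1' z := smoothMxS U1O (sE1 z).
have sB := smooth_Bt v oU1 sE1' uE1.
pose D := U1 `&` [set p | \det (Bmx (vt p)) != 0].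
have oD : open D by apply: smoothC_neq0_open => //; exact: smoothC_det.
have DU1 : D `<=` U1 by move=> p [].
have DO1 : D `<=` O1 by move=> p /DU1/U1O.
have D0 : D (0, 0).
  split; last by rewrite /= /vt vt0// -unitfE -unitmxE.
  split=> //=; apply/prodf_neq0 => j _; rewrite E0 det1; exact: oner_neq0.
have sE z : smoothMx D (E^~ z) := smoothMxS DO1 (sE1 z).
have uE p : D p -> E p k \in unitmx by move=> /DU1; exact: uE1.
have uEj (j : 'I_n) p : D p -> E p (alpha R n ^+ j * k) \in unitmx.
  by move=> /DU1; exact: uEj1.
have uB p : D p -> Bmx (vt p) \in unitmx by move=> [_ /=]; rewrite unitmxE unitfE.
have su : smoothMx D u := smoothMxS DO1 su1.
have u0 p : D p -> zero_diag (u p) by move=> /DO1/kw[].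
have uc p : D p -> circulant (u p) by move=> /DO1/kw[].
have sY : smoothMx D Yt := smooth_Yt oD sE uE uB.
have sut : smoothMx D ut := smooth_utilde oD su sY.
have ut0 p : D p -> zero_diag (ut p) by move=> /u0; exact: zero_diag_utilde.
have Yc p : D p -> circulant (Yt p) := circulant_Yt uB (p := p).
have utc p : D p -> circulant (ut p).
  by move=> Dp; apply: circulant_utilde; [exact: uc|exact: Yc].
have lq := lax_Qseq hQ oD su u0.
have hE' z p (Dp : D p) := (let: And3 _ _ H := hE z in H) p (DO1 p Dp).
(* x is the case N = 1 with c = (a, u), t the case N = n + 1 with c = Q(u) *)
pose cx i p := lin (amx R n) (u p) i.
pose hx i p := lin (amx R n) (ut p) i.
pose ct i p := Qseq Q u i p.
pose ht i p := dressed Yt ct i p.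
have Fx : flow v k D E (1, 0) 1 cx hx.
  split.
  - by case=> [|[|i]]; [exact: smoothMx_cst|exact: su|exact: smoothMx_cst].
  - by move=> z p Dp; rewrite tpoly_linE; have [] := hE' z p Dp.
  - move=> p [|[|i]] Dp // _; first by rewrite expr1 tauV_amx_tau.
    by rewrite expr0 scale1r; exact: uc.
  - move=> p Dp; split=> [||[_|//]]; [by []..|].
    by rewrite /hx /cx /= utilde_amx subrK.
have Ft : flow v k D E (0, 1) n.+1 ct ht.
  split.
  - by have [] := lq.
  - by move=> z p Dp; rewrite tpoly_horner; have [] := hE' z p Dp.
  - by move=> p i Dp iN; exact: (Qseq_weight hQ oD su u0 uc Dp iN).
  - move=> p Dp; split=> [||i _]; [exact: Qseq0|by []|exact: dressedE].
have Yx p (Dp : D p) : dirM (1, 0) Yt p = Yt p * u p - ut p * Yt p.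
  exact: (Yt_flow oD sE uE uB Fx Dp).
have Yt' p (Dp : D p) : dirM (0, 1) Yt p = Yt p * ct n.+1 p - ht n.+1 p * Yt p.
  exact: (Yt_flow oD sE uE uB Ft Dp).
have lh : lax D ut ht.
  have q0 p (_ : D p) : ct 0%N p = amx R n by exact: Qseq0.
  have e p (_ : D p) := utilde_amx u Yt p.
  exact: (lax_dressed oD sY lq q0 e Yx).
have lqt := lax_Qseq hQ oD sut ut0.
have htE i p : D p -> ht i p = Qseq Q ut i p.
  apply: (lax_unique oD lh lqt) => {i p} // p Dp; first exact: Qseq0.
  - apply: dress_power; [exact: amx_mulVl|exact: amx_mulV|exact: Qseq0|].
    exact: (Qseq_power hQ oD su u0 Dp).
  - exact: (Qseq_power hQ oD sut ut0 Dp).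
have u_t p (Dp : D p) : dirM (0, 1) u p = ct n.+2 p * amx R n - amx R n * ct n.+2 p.
  have [_ _ e1] := kw p (DO1 p Dp).
  by have [_ /(_ p Dp)[_ /(_ n.+1) e2]] := lq; exact: (etrans e1 e2).
have zc p (Dp : D p) : tpoly (fun i => dirM (0, 1) (cx i) p) 1
    - tpoly (fun i => dirM (1, 0) (ct i) p) n.+1
  = tpoly (cx^~ p) 1 * tpoly (ct^~ p) n.+1 - tpoly (ct^~ p) n.+1 * tpoly (cx^~ p) 1.
  have [_ /(_ p Dp)[l0 lS]] := lq.
  have q0a : ct 0%N p * amx R n = amx R n * ct 0%N p.
    by apply/eqP; rewrite -subr_eq0; apply/eqP.
  have := @tpoly_zero_curvature _ (amx R n) (u p) (ct^~ p) (fun i => dirM (1, 0) (ct i) p) n.+1 q0a lS.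
  rewrite -u_t// => e.
  have -> : tpoly (fun i => dirM (0, 1) (cx i) p) 1 = (dirM (0, 1) u p)%:P.
    by rewrite /= dirM_cst polyC0 mul0r add0r.
  by rewrite -e addrK.
have [rho rho0 rhoD] := square_nbhs oD D0.
pose r := rho / 2.
have r0 : 0 < r by rewrite divr_gt0.
have rD : square (2 * r) `<=` D by rewrite /r mulrC divfK.
have r1D : square r `<=` D.
  have r_lt2 : r < 2 * r by rewrite ltr_pMl// ltr1n.
  by move=> p [p1 p2]; apply: rD; split; apply: lt_trans r_lt2; assumption.
have oS := @open_square R r.
have ut_t p (Dp : D p) : dirM (0, 1) ut p = lie (ht n.+2 p) (amx R n).
  have sa := smoothMx_cst D (amx R n); have sb := smoothMx_cst D (invmx (amx R n)).
  have s1 := smoothMxM oD sa su; have s2 := smoothMxM oD sY sa; have s3 := smoothMxM oD sa sY.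
  have e1 := dirMD (0, 1) (smoothMxM oD s1 sb) (smoothMxM oD (smoothMxB oD s2 s3) sb) Dp.
  rewrite [LHS]e1 (dirM_mulr _ _ oD s1 Dp) (dirM_mulr _ _ oD (smoothMxB oD s2 s3) Dp).
  rewrite (dirMB _ oD s2 s3 Dp) (dirM_mull _ _ oD su Dp) (dirM_mulr _ _ oD sY Dp).
  rewrite (dirM_mull _ _ oD sY Dp) u_t// invmx_amx.
  have -> : dirM (0, 1) Yt p = ht n.+2 p * amx R n - amx R n * ct n.+2 p.
    rewrite (Yt' p Dp).
    exact: (@dress_exchange 'M[R[i]]_n'.+1 _ _ _ _ _ _ (dressedE Yt ct n.+1 p)).
  exact: (@kw_transform 'M[R[i]]_n'.+1 _ _ _ _ (amx_mulV R n')).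
exists (square r); split; first split=> //.
- by move=> p /r1D/DO1.
- by split; rewrite /= normr0.
- by move=> p /r1D; exact: uB.
split.
- split=> [|p /r1D Dp]; first exact: (smoothMxS r1D sut).
  split; [exact: utc|exact: ut0|].
  have [_ /(_ p Dp)[_ /(_ n.+1) e]] := lqt.
  by rewrite [RHS]e -(htE _ _ Dp) dtME; exact: ut_t.
- have T z := trivialization_exists hk hB oD sE E0 uE uB Fx Ft zc r0 rD uEj z.
  have [e He] := choice T.
  exists (fun p z => e z p); split=> [z|p z Sp]; last by have [_ _ _ _] := He z; apply.
  have [se e0 ex et _] := He z; split=> // p Sp; split.
    by rewrite dxME ex// tpoly_linE.
  rewrite dtME et// tpoly_horner; congr (_ *m _); apply: eq_bigr => j _.
  by rewrite (htE _ _ (r1D _ Sp)).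
- split=> [|p /r1D Dp]; first exact: (smoothMxS r1D sY).
  split; [exact: Yx| |exact: Yc].
  by rewrite dtME (Yt' p Dp) (htE _ _ Dp).
Qed.
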